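(* Let the triplet $(n,s,\theta)$ be admissible. Then the bilinear estimate $$\|\overline u\,\overline v\|_{X^{s,\theta-1}(\mathbb{R}^n\times\mathbb{R})}\lesssim\|u\|_{X^{s,\theta}(\mathbb{R}^n\times\mathbb{R})}\,\|v\|_{X^{s,\theta}(\mathbb{R}^n\times\mathbb{R})}$$ is valid, i.e. there is a constant $C=C(n,s,\theta)>0$ such that $\|\overline u\,\overline v\|_{X^{s,\theta-1}}\le C\|u\|_{X^{s,\theta}}\|v\|_{X^{s,\theta}}$ for all complex-valued Schwartz functions $u,v$ on $\mathbb{R}^n\times\mathbb{R}$.
   Context: The triplet $(n,s,\theta)$ (with $s,\theta\in\mathbb{R}$) is called admissible if one of the following holds: (i) $n=2$, $\frac12<\theta\ne\frac34$, and $\max\{\theta-\frac54,\,2\theta-2\}\le s<0$; (ii) $n=2$, $\theta=\frac34$, and $-\frac12<s<0$; (iii) $n=3$, $\theta>\frac12$, and $2\theta-\frac32\le s<0$. For $\sigma,\beta\in\mathbb{R}$, $$\|w\|_{X^{\sigma,\beta}(\mathbb{R}^n\times\mathbb{R})}=\|\langle\xi\rangle^\sigma\langle\tau-|\xi|^2\rangle^\beta\widehat w(\xi,\tau)\|_{L^2_{\xi,\tau}(\mathbb{R}^n\times\mathbb{R})},$$ where $\langle a\rangle=(1+|a|^2)^{1/2}$ and $\widehat w(\xi,\tau)=\int_{\mathbb{R}^n\times\mathbb{R}} e^{-i(x\xi+t\tau)}w(x,t)\,dx\,dt$. The bar denotes complex conjugation. *)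

(* Defs.v *)
From HB Require Import structures.
From mathcomp Require Import all_boot all_order all_algebra.
From mathcomp Require Import complex.
From mathcomp Require Import all_classical all_reals all_analysis.

Set Implicit Arguments.
Unset Strict Implicit.
Unset Printing Implicit Defensive.
Import Order.TTheory GRing.Theory Num.Theory.
Import numFieldNormedType.Exports.
Import ComplexField.

Local Open Scope classical_set_scope.
Local Open Scope ring_scope.
Local Open Scope complex_scope.

(* The Borel sigma-algebra of R^n, generated by the coordinate maps. *)
Section measurable_rV.
Context {R : realType} (n : nat).

Let coord (i : 'I_n) (x : 'rV[R]_n) : measurableTypeR R := x ord0 i.

Let rV_set0 : g_sigma_preimage coord set0.
Proof. exact: sigma_algebra0. Qed.

Let rV_setC A : g_sigma_preimage coord A -> g_sigma_preimage coord (~` A).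
Proof. exact: sigma_algebraC. Qed.

Let rV_bigcup (F : (set 'rV[R]_n)^nat) :
  (forall i, g_sigma_preimage coord (F i)) ->
  g_sigma_preimage coord (\bigcup_i (F i)).
Proof. exact: sigma_algebra_bigcup. Qed.

HB.instance Definition _ :=
  @isMeasurable.Build (measure_tuple_display default_measure_display)
    'rV[R]_n (g_sigma_preimage coord) rV_set0 rV_setC rV_bigcup.

Lemma measurable_coord_rV (i : 'I_n) :
  measurable_fun [set: 'rV[R]_n]
    (fun x => x ord0 i : measurableTypeR R).
Proof.
move=> _ Y mY; rewrite setTI; apply: sub_sigma_algebra => /=.
rewrite -bigcup_seq/=; exists i => /=; first by rewrite mem_index_enum.
by exists Y => //; rewrite setTI.
Qed.

Lemma measurable_fun_rV d (T : measurableType d) (f : T -> 'rV[R]_n) :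
  (forall i, measurable_fun [set: T]
    (fun t => f t ord0 i : measurableTypeR R)) ->
  measurable_fun [set: T] f.
Proof.
move=> mf.
have H : g_sigma_preimage (fun i t => coord i (f t)) `<=` measurable.
  apply: smallest_sub; first exact: sigma_algebra_measurable.
  rewrite -bigcup_seq; apply: bigcup_sub => i _.
  by move=> A [B mB <-]; exact: mf.
by move=> _ A mA; apply: H; rewrite (g_sigma_preimage_comp coord f); exists A.
Qed.

End measurable_rV.

(* The library registers sigma-finiteness of m1 \x m2 only for subprobabilities. *)
Lemma sigma_finite_product_measure1 d1 d2 (T1 : measurableType d1)
    (T2 : measurableType d2) (R : realType)
    (m1 : {sigma_finite_measure set T1 -> \bar R})
    (m2 : {sigma_finite_measure set T2 -> \bar R}) :
  sigma_finite setT (m1 \x m2)%E.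
Proof.
have /sigma_finiteP[F [TF ndF Foo]] := sigma_finiteT m1.
have /sigma_finiteP[G [TG ndG Goo]] := sigma_finiteT m2.
exists (fun n => F n `*` G n).
  rewrite -setXTT TF TG predeqE => -[x y]; split.
    move=> [/= [n _ Fnx] [k _ Gky]]; exists (maxn n k) => //; split.
    - by move: x Fnx; exact/subsetPset/ndF/leq_maxl.
    - by move: y Gky; exact/subsetPset/ndG/leq_maxr.
  by move=> [n _ []/= ? ?]; split; exists n.
move=> k; have [? ?] := Foo k; have [? ?] := Goo k.
split; first exact: measurableX.
by rewrite product_measure1E// lte_mul_pinfty// ge0_fin_numE.
Qed.

(* Lebesgue measure on R^n, by recursion on n: the image of
   lebesgue_measure \x (Lebesgue measure on R^n) under (a, x) |-> (a, x_1, .., x_n). *)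
Section lebesgue_rV.
Context {R : realType}.

Definition cons_rV n (p : measurableTypeR R * 'rV[R]_n) : 'rV[R]_n.+1 :=
  @row_mx R 1 1 n (const_mx p.1) p.2.

Definition uncons_rV n (x : 'rV[R]_n.+1) : measurableTypeR R * 'rV[R]_n :=
  (x ord0 ord0, \row_i x ord0 (lift ord0 i)).

Lemma cons_rV0 n p : @cons_rV n p ord0 ord0 = p.1.
Proof.
have -> : (ord0 : 'I_n.+1) = lshift n (ord0 : 'I_1) by apply: val_inj.
by apply: (etrans (@row_mxEl R 1 1 n _ _ _ _)); rewrite mxE.
Qed.

Lemma cons_rVS n p i : @cons_rV n p ord0 (lift ord0 i) = p.2 ord0 i.
Proof.
have -> : lift ord0 i = rshift 1 i by apply: val_inj.
exact: (@row_mxEr R 1 1 n).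
Qed.

Lemma cons_rVK n : cancel (@cons_rV n) (@uncons_rV n).
Proof.
move=> [a x]; rewrite /uncons_rV cons_rV0; congr pair.
by apply/rowP => i; rewrite mxE cons_rVS.
Qed.

Lemma measurable_cons_rV n : measurable_fun setT (@cons_rV n).
Proof.
apply: measurable_fun_rV => i; have [j ->|->] := unliftP ord0 i.
  under eq_fun do rewrite cons_rVS.
  exact: (measurableT_comp (measurable_coord_rV j) measurable_snd).
under eq_fun do rewrite cons_rV0.
exact: measurable_fst.
Qed.

Lemma measurable_uncons_rV n : measurable_fun setT (@uncons_rV n).
Proof.
apply/measurable_fun_pairP; split => /=; first exact: measurable_coord_rV.
apply: measurable_fun_rV => i /=; under eq_fun do rewrite mxE.
exact: measurable_coord_rV.
Qed.

Section step.
Context (n : nat) (m : {sigma_finite_measure set 'rV[R]_n -> \bar R}).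

Definition lebesgue_rV_step : set 'rV[R]_n.+1 -> \bar R :=
  pushforward (lebesgue_measure \x m)%E (@cons_rV n).

HB.instance Definition _ := Measure.copy lebesgue_rV_step
  (measure_function_pushforward__canonical__measure_function_Measure
    [the measure _ _ of (lebesgue_measure \x m)%E] (@measurable_cons_rV n)).

Let lebesgue_rV_step_sigma_finite : sigma_finite setT lebesgue_rV_step.
Proof.
have [F FT Foo] := sigma_finite_product_measure1 (@lebesgue_measure R) m.
exists (fun k => @uncons_rV n @^-1` F k).
  by rewrite -preimage_bigcup -FT preimage_setT.
move=> k; have [mF Fk] := Foo k; split.
  by rewrite -[X in measurable X]setTI; exact: measurable_uncons_rV.
rewrite /lebesgue_rV_step /pushforward -comp_preimage.
by rewrite (_ : _ \o _ = id) ?preimage_id//; apply/funext/cons_rVK.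
Qed.

HB.instance Definition _ := Measure_isSigmaFinite.Build _ _ _
  lebesgue_rV_step lebesgue_rV_step_sigma_finite.

End step.

Fixpoint lebesgue_rV n : {sigma_finite_measure set 'rV[R]_n -> \bar R} :=
  match n with
  | 0 => [the {sigma_finite_measure set 'rV[R]_0 -> \bar R} of \d_(0 : 'rV[R]_0)]
  | k.+1 => [the {sigma_finite_measure set 'rV[R]_k.+1 -> \bar R}
              of lebesgue_rV_step (lebesgue_rV k)]
  end.

Lemma lebesgue_rV_box n (A : 'I_n -> set (measurableTypeR R)) :
  (forall i, measurable (A i)) ->
  lebesgue_rV n [set x : 'rV[R]_n | forall i, A i (x ord0 i)] =
  (\prod_(i < n) lebesgue_measure (A i))%E.
Proof.
elim: n A => [|n IH] A mA.
  rewrite big_ord0 /= diracE mem_set //=; by case.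
move: (@big_ord_recl _ 1%E *%E n (fun i => lebesgue_measure (A i))) => ->.
rewrite -IH //= /lebesgue_rV_step /pushforward.
rewrite -product_measure1E //; last first.
  rewrite (_ : mkset _ = \big[setI/setT]_(i < n) ((fun x : 'rV[R]_n => x ord0 i : measurableTypeR R) @^-1` (A (lift ord0 i)))).
    apply: bigsetI_measurable => i _; rewrite -[X in measurable X]setTI.
    exact: measurable_coord_rV.
  rewrite -bigcap_seq; apply/seteqP; split => [x H i _|x H i]; first exact: H.
  by apply: H => /=; rewrite mem_index_enum.
congr product_measure1; apply/seteqP; split => [p H /=|p [H1 H2] i /=].
  by split => [|i]; [have := H ord0; rewrite cons_rV0|have := H (lift ord0 i); rewrite cons_rVS].
by have [j ->|->] := unliftP ord0 i; rewrite ?cons_rVS ?cons_rV0 //; exact: H2.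
Qed.

End lebesgue_rV.
Arguments lebesgue_rV : clear implicits.

Section euclidean.
Context {R : realType} {n : nat}.
Implicit Types x y : 'rV[R]_n.

Definition dot x y : R := \sum_(i < n) x ord0 i * y ord0 i.

(* The library norm `|x| on 'rV[R]_n is the sup norm. *)
Definition enorm x : R := Num.sqrt (dot x x).

End euclidean.

Section spacetime.
Context {R : realType} {n : nat}.

Definition lebesgue_spacetime := (lebesgue_rV R n \x @lebesgue_measure R)%E.
HB.instance Definition _ := Measure.on lebesgue_spacetime.
HB.instance Definition _ := Measure_isSigmaFinite.Build _ _ _
  lebesgue_spacetime (sigma_finite_product_measure1 _ _).

(* Coordinates on R^n x R are indexed by option 'I_n; None is the time variable. *)
Definition st_coord (p : 'rV[R]_n * R) (j : option 'I_n) : R :=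
  if j is Some i then p.1 ord0 i else p.2.

Definition st_basis (j : option 'I_n) : 'rV[R]_n * R :=
  if j is Some i then (delta_mx ord0 i, 0) else (0, 1).

Definition partials (js : seq (option 'I_n)) (f : 'rV[R]_n * R -> R) :=
  foldr (fun j (g : 'rV[R]_n * R -> R) p => 'D_(st_basis j) g p) f js.

Definition smooth (f : 'rV[R]_n * R -> R) : Prop :=
  forall js, continuous (partials js f) /\
    forall j p, derivable (partials js f) p (st_basis j).

Definition real_schwartz (f : 'rV[R]_n * R -> R) : Prop :=
  smooth f /\
  forall (a : option 'I_n -> nat) (js : seq (option 'I_n)),
    exists M : R, forall p,
      `|(\prod_j st_coord p j ^+ a j) * partials js f p| <= M.

Definition schwartz (u : 'rV[R]_n * R -> R[i]) : Prop :=
  real_schwartz (fun p => complex.Re (u p)) /\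
  real_schwartz (fun p => complex.Im (u p)).

Definition cintegral (g : 'rV[R]_n * R -> R[i]) : R[i] :=
  (\int[lebesgue_spacetime]_p complex.Re (g p)) +i*
  (\int[lebesgue_spacetime]_p complex.Im (g p)).

(* expi a = e^(i a) *)
Definition expi (a : R) : R[i] := cos a +i* sin a.

Definition fourier (w : 'rV[R]_n * R -> R[i]) (q : 'rV[R]_n * R) : R[i] :=
  cintegral (fun p => expi (- (dot p.1 q.1 + p.2 * q.2)) * w p).

Definition bracket (a : R) : R := Num.sqrt (1 + a ^+ 2).

Definition Xnorm (sigma beta : R) (w : 'rV[R]_n * R -> R[i]) : \bar R :=
  Lnorm lebesgue_spacetime 2%:E
    (fun q => (bracket (enorm q.1) `^ sigma
               * bracket (q.2 - enorm q.1 ^+ 2) `^ beta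
               * Normc.normc (fourier w q))%:E).

End spacetime.

Definition admissible {R : realType} (n : nat) (s theta : R) : Prop :=
  [\/ [/\ n = 2%N, 1 / 2 < theta, theta != 3 / 4,
          Num.max (theta - 5 / 4) (2 * theta - 2) <= s & s < 0],
      [/\ n = 2%N, theta = 3 / 4, - (1 / 2) < s & s < 0]
    | [/\ n = 3%N, 1 / 2 < theta, 2 * theta - 3 / 2 <= s & s < 0]].

(* Main.v *)
From HB Require Import structures.
Require Import Defs.
From mathcomp Require Import all_boot all_order all_algebra.
From mathcomp Require Import complex ring lra.
From mathcomp Require Import all_classical all_reals all_analysis.
From mathcomp Require Import measurable_realfun.

(** Write a = -s > 0 and, for a space-time frequency q = (xi, tau), let
    b = <xi> and L = <tau - |xi|^2>.  Up to a constant, the Fourier transform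
    of conj u conj v at q is at most the integral over p of
    |u^(p)| |v^(-p-q)| (fourier_conjM_le).  Testing it against itself turns
    the estimate into an L^2 bound for a trilinear form on triples of
    frequencies of sum zero (duality_bound), whose kernel is
      b1^a b2^a b3^-a L1^-theta L2^-theta L3^(theta-1)   (bilinear_weight),
    the third frequency being that of the product.

    This form is bounded for the following reasons.  The modulations
    tau_j - |xi_j|^2 of such a triple add up to - (|xi_1|^2 + |xi_2|^2 +
    |xi_3|^2): conjugating both factors makes the three quadratic terms add
    up instead of cancelling.  Hence the largest L_j is at least a multiple
    of N^2, where N = b1 + b2 + b3 (sum_sqr_modulation_le); it pays for the
    exponent theta - 1, and what remains is L^-theta for two of the three
    frequencies times b1^a b2^a b3^-a N^(2 theta - 2) (modulation_weight_le).

    If b3 is comparable to N, this last weight is at most N^(-(d-2)/2) in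
    dimension d.  A Schur test then asks for the integral of L1^(-2 theta)
    L2^(-2 theta) over pairs of frequencies with a prescribed sum; it is an
    integral over spheres, which N^(-(d-2)) makes uniformly bounded
    (trilinear_bounded_elliptic).

    If b3 is much smaller than N, then b1 and b2 are close to each other and
    any two of the three frequencies are separated by a multiple of N, hence
    also one of their coordinates, say x1 and x2.  With the modulations and
    the other coordinates frozen, the frequencies run over two parabolas, and
    (x1, x2) -> (x1 + x2, x1^2 + x2^2) has Jacobian 2 |x1 - x2|, so the
    Cauchy-Schwarz inequality gains a factor N^(-1/2)
    (integral_paraboloid_sum_le, trilinear_bounded_freeze).  The remaining
    loss is the integral of <y>^(-2a) over a cube of side N in dimension
    d - 1 (integral_cube_bracket_le), and admissibility of (n, s, theta) is
    what makes the product of all powers of N bounded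
    (trilinear_bounded_admissible).

    The bound on the Fourier transform of a product comes from Abel
    summation: with an exponential convergence factor all exchanges of
    integrals are absolutely convergent, and the factor corresponds to
    smoothing by a Poisson kernel, which disappears in the limit
    (normc_cint_mul_le). *)

Set Implicit Arguments.
Unset Strict Implicit.
Unset Printing Implicit Defensive.
Import Order.TTheory GRing.Theory Num.Theory.
Import numFieldNormedType.Exports.
Import ComplexField.
Local Open Scope classical_set_scope.
Local Open Scope ring_scope.

(** * Changes of variables and the Cauchy-Schwarz inequality *)

Section transfer.
Context d1 d2 (X : measurableType d1) (Y : measurableType d2) (R : realType).
Variables (phi : X -> Y) (mphi : measurable_fun setT phi).
Variables (mu : {measure set X -> \bar R}) (nu : {measure set Y -> \bar R}).
Hypothesis pres : forall A, measurable A -> mu (phi @^-1` A) = nu A.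
Local Open Scope ereal_scope.

Lemma ge0_integral_preserving (f : Y -> \bar R) :
  measurable_fun setT f -> (forall y, 0 <= f y) ->
  \int[nu]_y f y = \int[mu]_x f (phi x).
Proof.
move=> mf f0.
rewrite -(@ge0_integral_pushforward _ _ X Y R phi mphi mu setT f) //.
by apply: eq_measure_integral => A mA _; rewrite -pres.
Qed.

Lemma integral_preserving (f : Y -> \bar R) :
  measurable_fun setT f ->
  \int[nu]_y f y = \int[mu]_x f (phi x).
Proof.
move=> mf; rewrite integralE [RHS]integralE.
rewrite (ge0_integral_preserving (measurable_funepos mf)) //.
rewrite (ge0_integral_preserving (measurable_funeneg mf)) //.
congr (_ - _); apply: eq_integral => x _.
  by rewrite !funepos.unlock.
by rewrite !funeneg.unlock.
Qed.

End transfer.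

Section cauchy_schwarz.
Local Open Scope ereal_scope.

(** The choice t = sqrt b / sqrt a makes the two terms on the right equal. *)
Lemma sqr_le_mul_of_am_gm (R : realType) (x a b : \bar R) :
  0 <= x -> 0 < a -> 0 < b ->
  (forall t : R, (0 < t)%R -> x *+ 2 <= t%:E * a + (t^-1)%:E * b) ->
  x ^+ 2 <= a * b.
Proof.
move=> x0 a0 b0 H.
have [->|aoo] := eqVneq a +oo; first by rewrite gt0_mulye // leey.
have [->|boo] := eqVneq b +oo; first by rewrite gt0_muley // leey.
case: a a0 aoo H => [a||] //; rewrite lte_fin => a0 _ H.
case: b b0 boo H => [b||] //; rewrite lte_fin => b0 _ H.
have sa : (0 < Num.sqrt a)%R by rewrite sqrtr_gt0.
have sb : (0 < Num.sqrt b)%R by rewrite sqrtr_gt0.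
have := H (Num.sqrt b / Num.sqrt a)%R (divr_gt0 sb sa).
have := sqr_sqrtr (ltW a0); have := sqr_sqrtr (ltW b0).
move: (Num.sqrt a) (Num.sqrt b) sa sb => p q p0 q0 {H} <- <-.
case: x x0 => [x||] // x0; rewrite -!EFinM -EFinD -EFin_natmul !lee_fin invf_div.
have -> : (q / p * p ^+ 2 + p / q * q ^+ 2 = (p * q) *+ 2)%R.
  by field; rewrite !gt_eqF.
rewrite ler_pMn2r // => xab; rewrite -expr2 -exprMn.
by rewrite ler_sqr ?nnegrE // mulr_ge0 // ltW.
Qed.

Lemma am_gm_of_sqr_le_mul (R : realType) (x a b : \bar R) (t : R) :
  0 <= x -> 0 <= a -> 0 <= b -> (0 < t)%R -> x ^+ 2 <= a * b ->
  x *+ 2 <= t%:E * a + (t^-1)%:E * b.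
Proof.
move=> x0 a0 b0 t0.
have t10 : (0 < t^-1)%R by rewrite invr_gt0.
case: a a0 => [a||] // a0; last first.
  by move=> _; rewrite gt0_muley ?lte_fin // addye ?leey //;
     rewrite gt_eqF // (lt_le_trans ltNy0) ?mule_ge0 // lee_fin ltW.
case: b b0 => [b||] // b0; last first.
  by move=> _; rewrite [X in _ + X]gt0_muley ?lte_fin // addey ?leey //.
case: x x0 => [x||] // x0.
rewrite -!EFinM -EFinD -EFin_natmul !lee_fin -expr2 => h.
rewrite !lee_fin in x0 a0 b0.
rewrite -(ler_sqr _ _) ?nnegrE ?mulrn_wge0 ?addr_ge0 ?mulr_ge0 ?(ltW t10) ?(ltW t0) //.
apply: (@le_trans _ _ (4 * (a * b))%R).
  have -> : ((x *+ 2) ^+ 2 = 4 * x ^+ 2)%R by rewrite -mulr_natl; ring.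
  by rewrite ler_wpM2l.
have <- : (4 * ((t * a) * (t^-1 * b)) = 4 * (a * b))%R by field; rewrite gt_eqF.
rewrite -subr_ge0; move: (t * a)%R (_ * b)%R => u v.
have -> : ((u + v) ^+ 2 - 4 * (u * v) = (u - v) ^+ 2)%R by ring.
exact: sqr_ge0.
Qed.

Context d (T : measurableType d) (R : realType) (mu : {measure set T -> \bar R}).

Lemma integral_eq0_of_sqr_le_mul (f A B : T -> \bar R) :
  measurable_fun setT f -> measurable_fun setT A ->
  (forall x, 0 <= f x) -> (forall x, 0 <= A x) ->
  (forall x, f x ^+ 2 <= A x * B x) ->
  \int[mu]_x A x = 0 -> \int[mu]_x f x = 0.
Proof.
move=> mf mA f0 A0 fAB IA.
have /(ae_eq_integral_abs mu measurableT mA).1 A_ae : \int[mu]_x `|A x| = 0.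
  by rewrite -IA; apply: eq_integral => x _; rewrite gee0_abs.
have -> : \int[mu]_x f x = \int[mu]_x `|f x|.
  by apply: eq_integral => x _; rewrite gee0_abs.
apply/(ae_eq_integral_abs mu measurableT mf).
apply: filterS A_ae => x /= Ax _; move: (fAB x); rewrite Ax //= mul0e => fx.
have : f x ^+ 2 == 0 by rewrite eq_le fx sqre_ge0.
by rewrite expe_eq0 /= => /eqP.
Qed.

(** Integrating the inequalities 2 f <= t A + B / t and choosing t afterwards
    reduces Cauchy-Schwarz to monotonicity of the integral. *)
Lemma cauchy_schwarz_integral (f A B : T -> \bar R) :
  measurable_fun setT f -> measurable_fun setT A -> measurable_fun setT B ->
  (forall x, 0 <= f x) -> (forall x, 0 <= A x) -> (forall x, 0 <= B x) ->
  (forall x, f x ^+ 2 <= A x * B x) ->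
  (\int[mu]_x f x) ^+ 2 <= \int[mu]_x A x * \int[mu]_x B x.
Proof.
move=> mf mA mB f0 A0 B0 fAB.
have IA0 : 0 <= \int[mu]_x A x by exact: integral_ge0.
have IB0 : 0 <= \int[mu]_x B x by exact: integral_ge0.
have [IA|IA] := eqVneq (\int[mu]_x A x) 0.
  by rewrite (integral_eq0_of_sqr_le_mul mf mA f0 A0 fAB IA) expe2 mule0 mule_ge0.
have [IB|IB] := eqVneq (\int[mu]_x B x) 0.
  have fBA x : f x ^+ 2 <= B x * A x by rewrite muleC.
  by rewrite (integral_eq0_of_sqr_le_mul mf mB f0 B0 fBA IB) expe2 mule0 mule_ge0.
apply: sqr_le_mul_of_am_gm; rewrite ?lt0e ?IA ?IB //; first exact: integral_ge0.
move=> t t0.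
have t10 : (0 <= t^-1)%R by rewrite invr_ge0 ltW.
rewrite -!ge0_integralZl ?lee_fin ?(ltW t0) // -ge0_integralD //; last 4 first.
- by move=> x _; rewrite mule_ge0 ?lee_fin ?(ltW t0).
- exact: measurable_funeM.
- by move=> x _; rewrite mule_ge0 ?lee_fin ?(ltW t0).
- exact: measurable_funeM.
rewrite mule2n -ge0_integralD //; apply: ge0_le_integral => //.
- by move=> x _; rewrite adde_ge0.
- exact: emeasurable_funD.
- by apply: emeasurable_funD; exact: measurable_funeM.
- move=> x _; rewrite -mule2n; exact: am_gm_of_sqr_le_mul.
Qed.

End cauchy_schwarz.

(** * Lebesgue measure on R^n *)

Section rV_unique.
Context {R : realType}.
Local Notation mR := (measurableTypeR R).
Local Notation leb := (@lebesgue_measure R).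

Definition box n (A : 'I_n -> set mR) : set 'rV[R]_n :=
  [set x | forall i, A i (x ord0 i)].

Lemma measurable_box n (A : 'I_n -> set mR) :
  (forall i, measurable (A i)) -> measurable (box A).
Proof.
move=> mA; rewrite (_ : box A = \big[setI/setT]_(i < n)
    ((fun x : 'rV[R]_n => x ord0 i : mR) @^-1` A i)).
  apply: bigsetI_measurable => i _; rewrite -[X in measurable X]setTI.
  exact: measurable_coord_rV.
rewrite -bigcap_seq; apply/seteqP; split => [x H i _|x H i]; first exact: H.
by apply: H => /=; rewrite mem_index_enum.
Qed.

(** Boxes form a pi-system that generates the sigma-algebra and exhausts the space. *)
Lemma lebesgue_rV_unique n (mu : {measure set 'rV[R]_n -> \bar R}) :
  (forall A, (forall i, measurable (A i)) ->
     mu (box A) = (\prod_(i < n) leb (A i))%E) ->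
  forall E, measurable E -> lebesgue_rV R n E = mu E.
Proof.
move=> muA E mE.
pose G := [set B | exists2 A : 'I_n -> set mR,
  (forall i, measurable (A i)) & B = box A].
pose g (k : nat) := box (fun _ : 'I_n => `[- k%:R, k%:R]%classic : set mR).
have gE k : (forall i : 'I_n, measurable (`[- k%:R, k%:R]%classic : set mR)).
  by move=> _; exact: measurable_itv.
apply: (measure_unique G g) => //.
- apply/seteqP; split.
    apply: sub_sigma_algebra2 => B; rewrite -bigcup_seq => -[i _ [C mC <-]].
    exists (fun j => if j == i then C else setT); first by move=> j; case: ifP.
    rewrite setTI; apply/seteqP; split => x /=.
      by move=> Cx j; case: eqP => [->|].
    by move/(_ i); rewrite eqxx.
  by apply: smallest_sub; [exact: sigma_algebra_measurable|
    move=> _ [A mA ->]; exact: measurable_box].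
- move=> _ _ [A mA ->] [B mB ->]; exists (fun i => A i `&` B i).
    by move=> i; exact: measurableI.
  apply/seteqP; split => x /=; first by move=> [Ax Bx] i; split; [exact: Ax|exact: Bx].
  by move=> H; split => i; have [] := H i.
- by move=> k; exists (fun=> `[- k%:R, k%:R]%classic).
- apply/seteqP; split => // x _.
  exists (Num.truncn (\sum_(i < n) `|x ord0 i|)).+1 => // i /=.
  rewrite in_itv /= -ler_norml.
  have : \sum_(i < n) `|x ord0 i| < (Num.truncn (\sum_(i < n) `|x ord0 i|)).+1%:R.
    exact: truncnS_gt.
  move=> /ltW; apply: le_trans.
  by rewrite (bigD1 i) //= lerDl sumr_ge0.
- by move=> _ [A mA ->]; rewrite muA //; exact: lebesgue_rV_box.
- move=> k; have gk : lebesgue_rV R n (g k) = _ := lebesgue_rV_box (gE k).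
  suff : (lebesgue_rV R n (g k) < +oo)%E by [].
  rewrite gk {gk}.
  have -> : (\prod_(i < n) leb `[(- k%:R)%R, k%:R%R] = \prod_(i < n) (k%:R - - k%:R : R)%:E)%E.
    apply: eq_bigr => i _; rewrite lebesgue_measure_itv /= lte_fin.
    case: ltP => //; rewrite -subr_ge0; have := ler0n R k; move=> h h2.
    by congr EFin; lra.
  by rewrite prodEFin ltry.
Qed.

Lemma lebesgue_measure_shift (c : R) (A : set mR) : measurable A ->
  leb ((fun x : mR => c + x : mR) @^-1` A) = leb A.
Proof.
have mf : measurable_fun setT (fun x : mR => c + x : mR).
  exact: measurable_funD.
pose mu := measure_function_pushforward__canonical__measure_function_Measure leb mf.
move=> mA; apply/esym.
apply: (@lebesgue_measure_unique R mu) => // _ [[a b]] _ <- /=.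
rewrite /pushforward.
rewrite (_ : _ @^-1` _ = `]a - c, b - c]%classic); last first.
  by apply/seteqP; split => x /=; rewrite !in_itv /=; rewrite ltrBlDl lerBrDl.
by rewrite !lebesgue_measure_itv /= !lte_fin ltrD2r -!EFinB; case: ifP => // _; congr EFin; ring.
Qed.

Lemma lebesgue_measure_scale (r : R) (A : set mR) : 0 < r -> measurable A ->
  (r%:E * leb ((fun x : mR => (r * x)%R : mR) @^-1` A))%E = leb A.
Proof.
move=> r0.
have mf : measurable_fun setT (fun x : mR => r * x : mR).
  exact: measurable_funM.
pose mu := [the measure _ _ of mscale (NngNum (ltW r0))
  (measure_function_pushforward__canonical__measure_function_Measure leb mf)].
move=> mA; apply/esym.
apply: (@lebesgue_measure_unique R mu) => // _ [[a b]] _ <- /=.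
rewrite /mscale /= /pushforward.
rewrite (_ : _ @^-1` _ = `]a / r, b / r]%classic); last first.
  by apply/seteqP; split => x /=; rewrite !in_itv /=; rewrite ltr_pdivrMr // ler_pdivlMr // mulrC.
rewrite !lebesgue_measure_itv /= !lte_fin ltr_pM2r ?invr_gt0 // -!EFinB.
by case: ifP => // _; rewrite ?mule0 // -EFinM; congr EFin; field; rewrite gt_eqF.
Qed.

(** Reflections, translations and dilations act on each coordinate separately,
    so their effect on the measure is decided in dimension one. *)
Lemma lebesgue_rV_coordwise n (r : R) (f : 'I_n -> mR -> mR) : 0 <= r ->
  (forall i, measurable_fun setT (f i)) ->
  (forall i A, measurable A -> (r%:E * leb (f i @^-1` A))%E = leb A) ->
  forall E, measurable E ->
  ((r ^+ n)%:E * lebesgue_rV R n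
     ((fun x : 'rV[R]_n => \row_i f i (x ord0 i)) @^-1` E))%E = lebesgue_rV R n E.
Proof.
move=> r0 mf fA E mE.
have mT : measurable_fun setT (fun x : 'rV[R]_n => (\row_i f i (x ord0 i) : 'rV[R]_n)).
  apply: measurable_fun_rV => i; under eq_fun do rewrite mxE.
  exact: (measurableT_comp (mf i) (measurable_coord_rV i)).
pose mu := [the measure _ _ of mscale (NngNum (exprn_ge0 n r0))
  (measure_function_pushforward__canonical__measure_function_Measure (lebesgue_rV R n) mT)].
apply/esym; apply: (@lebesgue_rV_unique n mu) => // A mA.
rewrite /mu /= /mscale /= /pushforward.
have -> : (fun x : 'rV[R]_n => \row_i f i (x ord0 i)) @^-1` box A =
    box (fun i => f i @^-1` A i).
  by apply/seteqP; split => x /= H i; have := H i; rewrite mxE.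
have -> : lebesgue_rV R n (box (fun i => f i @^-1` A i)) =
    (\prod_(i < n) leb (f i @^-1` A i))%E.
  by apply: lebesgue_rV_box => i; rewrite -[X in measurable X]setTI; exact: mf.
have -> : (r ^+ n)%:E = (\prod_(i < n) r%:E)%E.
  by rewrite prodEFin prodr_const card_ord.
by rewrite -big_split /=; apply: eq_bigr => i _; rewrite fA.
Qed.

(** The recursive definition of the measure splits off the first coordinate;
    here k is arbitrary, since any coordinate may be the one that separates
    two frequencies. *)
Definition insert_coord n (k : 'I_n.+1) (p : 'rV[R]_n * mR) : 'rV[R]_n.+1 :=
  \row_i (if unlift k i is Some j then p.1 ord0 j else p.2).

Lemma insert_coord_same n (k : 'I_n.+1) p : insert_coord k p ord0 k = p.2.
Proof. by rewrite mxE unlift_none. Qed.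

Lemma insert_coord_lift n (k : 'I_n.+1) p j :
  insert_coord k p ord0 (lift k j) = p.1 ord0 j.
Proof. by rewrite mxE liftK. Qed.

Lemma measurable_insert_coord n (k : 'I_n.+1) :
  measurable_fun setT (insert_coord k).
Proof.
apply: measurable_fun_rV => i; have [j ->|->] := unliftP k i.
  under eq_fun do rewrite insert_coord_lift.
  exact: (measurableT_comp (measurable_coord_rV j) measurable_fst).
under eq_fun do rewrite insert_coord_same.
exact: measurable_snd.
Qed.

Lemma insert_coord_preserving n (k : 'I_n.+1) E : measurable E ->
  (lebesgue_rV R n \x leb)%E (insert_coord k @^-1` E) = lebesgue_rV R n.+1 E.
Proof.
move=> mE.
pose mu := measure_function_pushforward__canonical__measure_function_Measure
  [the measure _ _ of (lebesgue_rV R n \x leb)%E] (measurable_insert_coord k).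
apply/esym; apply: (@lebesgue_rV_unique n.+1 mu) => // A mA.
rewrite /mu /= /pushforward.
have -> : insert_coord k @^-1` box A = box (fun j => A (lift k j)) `*` A k.
  apply/seteqP; split => [p /= H|p [/= H1 H2] i].
    split => [j|]; first by have := H (lift k j); rewrite insert_coord_lift.
    by have := H k; rewrite insert_coord_same.
  by have [j ->|->] := unliftP k i; rewrite ?insert_coord_lift ?insert_coord_same.
rewrite product_measure1E //; last exact: measurable_box.
rewrite (bigD1_ord k) //= muleC; congr (_ * _)%E.
exact: lebesgue_rV_box.
Qed.

End rV_unique.

(** * Measurability *)

Section measurability_lemmas.
Context {R : realType} d (T : measurableType d).

Lemma measurable_sqre (f : T -> \bar R) :
  measurable_fun setT f -> measurable_fun setT (fun x => f x ^+ 2)%E.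
Proof. by move=> mf; exact: emeasurable_funM. Qed.

Lemma measurable_fun_opp (f : T -> R) :
  measurable_fun setT f -> measurable_fun setT (fun x => - f x).
Proof. by move=> mf; apply: (measurableT_comp _ mf); exact: oppr_measurable. Qed.

Lemma measurable_fun_norm (f : T -> R) :
  measurable_fun setT f -> measurable_fun setT (fun x => `|f x|).
Proof. by move=> mf; apply: (measurableT_comp _ mf); exact: normr_measurable. Qed.

Lemma measurable_sqrtr (f : T -> R) :
  measurable_fun setT f -> measurable_fun setT (fun x => Num.sqrt (f x)).
Proof.
move=> mf; apply: (measurableT_comp _ mf).
by apply: continuous_measurable_fun => x; exact: sqrt_continuous.
Qed.

Lemma measurable_bracket (f : T -> R) :
  measurable_fun setT f -> measurable_fun setT (fun x => bracket (f x)).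
Proof.
move=> mf; apply: measurable_sqrtr; apply: measurable_funD => //.
exact: measurable_funX.
Qed.

Lemma measurable_fun_dot n (f g : T -> 'rV[R]_n) :
  measurable_fun setT f -> measurable_fun setT g ->
  measurable_fun setT (fun t => dot (f t) (g t)).
Proof.
move=> mf mg; apply: measurable_sum => i; apply: measurable_funM.
- exact: (measurableT_comp (measurable_coord_rV i) mf).
- exact: (measurableT_comp (measurable_coord_rV i) mg).
Qed.

Lemma measurable_fun_enorm n (f : T -> 'rV[R]_n) :
  measurable_fun setT f -> measurable_fun setT (fun t => enorm (f t)).
Proof. by move=> mf; apply: measurable_sqrtr; exact: measurable_fun_dot. Qed.

Lemma measurable_fun_coord n i (f : T -> 'rV[R]_n) :
  measurable_fun setT f -> measurable_fun setT (fun t => f t ord0 i : measurableTypeR R).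
Proof. exact: (measurableT_comp (measurable_coord_rV i)). Qed.

Lemma measurable_fun_insert_coord n (k : 'I_n.+1) (f : T -> 'rV[R]_n)
    (g : T -> measurableTypeR R) :
  measurable_fun setT f -> measurable_fun setT g ->
  measurable_fun setT (fun t => insert_coord k (f t, g t)).
Proof.
move=> mf mg; apply: (measurableT_comp (measurable_insert_coord k)).
exact: measurable_fun_pair.
Qed.

Lemma measurable_rV_add n (f g : T -> 'rV[R]_n) :
  measurable_fun setT f -> measurable_fun setT g ->
  measurable_fun setT (fun t => f t + g t).
Proof.
move=> mf mg; apply: measurable_fun_rV => i; under eq_fun do rewrite !mxE.
by apply: measurable_funD; exact: measurable_fun_coord.
Qed.

Lemma measurable_rV_opp n (f : T -> 'rV[R]_n) :
  measurable_fun setT f -> measurable_fun setT (fun t => - f t).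
Proof.
move=> mf; apply: measurable_fun_rV => i; under eq_fun do rewrite !mxE.
by apply: measurable_fun_opp; exact: measurable_fun_coord.
Qed.

Lemma measurable_rV_scale n (c : R) (f : T -> 'rV[R]_n) :
  measurable_fun setT f -> measurable_fun setT (fun t => (c *: f t)%R).
Proof.
move=> mf; apply: measurable_fun_rV => i; under eq_fun do rewrite mxE.
apply: measurable_funM; first exact: measurable_cst.
exact: measurable_fun_coord.
Qed.

Lemma measurable_fun_nat_of_bool (f : T -> bool) :
  measurable_fun setT f -> measurable_fun setT (fun t => (f t)%:R : R).
Proof.
move=> mf; apply: (measurableT_comp (f := fun b : bool => b%:R : R) _ mf).
by [].
Qed.

Local Notation mR := (measurableTypeR R).
Local Notation X n := ('rV[R]_n * mR)%type.

(** The frequency that completes p and q to a triple of sum zero. *)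
Definition third n (p q : X n) : X n := (- p.1 - q.1, - p.2 - q.2)%R.

Lemma measurable_third n (f g : T -> X n) :
  measurable_fun setT f -> measurable_fun setT g ->
  measurable_fun setT (fun t => third (f t) (g t)).
Proof.
move=> mf mg; apply/measurable_fun_pairP; split => /=.
- apply: measurable_fun_rV => i; under eq_fun do rewrite !mxE.
  apply: measurable_funB.
    apply: measurableT_comp => //.
    exact: (measurableT_comp (measurable_coord_rV i) (measurableT_comp measurable_fst mf)).
  exact: (measurableT_comp (measurable_coord_rV i) (measurableT_comp measurable_fst mg)).
- apply: measurable_funB.
    apply: measurableT_comp => //.
    exact: (measurableT_comp measurable_snd mf).
  exact: (measurableT_comp measurable_snd mg).
Qed.

(** Coordinates adapted to the paraboloid: x is the k-th frequency, and z
    consists of the other frequencies and of the modulation tau - |xi|^2. *)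
Definition paraboloid_chart n (k : 'I_n.+1) (zx : X n * mR) : X n.+1 :=
  let xi := insert_coord k (zx.1.1, zx.2) in (xi, zx.1.2 + dot xi xi)%R.

End measurability_lemmas.

Section measurable_integrals.
Local Open Scope ereal_scope.
Context {R : realType} d1 d2 (T1 : measurableType d1) (T2 : measurableType d2).

Lemma measurable_integral_snd (m : {sigma_finite_measure set T2 -> \bar R})
    (f : T1 * T2 -> \bar R) :
  measurable_fun setT f -> (forall x, 0 <= f x) ->
  measurable_fun setT (fun x => \int[m]_y f (x, y)).
Proof. by move=> mf f0; exact: measurable_fun_fubini_tonelli_F. Qed.

Lemma measurable_integral_fst (m : {sigma_finite_measure set T1 -> \bar R})
    (f : T1 * T2 -> \bar R) :
  measurable_fun setT f -> (forall x, 0 <= f x) ->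
  measurable_fun setT (fun y => \int[m]_x f (x, y)).
Proof. by move=> mf f0; exact: measurable_fun_fubini_tonelli_G. Qed.

End measurable_integrals.

Ltac meas :=
  lazymatch goal with
  | |- measurable_fun _ _ => idtac
  end;
  lazymatch goal with
  | |- measurable_fun _ (fun x => x) => exact: measurable_id
  | |- measurable_fun _ (fun _ => ?c) => exact: measurable_cst
  | |- measurable_fun _ (fun x => (@?f x, @?g x)) =>
      apply: (measurable_fun_pair (f := f) (g := g)); meas
  | |- measurable_fun _ (fun x => fst (@?f x)) =>
      apply: (@measurableT_comp _ _ _ _ _ _ _ setT f measurable_fst); meas
  | |- measurable_fun _ (fun x => snd (@?f x)) =>
      apply: (@measurableT_comp _ _ _ _ _ _ _ setT f measurable_snd); meas
  | |- measurable_fun _ (fun x => EFin (@?f x)) =>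
      apply: (proj2 (measurable_EFinP _ f)); meas
  | |- measurable_fun _ (fun x => mule (@?f x) (@?g x)) =>
      apply: (emeasurable_funM (f := f) (g := g)); meas
  | |- measurable_fun _ (fun x => expe (@?f x) 2) =>
      apply: (measurable_sqre (f := f)); meas
  | |- measurable_fun _ (fun x => GRing.mul (@?f x) (@?g x)) =>
      apply: (measurable_funM (f := f) (g := g)); meas
  | |- measurable_fun _ (fun x => @?f x + @?g x) =>
      first [apply: (measurable_funD (f := f) (g := g)) |
             apply: (emeasurable_funD (f := f) (g := g)) |
             apply: (measurable_rV_add (f := f) (g := g))]; meas
  | |- measurable_fun _ (fun x => - (@?f x)) =>
      first [apply: (measurable_fun_opp (f := f)) |
             apply: (measurable_rV_opp (f := f))]; meas
  | |- measurable_fun _ (fun x => ?c *: @?f x) =>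
      apply: (measurable_rV_scale c (f := f)); meas
  | |- measurable_fun _ (fun x => (@?f x && @?g x)) =>
      apply: (measurable_and (f := f) (g := g)); meas
  | |- measurable_fun _ (fun x => (@?f x) ^+ _) =>
      apply: (measurable_funX (f := f)); meas
  | |- measurable_fun _ (fun x => powR (@?f x) ?p) =>
      apply: (@measurableT_comp _ _ _ _ _ _ _ setT f (measurable_powR p)); meas
  | |- measurable_fun _ (fun x => `| @?f x |) =>
      apply: (measurable_fun_norm (f := f)); meas
  | |- measurable_fun _ (fun x => bracket (@?f x)) =>
      apply: (measurable_bracket (f := f)); meas
  | |- measurable_fun _ (fun x => dot (@?f x) (@?g x)) =>
      apply: (measurable_fun_dot (f := f) (g := g)); meas
  | |- measurable_fun _ (fun x => enorm (@?f x)) =>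
      apply: (measurable_fun_enorm (f := f)); meas
  | |- measurable_fun _ (fun x => insert_coord ?k (@?f x, @?g x)) =>
      apply: (@measurable_fun_insert_coord _ _ _ _ k f g); meas
  | |- measurable_fun _ (fun x => fun_of_matrix (@?f x) ord0 ?i) =>
      apply: (@measurable_fun_coord _ _ _ _ i f); meas
  | |- measurable_fun _ (fun x => (nat_of_bool (@?f x))%:R) =>
      apply: (measurable_fun_nat_of_bool (f := f)); meas
  | |- measurable_fun _ (fun x => (@?f x <= @?g x)%R) =>
      apply: (measurable_fun_ler (f := f) (g := g)); meas
  | |- measurable_fun _ (fun x => (@?f x < @?g x)%R) =>
      apply: (measurable_fun_ltr (f := f) (g := g)); meas
  | |- measurable_fun _ (fun x => third (@?f x) (@?g x)) =>
      apply: (@measurable_third _ _ _ _ f g); meas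
  | |- measurable_fun _ (fun x => ?F (@?f x)) =>
      match goal with
      | H : measurable_fun _ F |- _ => apply: (@measurableT_comp _ _ _ _ _ _ F setT f H); meas
      end
  | |- measurable_fun _ ?F => exact
  end.

Lemma measurable_paraboloid_chart (R : realType) n (k : 'I_n.+1) :
  measurable_fun setT (@paraboloid_chart R n k).
Proof. by rewrite /paraboloid_chart /=; meas. Qed.

Section lebesgue_plane.
Context {R : realType}.

(** Named so that its sigma-finite structure can be inferred. *)
Definition lebesgue_plane := (@lebesgue_measure R \x @lebesgue_measure R)%E.
HB.instance Definition _ := Measure.on lebesgue_plane.
HB.instance Definition _ := Measure_isSigmaFinite.Build _ _ _
  lebesgue_plane (sigma_finite_product_measure1 _ _).
End lebesgue_plane.

(** * Space-time integrals and trilinear forms *)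

Section spacetime_integrals.
Context {R : realType}.
Local Notation mR := (measurableTypeR R).
Local Notation leb := (@lebesgue_measure R).
Local Notation X n := ('rV[R]_n * mR)%type.
Local Notation mu := (@lebesgue_spacetime R _).

Lemma dot_ge0 n (x : 'rV[R]_n) : 0 <= dot x x.
Proof. by apply: sumr_ge0 => i _; rewrite -expr2 sqr_ge0. Qed.

Lemma sqr_enorm n (x : 'rV[R]_n) : enorm x ^+ 2 = dot x x.
Proof. exact: sqr_sqrtr (dot_ge0 x). Qed.

Lemma lebesgue_measure_reflect (c : R) (A : set mR) : measurable A ->
  leb ((fun x : mR => c - x : mR) @^-1` A) = leb A.
Proof.
move=> mA; rewrite -(lebesgue_measure_shift c mA).
have mf : measurable_fun setT (fun x : mR => c + x : mR) by exact: measurable_funD.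
have := mf measurableT A mA; rewrite setTI => mA'.
exact: lebesgue_measureN mA'.
Qed.

Lemma measurable_rV_reflect n (c : 'rV[R]_n) :
  measurable_fun setT (fun x : 'rV[R]_n => c - x).
Proof.
apply: measurable_fun_rV => i; under eq_fun do rewrite !mxE.
apply: measurable_funB => //; exact: measurable_coord_rV.
Qed.

Lemma measurable_rV_shift n (c : 'rV[R]_n) :
  measurable_fun setT (fun x : 'rV[R]_n => c + x).
Proof.
apply: measurable_fun_rV => i; under eq_fun do rewrite !mxE.
apply: measurable_funD => //; exact: measurable_coord_rV.
Qed.

Lemma lebesgue_rV_reflect n (c : 'rV[R]_n) E : measurable E ->
  lebesgue_rV R n ((fun x : 'rV[R]_n => c - x) @^-1` E) = lebesgue_rV R n E.
Proof.
move=> mE; rewrite -[RHS](@lebesgue_rV_coordwise _ n 1 (fun i x => c ord0 i - x)) //.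
- rewrite expr1n mul1e; congr (lebesgue_rV R n _); apply/seteqP.
  by split => x /=; set u := c - x; set v := \row_i _;
     have -> : u = v by apply/rowP => i; rewrite !mxE.
- by move=> i; exact: measurable_funB.
- by move=> i A mA; rewrite mul1e lebesgue_measure_reflect.
Qed.

Lemma lebesgue_rV_shift n (c : 'rV[R]_n) E : measurable E ->
  lebesgue_rV R n ((fun x : 'rV[R]_n => c + x) @^-1` E) = lebesgue_rV R n E.
Proof.
move=> mE; rewrite -[RHS](@lebesgue_rV_coordwise _ n 1 (fun i x => c ord0 i + x)) //.
- rewrite expr1n mul1e; congr (lebesgue_rV R n _); apply/seteqP.
  by split => x /=; set u := c + x; set v := \row_i _;
     have -> : u = v by apply/rowP => i; rewrite !mxE.
- by move=> i; exact: measurable_funD.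
- by move=> i A mA; rewrite mul1e lebesgue_measure_shift.
Qed.

Local Open Scope ereal_scope.

Lemma integral_lebesgue_shift (c : R) (f : mR -> \bar R) :
  measurable_fun setT f -> (forall x, 0 <= f x) ->
  \int[leb]_x f (c + x)%R = \int[leb]_x f x.
Proof.
move=> mf f0; apply/esym/(@ge0_integral_preserving _ _ _ _ _ (fun x : mR => (c + x)%R : mR)) => //.
  exact: measurable_funD.
by move=> A mA; exact: lebesgue_measure_shift.
Qed.

Lemma integral_lebesgue_reflect (c : R) (f : mR -> \bar R) :
  measurable_fun setT f -> (forall x, 0 <= f x) ->
  \int[leb]_x f (c - x)%R = \int[leb]_x f x.
Proof.
move=> mf f0; apply/esym/(@ge0_integral_preserving _ _ _ _ _ (fun x : mR => (c - x)%R : mR)) => //.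
  exact: measurable_funB.
by move=> A mA; exact: lebesgue_measure_reflect.
Qed.

Lemma integral_rV_reflect n (c : 'rV[R]_n) (f : 'rV[R]_n -> \bar R) :
  measurable_fun setT f -> (forall x, 0 <= f x) ->
  \int[lebesgue_rV R n]_x f (c - x)%R = \int[lebesgue_rV R n]_x f x.
Proof.
move=> mf f0; apply/esym/(@ge0_integral_preserving _ _ _ _ _ (fun x : 'rV[R]_n => (c - x)%R)) => //.
  exact: measurable_rV_reflect.
by move=> A mA; exact: lebesgue_rV_reflect.
Qed.

Lemma integral_rV_shift n (c : 'rV[R]_n) (f : 'rV[R]_n -> \bar R) :
  measurable_fun setT f -> (forall x, 0 <= f x) ->
  \int[lebesgue_rV R n]_x f (c + x)%R = \int[lebesgue_rV R n]_x f x.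
Proof.
move=> mf f0; apply/esym/(@ge0_integral_preserving _ _ _ _ _ (fun x : 'rV[R]_n => (c + x)%R)) => //.
  exact: measurable_rV_shift.
by move=> A mA; exact: lebesgue_rV_shift.
Qed.

Lemma integral_insert_coord n (k : 'I_n.+1) (f : 'rV[R]_n.+1 -> \bar R) :
  measurable_fun setT f -> (forall x, 0 <= f x) ->
  \int[lebesgue_rV R n.+1]_x f x =
  \int[lebesgue_rV R n]_y \int[leb]_x f (insert_coord k (y, x)).
Proof.
move=> mf f0.
rewrite (ge0_integral_preserving (measurable_insert_coord k) (insert_coord_preserving k)) //.
rewrite fubini_tonelli1 //.
exact: (measurableT_comp mf (measurable_insert_coord k)).
Qed.

Lemma integral_spacetime n (f : X n -> \bar R) :
  measurable_fun setT f -> (forall x, 0 <= f x) ->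
  \int[mu]_q f q = \int[lebesgue_rV R n]_x \int[leb]_t f (x, t).
Proof.
move=> mf f0.
exact: (@fubini_tonelli1 _ _ _ _ _ (lebesgue_rV R n) leb f mf f0).
Qed.

Lemma thirdK n (p : X n) : involutive (third p).
Proof. by move=> [x t]; congr pair; rewrite /= opprB addrC subrK. Qed.

Lemma thirdC n (p q : X n) : third p q = third q p.
Proof. by rewrite /third [(- p.1 - _)%R]addrC [(- p.2 - _)%R]addrC. Qed.

Lemma integral_third n (p : X n) (f : X n -> \bar R) :
  measurable_fun setT f -> (forall x, 0 <= f x) ->
  \int[mu]_q f (third p q) = \int[mu]_q f q.
Proof.
move=> mf f0.
have mf3 : measurable_fun setT (fun q => f (third p q)).
  by apply: (measurableT_comp mf); exact: measurable_third.
have f30 q : 0 <= f (third p q) by [].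
rewrite (integral_spacetime mf3 f30) (integral_spacetime mf f0).
pose g x := \int[leb]_t f (x, t).
have mg : measurable_fun setT g by exact: measurable_fun_fubini_tonelli_F.
have g0 x : 0 <= g x by exact: integral_ge0.
transitivity (\int[lebesgue_rV R n]_x g (- p.1 - x)%R); last exact: integral_rV_reflect.
apply: eq_integral => x _ /=.
apply: (@integral_lebesgue_reflect (- p.2)%R (fun t => f ((- p.1 - x)%R, t))) => //.
exact: measurable_fun_pair2.
Qed.

Lemma dot_insert_coord n (k : 'I_n.+1) (p : X n) :
  dot (insert_coord k p) (insert_coord k p) = (dot p.1 p.1 + p.2 ^+ 2)%R.
Proof.
rewrite /dot (bigD1_ord k) //= insert_coord_same -expr2 addrC; congr (_ + _)%R.
by apply: eq_bigr => i _; rewrite insert_coord_lift.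
Qed.

Lemma integral_paraboloid_chart n (k : 'I_n.+1) (f : X n.+1 -> \bar R) :
  measurable_fun setT f -> (forall x, 0 <= f x) ->
  \int[mu]_q f q = \int[mu]_z \int[leb]_x f (paraboloid_chart k (z, x)).
Proof.
move=> mf f0.
pose g (xi : 'rV[R]_n.+1) := \int[leb]_t f (xi, t).
have mg : measurable_fun setT g by exact: measurable_fun_fubini_tonelli_F.
have g0 x : 0 <= g x by exact: integral_ge0.
rewrite (integral_spacetime mf f0) (integral_insert_coord k mg g0).
pose F z := \int[leb]_x f (paraboloid_chart k (z, x)).
have mF : measurable_fun setT F.
  apply: (@measurable_integral_snd _ _ _ _ _ leb (fun zx => f (paraboloid_chart k zx))).
    exact: (measurableT_comp mf (measurable_paraboloid_chart k)).
  by move=> ?; exact: f0.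
have F0 z : 0 <= F z by exact: integral_ge0.
rewrite (integral_spacetime mF F0); apply: eq_integral => y _.
transitivity (\int[leb]_x \int[leb]_t f (paraboloid_chart k ((y, t), x))).
  apply: eq_integral => x _; rewrite /g /paraboloid_chart /=.
  set xi := insert_coord k (y, x).
  rewrite -(@integral_lebesgue_shift (dot xi xi) (fun t => f (xi, t))) //.
    by apply: eq_integral => t _; rewrite addrC.
  exact: measurable_fun_pair2.
apply: (fubini_tonelli (m1 := leb) (m2 := leb) (fun xt => f (paraboloid_chart k ((y, xt.2), xt.1)))) => //.
apply: (measurableT_comp mf); apply: (measurableT_comp (measurable_paraboloid_chart k)).
by meas.
Qed.

Local Notation mu2 := (mu \x mu).

Lemma integral_swap_pair n (f : X n * X n -> \bar R) :
  measurable_fun setT f -> (forall x, 0 <= f x) ->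
  \int[mu2]_pq f (pq.2, pq.1) = \int[mu2]_pq f pq.
Proof.
move=> mf f0.
have mf' : measurable_fun setT (fun pq => f (pq.2, pq.1)).
  by meas.
rewrite (fubini_tonelli1 _ mf' (fun x => f0 _)).
by rewrite (fubini_tonelli2 _ mf f0).
Qed.

Lemma integral_third_pair n (f : X n * X n -> \bar R) :
  measurable_fun setT f -> (forall x, 0 <= f x) ->
  \int[mu2]_pq f (pq.1, third pq.1 pq.2) = \int[mu2]_pq f pq.
Proof.
move=> mf f0.
have mf' : measurable_fun setT (fun pq : X n * X n => f (pq.1, third pq.1 pq.2)).
  apply: (measurableT_comp mf); apply: measurable_fun_pair; first exact: measurable_fst.
  by apply: measurable_third; [exact: measurable_fst|exact: measurable_snd].
rewrite (fubini_tonelli1 _ mf' (fun x => f0 _)) (fubini_tonelli1 _ mf f0).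
apply: eq_integral => p _; apply: (@integral_third n p (fun q => f (p, q))) => //.
exact: measurable_fun_pair2.
Qed.

Definition trilinear n (K : X n * X n -> R) (F1 F2 F3 : X n -> \bar R) : \bar R :=
  \int[mu2]_pq ((K pq)%:E * (F1 pq.1 * F2 pq.2 * F3 (third pq.1 pq.2))).

Definition trilinear_bounded n (K : X n * X n -> R) :=
  exists2 C : R, (0 <= C)%R & forall F1 F2 F3 : X n -> \bar R,
    measurable_fun setT F1 -> measurable_fun setT F2 -> measurable_fun setT F3 ->
    (forall q, 0 <= F1 q) -> (forall q, 0 <= F2 q) -> (forall q, 0 <= F3 q) ->
    (trilinear K F1 F2 F3) ^+ 2 <=
      C%:E * (\int[mu]_q F1 q ^+ 2 * \int[mu]_q F2 q ^+ 2 * \int[mu]_q F3 q ^+ 2).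
End spacetime_integrals.

Section trilinear_theory.
Context {R : realType}.
Local Notation mR := (measurableTypeR R).
Local Notation leb := (@lebesgue_measure R).
Local Notation ST n := ('rV[R]_n * mR)%type.
Local Notation mu := (@lebesgue_spacetime R _).
Local Notation mu2 := (mu \x mu)%E.
Local Open Scope ereal_scope.

Lemma sqreM (x y : \bar R) : (x * y) ^+ 2 = x ^+ 2 * y ^+ 2.
Proof. by rewrite !expe2 muleACA. Qed.

Lemma measurable_trilinear n (K : ST n * ST n -> R) (F1 F2 F3 : ST n -> \bar R) :
  measurable_fun setT K ->
  measurable_fun setT F1 -> measurable_fun setT F2 -> measurable_fun setT F3 ->
  measurable_fun setT
    (fun pq : ST n * ST n => (K pq)%:E * (F1 pq.1 * F2 pq.2 * F3 (third pq.1 pq.2))).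
Proof. by move=> mK m1 m2 m3; meas. Qed.

Lemma trilinear_ge0 n (K : ST n * ST n -> R) (F1 F2 F3 : ST n -> \bar R) :
  (forall pq, 0 <= K pq)%R ->
  (forall q, 0 <= F1 q) -> (forall q, 0 <= F2 q) -> (forall q, 0 <= F3 q) ->
  0 <= trilinear K F1 F2 F3.
Proof.
by move=> K0 p1 p2 p3; apply: integral_ge0 => pq _; rewrite !mule_ge0 ?lee_fin.
Qed.

Lemma trilinear_bounded_le n (K K' : ST n * ST n -> R) (c : R) :
  measurable_fun setT K -> measurable_fun setT K' -> (0 <= c)%R ->
  (forall pq, 0 <= K pq)%R -> (forall pq, 0 <= K' pq)%R ->
  (forall pq, K pq <= c * K' pq)%R -> trilinear_bounded K' -> trilinear_bounded K.
Proof.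
move=> mK mK' c0 K0 K'0 KK' [C C0 bK']; exists (c ^+ 2 * C)%R; first by rewrite mulr_ge0 ?sqr_ge0.
move=> F1 F2 F3 m1 m2 m3 p1 p2 p3.
have F0 (pq : ST n * ST n) : 0 <= F1 pq.1 * F2 pq.2 * F3 (third pq.1 pq.2).
  by rewrite !mule_ge0.
have le : trilinear K F1 F2 F3 <= c%:E * trilinear K' F1 F2 F3.
  rewrite -ge0_integralZl_EFin //; last 2 first.
  - by move=> pq _; rewrite mule_ge0 ?lee_fin.
  - exact: measurable_trilinear.
  apply: ge0_le_integral => //.
  - by move=> pq _; rewrite mule_ge0 ?lee_fin.
  - exact: measurable_trilinear.
  - by apply: measurable_funeM; exact: measurable_trilinear.
  - by move=> pq _; rewrite [X in _ <= X]muleA -EFinM lee_wpmul2r ?lee_fin //.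
have T0 := trilinear_ge0 K0 p1 p2 p3.
have T'0 := trilinear_ge0 K'0 p1 p2 p3.
apply: (@le_trans _ _ ((c%:E * trilinear K' F1 F2 F3) ^+ 2)).
  by rewrite lee_sqr ?mule_ge0 ?lee_fin.
rewrite sqreM -EFin_expe [X in _ <= X * _]EFinM -[X in _ <= X]muleA.
apply: lee_wpmul2l.
  by rewrite lee_fin sqr_ge0.
exact: bK'.
Qed.

Lemma sqr_add_le (x y a b : \bar R) :
  0 <= x -> 0 <= y -> 0 <= a -> 0 <= b -> x ^+ 2 <= a -> y ^+ 2 <= b ->
  (x + y) ^+ 2 <= 2%:E * (a + b).
Proof.
move=> x0 y0 a0 b0; case: a a0 => [a||] // a0; last first.
  by move=> _ _; rewrite addye ?gt0_muley ?leey // gt_eqF // (lt_le_trans _ b0).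
case: b b0 => [b||] // b0; last by move=> _ _; rewrite addey ?gt0_muley ?leey.
case: x x0 => [x||] // x0.
case: y y0 => [y||] // y0.
rewrite -EFinD -!EFin_expe -EFinD -EFinM !lee_fin => xa yb.
apply: (@le_trans _ _ (2 * (x ^+ 2 + y ^+ 2))%R); last by rewrite ler_pM2l // lerD.
by rewrite -subr_ge0 (_ : _ - _ = (x - y) ^+ 2)%R ?sqr_ge0 //; ring.
Qed.

Lemma trilinear_bounded_add n (K K' : ST n * ST n -> R) :
  measurable_fun setT K -> measurable_fun setT K' ->
  (forall pq, 0 <= K pq)%R -> (forall pq, 0 <= K' pq)%R ->
  trilinear_bounded K -> trilinear_bounded K' ->
  trilinear_bounded (fun pq => K pq + K' pq)%R.
Proof.
move=> mK mK' K0 K'0 [C C0 bK] [C' C'0 bK'].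
exists (2 * (C + C'))%R; first by rewrite mulr_ge0 // addr_ge0.
move=> F1 F2 F3 m1 m2 m3 p1 p2 p3.
have -> : trilinear (fun pq => K pq + K' pq)%R F1 F2 F3 =
    trilinear K F1 F2 F3 + trilinear K' F1 F2 F3.
  rewrite -ge0_integralD //; last 4 first.
  - by move=> pq _; rewrite !mule_ge0 ?lee_fin.
  - exact: measurable_trilinear.
  - by move=> pq _; rewrite !mule_ge0 ?lee_fin.
  - exact: measurable_trilinear.
  by apply: eq_integral => pq _; rewrite EFinD ge0_muleDl ?lee_fin.
set N := (_ * _ * _); have N0 : 0 <= N.
  by rewrite /N !mule_ge0 //; apply: integral_ge0 => q _; exact: sqre_ge0.
rewrite EFinM -muleA.
have -> : (C + C')%:E * N = C%:E * N + C'%:E * N.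
  by rewrite EFinD ge0_muleDl ?lee_fin.
have CN : 0 <= C%:E * N by apply: mule_ge0; rewrite ?lee_fin.
have C'N : 0 <= C'%:E * N by apply: mule_ge0; rewrite ?lee_fin.
apply: sqr_add_le => //; rewrite ?trilinear_ge0 //.
- exact: bK.
- exact: bK'.
Qed.

Lemma trilinear_bounded_swap n (K : ST n * ST n -> R) :
  measurable_fun setT K -> (forall pq, 0 <= K pq)%R ->
  trilinear_bounded K -> trilinear_bounded (fun pq => K (pq.2, pq.1)).
Proof.
move=> mK K0 [C C0 bK]; exists C; first exact: C0.
move=> F1 F2 F3 m1 m2 m3 p1 p2 p3.
rewrite [X in C%:E * (X * _)]muleC.
have -> : trilinear (fun pq => K (pq.2, pq.1)) F1 F2 F3 = trilinear K F2 F1 F3.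
  rewrite /trilinear -(@integral_swap_pair _ _ (fun pq =>
    (K pq)%:E * (F2 pq.1 * F1 pq.2 * F3 (third pq.1 pq.2)))).
  - by apply: eq_integral => pq _; rewrite /= thirdC [F2 _ * _]muleC.
  - exact: measurable_trilinear.
  - by move=> pq; rewrite !mule_ge0 ?lee_fin.
exact: bK.
Qed.

(** The three functions play symmetric roles, since p and third p q are
    independent variables as much as p and q are. *)
Lemma trilinear_bounded_third n (K : ST n * ST n -> R) :
  measurable_fun setT K -> (forall pq, 0 <= K pq)%R ->
  trilinear_bounded K -> trilinear_bounded (fun pq => K (pq.1, third pq.1 pq.2)).
Proof.
move=> mK K0 [C C0 bK]; exists C; first exact: C0.
move=> F1 F2 F3 m1 m2 m3 p1 p2 p3.
rewrite [X in C%:E * X]muleAC.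
have -> : trilinear (fun pq => K (pq.1, third pq.1 pq.2)) F1 F2 F3 = trilinear K F1 F3 F2.
  rewrite /trilinear -(@integral_third_pair _ _ (fun pq =>
    (K pq)%:E * (F1 pq.1 * F3 pq.2 * F2 (third pq.1 pq.2)))).
  - by apply: eq_integral => pq _; rewrite /= thirdK -!muleA [F3 _ * _]muleC.
  - exact: measurable_trilinear.
  - by move=> pq; rewrite !mule_ge0 ?lee_fin.
exact: bK.
Qed.

(** Cauchy-Schwarz with K F2 in one factor and F1 F3 in the other: the second
    factor splits because p and third p q are independent variables. *)
Lemma trilinear_bounded_schur n (K : ST n * ST n -> R) (C : R) :
  measurable_fun setT K -> (forall pq, 0 <= K pq)%R -> (0 <= C)%R ->
  (forall q, \int[mu]_p ((K (p, q)) ^+ 2)%:E <= C%:E) -> trilinear_bounded K.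
Proof.
move=> mK K0 C0 CK; exists C; first exact: C0.
move=> F1 F2 F3 m1 m2 m3 p1 p2 p3.
pose A (pq : ST n * ST n) := (K pq ^+ 2)%:E * F2 pq.2 ^+ 2.
pose B (pq : ST n * ST n) := F1 pq.1 ^+ 2 * F3 (third pq.1 pq.2) ^+ 2.
have mA : measurable_fun setT A by rewrite /A; meas.
have mB : measurable_fun setT B by rewrite /B; meas.
have A0 pq : 0 <= A pq by rewrite mule_ge0 ?sqre_ge0 // lee_fin sqr_ge0.
have B0 pq : 0 <= B pq by rewrite mule_ge0 ?sqre_ge0.
have := @cauchy_schwarz_integral _ _ R mu2 _ A B (measurable_trilinear mK m1 m2 m3) mA mB.
move=> /(_ _ A0 B0 _)/le_trans; apply => //.
- by move=> pq; rewrite !mule_ge0 ?lee_fin.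
- move=> pq; rewrite /A /B !sqreM -EFin_expe.
  move: (K pq ^+ 2)%:E (F1 _ ^+ 2) (F2 _ ^+ 2) (F3 _ ^+ 2) => k a b c.
  by rewrite -!muleA (muleCA a) lexx.
have IA : \int[mu2]_pq A pq <= C%:E * \int[mu]_q F2 q ^+ 2.
  rewrite (fubini_tonelli2 _ mA A0) -ge0_integralZl ?lee_fin //; last 2 first.
  - by meas.
  - by move=> q _; rewrite sqre_ge0.
  apply: ge0_le_integral => //.
  - by move=> q _; apply: integral_ge0.
  - exact: measurable_integral_fst.
  - by apply: measurable_funeM; meas.
  move=> q _; apply: (@le_trans _ _ ((\int[mu]_p (K (p, q) ^+ 2)%:E) * F2 q ^+ 2)).
    rewrite -ge0_integralZr ?sqre_ge0 //.
    - by meas.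
    - by move=> p _; rewrite lee_fin sqr_ge0.
  by apply: lee_wpmul2r; [exact: sqre_ge0|exact: CK].
have IB : \int[mu2]_pq B pq = \int[mu]_q F1 q ^+ 2 * \int[mu]_q F3 q ^+ 2.
  rewrite (fubini_tonelli1 _ mB B0) -ge0_integralZr //; last 3 first.
  - by meas.
  - by move=> q _; rewrite sqre_ge0.
  - by apply: integral_ge0 => q _; exact: sqre_ge0.
  apply: eq_integral => p _; rewrite /B /fubini_F /= ge0_integralZl ?sqre_ge0 //.
  - congr (_ * _); apply: (@integral_third _ _ p (fun q => F3 q ^+ 2)); first by meas.
    by move=> q; exact: sqre_ge0.
  - by meas.
  - by move=> p' _; rewrite sqre_ge0.
rewrite IB; apply: le_trans (lee_wpmul2r _ IA) _.
  by rewrite mule_ge0 //; apply: integral_ge0 => q _; exact: sqre_ge0.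
move: (\int[mu]_q F1 q ^+ 2) (\int[mu]_q F2 q ^+ 2) (\int[mu]_q F3 q ^+ 2) => a b c.
by rewrite -!muleA (muleCA a) lexx.
Qed.

End trilinear_theory.

(** * A quadratic change of variables *)

Section signed_square.
Context {R : realType}.
Local Notation mR := (measurableTypeR R).
Local Notation leb := (@lebesgue_measure R).

Lemma is_derive_signed_square (v : R) :
  is_derive v (1 : R) (fun x : R => x * `|x|) (2 * `|v|).
Proof.
have [v0|v0|v0] := ltgtP v 0.
- apply: (@near_eq_is_derive _ _ _ (fun x : R => - (x ^+ 2))).
  + near=> y; rewrite ltr0_norm ?mulrN ?expr2 //; near: y; exact: lt_nbhsl.
  + apply: is_derive_eq; rewrite ltr0_norm // /GRing.scale /=; ring.
- apply: (@near_eq_is_derive _ _ _ (fun x : R => x ^+ 2)).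
  + near=> y; rewrite gtr0_norm ?expr2 //; near: y; exact: lt_nbhsr.
  + apply: is_derive_eq; rewrite gtr0_norm // /GRing.scale /=; ring.
- rewrite v0 normr0 mulr0; pose f (x : R) := x * `|x|; rewrite -/f.
  have H : (fun h : R => h^-1 *: ((f \o shift (0:R)) (h *: (1 : R)) - f 0))
      @ (0 : R)^' --> (0 : R).
    apply: (@cvg_trans _ ((fun h : R => `|h|) @ (0 : R)^')).
      apply: near_eq_cvg; near=> h; rewrite /f /= mul0r subr0 addr0 /GRing.scale /= mulr1 mulKf //.
      by near: h; exact: nbhs_dnbhs_neq.
    apply: cvg_within_filter; have := @norm_continuous _ R (0 : R).
    by rewrite /continuous_at normr0.
  apply: DeriveDef; first by apply/cvg_ex; exists 0.
  by apply: cvg_lim.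
Unshelve. all: by end_near. Qed.

Lemma ge0_integral_mrestr d (T : measurableType d) (mu : {measure set T -> \bar R})
    (D : set T) (mD : measurable D) (f : T -> \bar R) :
  measurable_fun setT f -> (forall x, 0 <= f x)%E ->
  (\int[mrestr mu mD]_x f x = \int[mu]_(x in D) f x)%E.
Proof.
move=> mf f0; rewrite -(setUv D) ge0_integral_setU //; last 3 first.
- exact: measurableC.
- by rewrite setUv.
- by rewrite disj_set2E setICr eqxx.
rewrite [X in (_ + X)%E](_ : _ = 0%E) ?adde0; last first.
  rewrite (eq_measure_integral mzero) ?integral_measure_zero // => A mA AD.
  transitivity (mu (A `&` D)) => //; rewrite (_ : A `&` D = set0) ?measure0 //.
  by apply/seteqP; split => x // [Ax Dx]; have := AD _ Ax.
apply: eq_measure_integral => A mA AD; transitivity (mu (A `&` D)) => //.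
by rewrite (_ : A `&` D = A) //; apply/setIidPl.
Qed.

Definition signed_sqrt (a : R) : R := Num.sg a * Num.sqrt `|a|.

Lemma signed_sqrtK (a : R) : signed_sqrt a * `|signed_sqrt a| = a.
Proof.
rewrite /signed_sqrt normrM (ger0_norm (sqrtr_ge0 _)) mulrACA -expr2 sqr_sqrtr //.
rewrite normr_sg; have [->|a0] := eqVneq a 0; first by rewrite normr0 !mulr0.
by rewrite mulr1 -numEsg.
Qed.

Lemma signed_square_mono : {mono (fun x : R => x * `|x|) : x y / x < y}.
Proof.
apply: leW_mono; apply: le_mono => x y xy.
have [x0|x0] := leP 0 x.
  have y0 : 0 < y by exact: le_lt_trans xy.
  by rewrite (ger0_norm x0) (gtr0_norm y0) -!expr2 ltr_pXn2r // nnegrE ltW.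
rewrite (ltr0_norm x0) mulrN; have [y0|y0] := leP 0 y.
  apply: (@lt_le_trans _ _ 0); first by rewrite oppr_lt0 nmulr_rgt0.
  by rewrite mulr_ge0.
by rewrite (ltr0_norm y0) mulrN ltrN2; nra.
Qed.

Lemma integral_norm_itv (a b : R) : a <= b ->
  (\int[leb]_(v in `]a, b]) (4 * `|v|)%:E = (2 * (b * `|b|) - 2 * (a * `|a|))%:E)%E.
Proof.
rewrite le_eqVlt => /predU1P[->|ab].
  by rewrite subrr set_itvoc0 integral_set0.
have mf : measurable_fun setT (fun v : R => 4 * `|v|) by meas.
rewrite integral_itv_obnd_cbnd; last by apply/measurable_EFinP; exact: measurable_funTS.
have dF x : is_derive x (1:R) (fun x : R => 2 * (x * `|x|)) (4 * `|x|).
  have d := is_derive_signed_square x.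
  by apply: is_derive_eq; rewrite /GRing.scale /=; ring.
have cF x : {for x, continuous (fun x : R => 2 * (x * `|x|))}.
  by apply: differentiable_continuous; apply/derivable1_diffP; exact: (@ex_derive _ _ _ _ _ _ _ (dF x)).
rewrite (@continuous_FTC2 _ _ (fun x : R => 2 * (x * `|x|))) ?EFinB //.
- apply: continuous_subspaceT => x; apply: cvgM; first exact: cvg_cst.
  exact: norm_continuous.
- split.
  + by move=> x _; exact: (@ex_derive _ _ _ _ _ _ _ (dF x)).
  + by apply: cvg_at_right_filter; exact: cF.
  + by apply: cvg_at_left_filter; exact: cF.
- by move=> x _; rewrite derive1E (@derive_val _ _ _ _ _ _ _ (dF x)).
Qed.

Local Open Scope ereal_scope.

(** The substitution t = 2 v |v| is an increasing bijection of the line with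
    derivative 4 |v|. *)
Lemma integral_signed_square (f : mR -> \bar R) :
  measurable_fun setT f -> (forall x, 0 <= f x) ->
  \int[leb]_v ((4 * `|v|)%:E * f (2 * (v * `|v|))%R) = \int[leb]_t f t.
Proof.
move=> mf f0; pose g (v : mR) : mR := (2 * (v * `|v|))%R.
have mg : measurable_fun setT g by rewrite /g; meas.
have g_lt x y : (g x < g y)%R = (x < y)%R by rewrite ltr_pM2l // signed_square_mono.
have g_le x y : (g x <= g y)%R = (x <= y)%R by rewrite !leNgt g_lt.
have g_sqrt a : g (signed_sqrt (a / 2)) = a.
  by rewrite /g signed_sqrtK mulrC divfK.
(* the density 4 |v| is realised as the area under its graph *)
pose D := [set p : mR * mR | (0 <= p.2)%R && (p.2 <= 4 * `|p.1|)%R].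
have mD : measurable D.
  have mb : measurable_fun setT (fun p : mR * mR => (0 <= p.2)%R && (p.2 <= 4 * `|p.1|)%R).
    by apply: measurable_and; meas.
  by have := mb measurableT [set true] I; rewrite setTI; congr measurable; apply/seteqP; split.
have mh : measurable_fun setT (fun p : mR * mR => g p.1) by meas.
have slice (v : mR) : leb `[0%R, (4 * `|v|)%R] = (4 * `|v|)%:E.
  rewrite lebesgue_measure_itv /= lte_fin; case: ltP => [_|]; first by rewrite oppr0 adde0.
  by move=> h; congr EFin; apply/eqP; rewrite eq_le mulr_ge0 //= andbT.
have areaE (F : mR -> \bar R) : measurable_fun setT F -> (forall v, 0 <= F v) ->
    \int[leb \x leb]_(p in D) F p.1 = \int[leb]_v ((4 * `|v|)%:E * F v).
  move=> mF F0; rewrite integral_mkcond.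
  rewrite (@fubini_tonelli1 _ _ _ _ _ leb leb); last 2 first.
  - by apply/(measurable_restrictT _ mD); apply: measurable_funTS; meas.
  - by move=> p; rewrite /patch; case: ifP.
  apply: eq_integral => v _; rewrite /fubini_F.
  transitivity (\int[leb]_(s in `[0%R, (4 * `|v|)%R]) cst (F v) s).
    rewrite [RHS]integral_mkcond; apply: eq_integral => s _; rewrite /patch /D.
    by congr (if _ then _ else _); apply/idP/idP; rewrite !inE /= in_itv.
  rewrite integral_cst //; transitivity (F v * leb `[0%R, (4 * `|v|)%R]) => //.
  by rewrite slice muleC.
rewrite -(areaE (f \o g)); [|exact: measurableT_comp|by move=> v; exact: f0].
rewrite -(@ge0_integral_mrestr _ _ (leb \x leb) D mD (fun p => f (g p.1))) //; last first.
  by apply: (measurableT_comp mf).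
apply/esym/(ge0_integral_preserving mh) => // A mA.
pose nu := measure_function_pushforward__canonical__measure_function_Measure
  [the measure _ _ of mrestr (leb \x leb) mD] mh.
apply/esym/(@lebesgue_measure_unique R nu) => // _ [[a b]] _ <-.
have mab : measurable (`]a, b]%classic : set mR) by exact: measurable_itv.
have -> : nu `]a, b]%classic = \int[leb \x leb]_(p in D) (\1_(g @^-1` `]a, b]) p.1)%:E.
  transitivity ((leb \x leb) ((fun p : mR * mR => g p.1) @^-1` `]a, b] `&` D)) => //.
  rewrite -integral_indic //; last first.
    by have := mh measurableT _ mab; rewrite setTI.
have mgab : measurable (g @^-1` `]a, b]).
  by have := mg measurableT _ mab; rewrite setTI.
rewrite (areaE (fun v => (\1_(g @^-1` `]a, b]) v)%:E)); last 2 first.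
- by apply/measurable_EFinP; exact: measurable_indic.
- by move=> v; rewrite lee_fin.
rewrite lebesgue_measure_itv /= lte_fin; case: ltP => ab; last first.
  rewrite (eq_integral (cst 0)) ?integral0 // => v _.
  rewrite (_ : g @^-1` `]a, b] = set0) ?indic0 ?mule0 //.
  by apply/seteqP; split => x //=; rewrite in_itv /= => /andP[h1 h2];
     have := lt_le_trans h1 (le_trans h2 ab); rewrite ltxx.
have -> : g @^-1` `]a, b] = `]signed_sqrt (a / 2), signed_sqrt (b / 2)]%classic.
  have E x : ((a < g x) && (g x <= b) =
      (signed_sqrt (a / 2) < x) && (x <= signed_sqrt (b / 2)))%R.
    by rewrite -(g_lt (signed_sqrt _) x) -(g_le x (signed_sqrt _)) !g_sqrt.
  by apply/seteqP; split => x /=; rewrite !in_itv /= E.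
transitivity (\int[leb]_(v in `]signed_sqrt (a / 2), signed_sqrt (b / 2)]) (4 * `|v|)%:E).
  rewrite integral_norm_itv -/(g _) -/(g _) ?g_sqrt ?EFinB //.
  by rewrite -g_le !g_sqrt ltW.
rewrite integral_mkcond; apply: eq_integral => v _.
by rewrite /patch indicE; case: ifP; rewrite ?mule1 ?mule0.
Qed.
(** The map x -> 2 x^2 covers the half-line twice; each sign of x is an
    instance of integral_signed_square. *)
Lemma integral_normM_le (f phi : mR -> \bar R) :
  measurable_fun setT f -> measurable_fun setT phi ->
  (forall x, 0 <= f x) -> (forall x, 0 <= phi x) ->
  (forall x : R, x != 0%R -> f x <= `|x|%:E * phi (2 * x ^+ 2)%R) ->
  \int[leb]_x f x <= 2%:E * \int[leb]_t phi t.
Proof.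
move=> mf mp f0 p0 fp.
pose g (s x : mR) := (4 * `|x|)%:E * phi (s * (2 * (x * `|x|)))%R.
have mg s : measurable_fun setT (g s) by rewrite /g; meas.
have g0 s x : 0 <= g s x by rewrite mule_ge0 // lee_fin mulr_ge0.
have mgg : measurable_fun setT (fun x => g 1%R x + g (-1)%R x).
  exact: emeasurable_funD.
have Ig : \int[leb]_x (g 1%R x + g (-1)%R x) = 2%:E * \int[leb]_t phi t.
  rewrite ge0_integralD //.
  have -> : \int[leb]_x g 1%R x = \int[leb]_t phi t.
    by rewrite -(integral_signed_square mp p0); apply: eq_integral => x _; rewrite /g mul1r.
  have -> : \int[leb]_x g (-1)%R x = \int[leb]_t phi t.
    have mpN : measurable_fun setT (fun t : mR => phi (0 - t)%R) by meas.
    rewrite -(integral_lebesgue_reflect 0 mp p0) -(integral_signed_square mpN) //.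
    by apply: eq_integral => x _; rewrite /g mulN1r sub0r.
  by rewrite -mule2n -mule_natl.
rewrite -Ig -(@integral_setD1 _ f 0%R setT); last 2 first.
- exact: measurableD.
- exact: measurable_funTS.
rewrite -(@integral_setD1 _ (fun x => g 1%R x + g (-1)%R x) 0%R setT); last 2 first.
- exact: measurableD.
- exact: measurable_funTS mgg.
apply: ge0_le_integral => //.
- exact: measurableD.
- exact: measurable_funTS.
- exact: measurable_funTS mgg.
move=> x [_ /eqP x0]; apply: le_trans (fp x x0) _.
have le1 : `|x|%:E * phi (2 * x ^+ 2)%R <= (4 * `|x|)%:E * phi (2 * x ^+ 2)%R.
  by rewrite lee_wpmul2r // lee_fin ler_peMl // ler1n.
apply: le_trans le1 _; rewrite /g mul1r mulN1r.
have [x_ge0|x_lt0] := leP 0%R x.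
  by rewrite (ger0_norm x_ge0) -expr2 leeDl // mule_ge0 // lee_fin mulr_ge0.
have -> : (- (2 * (x * `|x|)) = 2 * x ^+ 2)%R by rewrite (ltr0_norm x_lt0); ring.
by rewrite leeDr // mule_ge0 // lee_fin mulr_ge0.
Qed.

(** The gain from transversality: (x, y) -> (x + y, x^2 + y^2) has Jacobian
    2 |x - y|.  In the variables z = x + y and v = x - z / 2 its second
    component is z^2 / 2 + 2 v^2, so that integral_normM_le applies for each z. *)
Lemma integral_paraboloid_sum_le (phi : mR * mR -> \bar R) (c : R) :
  measurable_fun setT phi -> (forall x, 0 <= phi x) ->
  \int[leb]_x \int[leb]_y (`|x - y|%:E * phi (x + y, c + x ^+ 2 + y ^+ 2)%R)
  <= 4%:E * \int[leb]_x \int[leb]_t phi (x, t).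
Proof.
move=> mp p0.
pose G (p : mR * mR) := `|p.1 - p.2|%:E * phi (p.1 + p.2, c + p.1 ^+ 2 + p.2 ^+ 2)%R.
have mG : measurable_fun setT G by rewrite /G; meas.
have G0 p : 0 <= G p by rewrite /G mule_ge0 // lee_fin.
have -> : \int[leb]_x \int[leb]_y G (x, y) = \int[leb]_z \int[leb]_x G (x, - x + z)%R.
  transitivity (\int[leb]_x \int[leb]_z G (x, - x + z)%R).
    apply: eq_integral => x _.
    rewrite (@integral_lebesgue_shift _ (- x)%R (fun y => G (x, y))) //; meas.
  apply: (@fubini_tonelli _ _ _ _ _ leb leb (fun p => G (p.1, - p.1 + p.2)%R)) => //.
  by meas.
rewrite -ge0_integralZl //; last 2 first.
- exact: measurable_integral_snd.
- by move=> x _; exact: integral_ge0.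
apply: ge0_le_integral => //.
- by move=> z _; exact: integral_ge0.
- apply: (@measurable_integral_fst _ _ _ _ _ leb (fun p => G (p.1, - p.1 + p.2)%R)) => //.
  by meas.
- by apply: measurable_funeM; exact: measurable_integral_snd.
move=> z _.
have -> : \int[leb]_x G (x, - x + z)%R = \int[leb]_v G (z / 2 + v, - (z / 2 + v) + z)%R.
  rewrite (@integral_lebesgue_shift _ (z / 2)%R (fun x => G (x, - x + z)%R)) //; meas.
pose psi (t : mR) := 2%:E * phi (z, (c + z ^+ 2 / 2) + t)%R.
have mpsi : measurable_fun setT psi by rewrite /psi; meas.
have psi0 t : 0 <= psi t by rewrite mule_ge0.
apply: (@le_trans _ _ (2%:E * \int[leb]_t psi t)).
  apply: integral_normM_le => //; first by meas.
  move=> v _; rewrite /G /psi /=.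
  have -> : (z / 2 + v - (- (z / 2 + v) + z) = 2 * v)%R by field.
  have -> : (z / 2 + v + (- (z / 2 + v) + z) = z)%R by ring.
  have -> : (c + (z / 2 + v) ^+ 2 + (- (z / 2 + v) + z) ^+ 2 =
    c + z ^+ 2 / 2 + 2 * v ^+ 2)%R by field.
  by rewrite normrM normr_nat EFinM muleCA muleA.
rewrite /psi ge0_integralZl //; last by meas.
rewrite (@integral_lebesgue_shift _ _ (fun t => phi (z, t))) //; last by meas.
by rewrite muleA -EFinM -natrM.
Qed.

End signed_square.

(** * Freezing coordinates *)

Section freezing.
Context {R : realType}.
Local Notation mR := (measurableTypeR R).
Local Notation leb := (@lebesgue_measure R).
Local Notation leb2 := (@lebesgue_plane R).
Local Notation ST n := ('rV[R]_n * mR)%type.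
Local Notation mu := (@lebesgue_spacetime R _).
Local Notation mu2 := (mu \x mu)%E.
Local Open Scope ereal_scope.

Lemma integral_pair_chart n (k : 'I_n.+1) (f : ST n.+1 * ST n.+1 -> \bar R) :
  measurable_fun setT f -> (forall x, 0 <= f x) ->
  \int[mu2]_pq f pq = \int[mu2]_zz \int[leb2]_xx
    f (paraboloid_chart k (zz.1, xx.1), paraboloid_chart k (zz.2, xx.2)).
Proof.
move=> mf f0; set c := paraboloid_chart k.
have mc : measurable_fun setT c by exact: measurable_paraboloid_chart.
pose F (zx : (ST n * ST n) * (mR * mR)) := f (c (zx.1.1, zx.2.1), c (zx.1.2, zx.2.2)).
have mF : measurable_fun setT F by rewrite /F; meas.
have F0 zx : 0 <= F zx by exact: f0.
pose G (zz : ST n * ST n) := \int[leb2]_xx F (zz, xx).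
have mG : measurable_fun setT G.
  exact: (@measurable_integral_snd _ _ _ _ _ leb2 F mF F0).
have G0 zz : 0 <= G zz by exact: integral_ge0.
rewrite (fubini_tonelli1 _ mf f0) [RHS](fubini_tonelli1 _ mG G0) /fubini_F.
pose g p := \int[mu]_q f (p, q).
have mg : measurable_fun setT g.
  exact: (@measurable_integral_snd _ _ _ _ _ mu f mf f0).
have g0 p : 0 <= g p by exact: integral_ge0.
rewrite (integral_paraboloid_chart k mg g0); apply: eq_integral => z1 _.
pose H (xz : mR * ST n) := \int[leb]_x2 f (c (z1, xz.1), c (xz.2, x2)).
have mH : measurable_fun setT H.
  apply: (@measurable_integral_snd _ _ _ _ _ leb
    (fun w : (mR * ST n) * mR => f (c (z1, w.1.1), c (w.1.2, w.2)))); last by [].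
  by meas.
have H0 xz : 0 <= H xz by exact: integral_ge0.
transitivity (\int[leb]_x1 \int[mu]_z2 H (x1, z2)).
  apply: eq_integral => x1 _; rewrite /g.
  have mf1 : measurable_fun setT (fun q => f (c (z1, x1), q)) by meas.
  by rewrite (integral_paraboloid_chart k mf1 (fun q => f0 _)).
rewrite (@fubini_tonelli _ _ _ _ _ leb mu H mH H0); apply: eq_integral => z2 _.
have mF' : measurable_fun setT (fun xx => F ((z1, z2), xx)) by rewrite /F /=; meas.
by rewrite /G (@fubini_tonelli1 _ _ _ _ _ leb leb _ mF' (fun xx => F0 _)).
Qed.

Lemma integral_spacetime_prod n (f : mR -> \bar R) (g : 'rV[R]_n -> \bar R) :
  measurable_fun setT f -> measurable_fun setT g ->
  (forall t, 0 <= f t) -> (forall x, 0 <= g x) ->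
  \int[mu]_z (f z.2 * g z.1) = \int[leb]_t f t * \int[lebesgue_rV R n]_x g x.
Proof.
move=> mf mg f0 g0.
rewrite integral_spacetime; last 2 first.
- by meas.
- by move=> z; rewrite mule_ge0.
rewrite -ge0_integralZl //; last by apply: integral_ge0 => t _; exact: f0.
apply: eq_integral => x _ /=; rewrite ge0_integralZr //.
Qed.

Lemma integral_sqr_chart_slices n (k : 'I_n.+1) (F3 : ST n.+1 -> \bar R) (y1 : 'rV[R]_n) :
  measurable_fun setT F3 -> (forall q, 0 <= F3 q) ->
  \int[lebesgue_rV R n]_y \int[leb]_x \int[leb]_t
    F3 (insert_coord k (- y1 - y, - x), - t)%R ^+ 2 = \int[mu]_q F3 q ^+ 2.
Proof.
move=> m3 p3.
have m3' : measurable_fun setT (fun q => F3 q ^+ 2) by meas.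
have p3' q : 0 <= F3 q ^+ 2 by exact: sqre_ge0.
rewrite (integral_spacetime m3' p3').
pose g xi := \int[leb]_t F3 (xi, t) ^+ 2.
have mg : measurable_fun setT g by exact: (measurable_integral_snd leb m3' p3').
have g0 xi : 0 <= g xi by exact: integral_ge0.
rewrite (integral_insert_coord k mg g0).
pose h y := \int[leb]_x g (insert_coord k (y, x)).
have mh : measurable_fun setT h.
  by apply: (@measurable_integral_snd _ _ _ _ _ leb (fun yx => g (insert_coord k (yx.1, yx.2)))) => //; meas.
have h0 y : 0 <= h y by exact: integral_ge0.
transitivity (\int[lebesgue_rV R n]_y h (- y1 - y)%R); last exact: integral_rV_reflect.
apply: eq_integral => y _.
have mg1 : measurable_fun setT (fun x : mR => g (insert_coord k ((- y1 - y)%R, x))).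
  by apply: (measurableT_comp mg); apply: measurable_fun_insert_coord => //; exact: measurable_cst.
rewrite /h -(integral_lebesgue_reflect 0 mg1 (fun x => g0 _)); apply: eq_integral => x _.
rewrite sub0r /g.
rewrite -(@integral_lebesgue_reflect _ 0 (fun t => F3 (insert_coord k ((- y1 - y)%R, (- x)%R), t) ^+ 2)) //.
  by apply: eq_integral => t _; rewrite sub0r.
by meas.
Qed.

Lemma third_chart n (k : 'I_n.+1) (z1 z2 : ST n) (x1 x2 : R) :
  third (paraboloid_chart k (z1, x1)) (paraboloid_chart k (z2, x2)) =
  (insert_coord k (- z1.1 - z2.1, - (x1 + x2)),
   - ((z1.2 + z2.2 + dot z1.1 z1.1 + dot z2.1 z2.1) + x1 ^+ 2 + x2 ^+ 2))%R.
Proof.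
rewrite /third /paraboloid_chart /= !dot_insert_coord /=; congr pair; last by ring.
apply/rowP => i; rewrite !mxE; case: unliftP => [j _|_]; last by rewrite opprD.
by rewrite !mxE.
Qed.

(** Two applications of Cauchy-Schwarz.  In the first, over x1 and x2 with z1
    and z2 frozen, the factor |x1 - x2| is the Jacobian that turns the square
    of F3 into an integral over its own variables.  The second, over z1 and
    z2, leaves the integrals of lam and kap. *)
Lemma trilinear_bounded_freeze n (k : 'I_n.+1) (K : ST n.+1 * ST n.+1 -> R)
    (lam : mR -> R) (kap : 'rV[R]_n.+1 * 'rV[R]_n -> R) (Cl Ck : R) :
  measurable_fun setT K -> measurable_fun setT lam -> measurable_fun setT kap ->
  (forall pq, 0 <= K pq)%R -> (forall t, 0 <= lam t)%R -> (forall w, 0 <= kap w)%R ->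
  (0 <= Cl)%R -> (0 <= Ck)%R ->
  \int[leb]_t (lam t)%:E <= Cl%:E ->
  (forall xi, \int[lebesgue_rV R n]_y (kap (xi, y))%:E <= Ck%:E) ->
  (forall (z1 z2 : ST n) (x1 x2 : mR),
    K (paraboloid_chart k (z1, x1), paraboloid_chart k (z2, x2)) ^+ 2 <=
    kap (insert_coord k (z2.1, x2), z1.1) * (lam z1.2 * lam z2.2) * `|x1 - x2|)%R ->
  trilinear_bounded K.
Proof.
move=> mK ml mk K0 l0 k0 Cl0 Ck0 Il Ik HK.
exists (4 * Cl ^+ 2 * Ck)%R; first by rewrite !mulr_ge0 // sqr_ge0.
move=> F1 F2 F3 m1 m2 m3 p1 p2 p3.
pose c : ST n * mR -> ST n.+1 := paraboloid_chart k.
have mc : measurable_fun setT c by exact: measurable_paraboloid_chart.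
pose f (pq : ST n.+1 * ST n.+1) := (K pq)%:E * (F1 pq.1 * F2 pq.2 * F3 (third pq.1 pq.2)).
have mf : measurable_fun setT f by exact: measurable_trilinear.
have f0 pq : 0 <= f pq by rewrite !mule_ge0 ?lee_fin.
have -> : trilinear K F1 F2 F3 = \int[mu2]_zz \int[leb2]_xx f (c (zz.1, xx.1), c (zz.2, xx.2)).
  exact: integral_pair_chart.
pose I zz := \int[leb2]_xx f (c (zz.1, xx.1), c (zz.2, xx.2)).
have mI : measurable_fun setT I.
  apply: (@measurable_integral_snd _ _ _ _ _ leb2
    (fun w : (ST n * ST n) * (mR * mR) => f (c (w.1.1, w.2.1), c (w.1.2, w.2.2)))); last by [].
  by meas.
have I0 zz : 0 <= I zz by exact: integral_ge0.
(* the squared masses on a frozen line *)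
pose G1 (z : ST n) := \int[leb]_x F1 (c (z, x)) ^+ 2.
have mG1 : measurable_fun setT G1.
  apply: (@measurable_integral_snd _ _ _ _ _ leb (fun zx => F1 (c zx) ^+ 2)); first by meas.
  by move=> zx; exact: sqre_ge0.
have G10 z : 0 <= G1 z by apply: integral_ge0 => x _; exact: sqre_ge0.
pose Phi (zz : ST n * ST n) := \int[leb]_x
  (F2 (c (zz.2, x)) ^+ 2 * (kap (insert_coord k (zz.2.1, x), zz.1.1))%:E).
pose phi (w : (ST n * ST n) * mR) :=
  F2 (c (w.1.2, w.2)) ^+ 2 * (kap (insert_coord k (w.1.2.1, w.2), w.1.1.1))%:E.
have mphi : measurable_fun setT phi by rewrite /phi; meas.
have phi0 w : 0 <= phi w by rewrite mule_ge0 ?sqre_ge0 // lee_fin.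
have mPhi : measurable_fun setT Phi by exact: (measurable_integral_snd leb mphi phi0).
have Phi0 zz : 0 <= Phi zz by apply: integral_ge0 => x _; exact: (phi0 (zz, x)).
pose H (yy : 'rV[R]_n * 'rV[R]_n) := \int[leb]_x \int[leb]_t
  F3 (insert_coord k (- yy.1 - yy.2, - x), - t)%R ^+ 2.
have mH : measurable_fun setT H.
  have m3w : measurable_fun setT (fun w : (('rV[R]_n * 'rV[R]_n) * mR) * mR =>
      F3 (insert_coord k (- w.1.1.1 - w.1.1.2, - w.1.2), - w.2)%R ^+ 2).
    by meas.
  have m3w' := measurable_integral_snd leb m3w (fun w => sqre_ge0 _).
  apply: (measurable_integral_snd leb m3w') => w.
  by apply: integral_ge0 => t _; exact: sqre_ge0.
have H0 yy : 0 <= H yy.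
  by apply: integral_ge0 => x _; apply: integral_ge0 => t _; exact: sqre_ge0.
set N1 := \int[mu]_q F1 q ^+ 2; set N2 := \int[mu]_q F2 q ^+ 2.
set N3 := \int[mu]_q F3 q ^+ 2.
have N10 : 0 <= N1 by apply: integral_ge0 => q _; exact: sqre_ge0.
have N20 : 0 <= N2 by apply: integral_ge0 => q _; exact: sqre_ge0.
have N30 : 0 <= N3 by apply: integral_ge0 => q _; exact: sqre_ge0.
pose A zz := 4%:E * (G1 zz.1 * ((lam zz.2.2)%:E * H (zz.1.1, zz.2.1))).
pose B zz := (lam zz.1.2)%:E * Phi zz.
have mA : measurable_fun setT A by rewrite /A; meas.
have mB : measurable_fun setT B by rewrite /B; meas.
have A0 zz : 0 <= A zz by rewrite /A !mule_ge0 // lee_fin.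
have B0 zz : 0 <= B zz by rewrite /B !mule_ge0 // lee_fin.
have IAB zz : I zz ^+ 2 <= A zz * B zz.
  case: zz => z1 z2.
  pose ll := (lam z1.2 * lam z2.2)%:E.
  have ll0 : 0 <= ll by rewrite lee_fin mulr_ge0.
  pose a (xx : mR * mR) := ll * (F1 (c (z1, xx.1)) ^+ 2 * phi ((z1, z2), xx.2)).
  pose b (xx : mR * mR) := `|xx.1 - xx.2|%:E * F3 (third (c (z1, xx.1)) (c (z2, xx.2))) ^+ 2.
  pose g (xx : mR * mR) := f (c (z1, xx.1), c (z2, xx.2)).
  have ma : measurable_fun setT a by rewrite /a; meas.
  have mb : measurable_fun setT b by rewrite /b; meas.
  have mg : measurable_fun setT g by rewrite /g; meas.
  have a0 xx : 0 <= a xx.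
    by apply: mule_ge0 => //; apply: mule_ge0; [exact: sqre_ge0|exact: phi0].
  have b0 xx : 0 <= b xx by apply: mule_ge0; [rewrite lee_fin|exact: sqre_ge0].
  have gab xx : g xx ^+ 2 <= a xx * b xx.
    rewrite /g /f !sqreM -EFin_expe.
    have := HK z1 z2 xx.1 xx.2; rewrite -/c -lee_fin => hk.
    apply: le_trans (lee_wpmul2r _ hk) _; first by rewrite !mule_ge0 // ?sqre_ge0.
    rewrite /a /b /ll /phi /= !EFinM.
    move: (kap _)%:E (lam z1.2)%:E (lam z2.2)%:E (`|xx.1 - xx.2|)%:E => u v w x.
    move: (F1 _) (F2 _) (F3 _) => r s t; rewrite -!expe2.
    move: (r ^+ 2) (s ^+ 2) (t ^+ 2) => {}r {}s {}t.
    rewrite le_eqVlt; apply/orP; left; apply/eqP.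
    by rewrite !muleA [LHS](ACl (2*3*5*6*1*4*7)%AC).
  have Ia : \int[leb2]_xx a xx = ll * (G1 z1 * Phi (z1, z2)).
    rewrite (@fubini_tonelli1 _ _ _ _ _ leb leb a ma a0).
    transitivity (\int[leb]_x (F1 (c (z1, x)) ^+ 2 * (ll * Phi (z1, z2)))).
      apply: eq_integral => x _; rewrite /fubini_F.
      have mphix : measurable_fun setT (fun y : mR => phi ((z1, z2), y)) by meas.
      transitivity (\int[leb]_y ((ll * F1 (c (z1, x)) ^+ 2) * phi ((z1, z2), y))).
        by apply: eq_integral => y _; rewrite /a muleA.
      rewrite ge0_integralZl //; last by rewrite mule_ge0 // sqre_ge0.
      by rewrite -muleA muleCA.
    rewrite ge0_integralZr //; [by rewrite muleCA|by meas|by move=> x _; exact: sqre_ge0|].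
    by rewrite mule_ge0.
  have Ib : \int[leb2]_xx b xx <= 4%:E * H (z1.1, z2.1).
    rewrite (@fubini_tonelli1 _ _ _ _ _ leb leb b mb b0) /fubini_F.
    pose F3' (xt : mR * mR) := F3 (insert_coord k (- z1.1 - z2.1, - xt.1), - xt.2)%R ^+ 2.
    have mF3' : measurable_fun setT F3' by rewrite /F3'; meas.
    have := @integral_paraboloid_sum_le _ F3'
      (z1.2 + z2.2 + dot z1.1 z1.1 + dot z2.1 z2.1)%R mF3' (fun x => sqre_ge0 _).
    apply: le_trans; rewrite le_eqVlt; apply/orP; left; apply/eqP.
    apply: eq_integral => x _; apply: eq_integral => y _.
    by rewrite /b /F3' /= third_chart.
  have := @cauchy_schwarz_integral _ _ R leb2 g a b mg ma mb (fun x => f0 _) a0 b0 gab.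
  move=> /le_trans; apply; rewrite Ia.
  apply: le_trans (lee_wpmul2l _ Ib) _; first by rewrite !mule_ge0.
  rewrite /A /B /ll /= EFinM.
  by rewrite !muleA [X in X <= _](ACl (5*3*2*6*1*4)%AC).
have := @cauchy_schwarz_integral _ _ R mu2 I A B mI mA mB I0 A0 B0 IAB.
move=> /le_trans; apply.
have IA : \int[mu2]_zz A zz <= 4%:E * (N1 * (Cl%:E * N3)).
  rewrite (fubini_tonelli1 _ mA A0) /fubini_F.
  have -> : N1 = \int[mu]_z G1 z.
    rewrite /N1; apply: (integral_paraboloid_chart k); first by meas.
    by move=> q; exact: sqre_ge0.
  have mlam : measurable_fun setT (fun t => (lam t)%:E) by meas.
  have lam0 t : 0 <= (lam t)%:E by rewrite lee_fin.
  have CN0 : 0 <= Cl%:E * N3 by rewrite mule_ge0 // lee_fin.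
  rewrite -ge0_integralZr // -ge0_integralZl //; last 2 first.
  - by meas.
  - by move=> z _; rewrite mule_ge0.
  apply: ge0_le_integral => //.
  - by move=> z _; apply: integral_ge0 => z2 _; exact: A0.
  - exact: (measurable_integral_snd mu mA A0).
  - by meas.
  move=> z1 _.
  have mHz : measurable_fun setT (fun y => H (z1.1, y)) by meas.
  have mHl : measurable_fun setT (fun z2 : ST n => (lam z2.2)%:E * H (z1.1, z2.1)) by meas.
  have Hl0 (z2 : ST n) : 0 <= (lam z2.2)%:E * H (z1.1, z2.1) by rewrite mule_ge0.
  have -> : \int[mu]_z2 A (z1, z2) = 4%:E * (G1 z1 * \int[mu]_z2 ((lam z2.2)%:E * H (z1.1, z2.1))).
    rewrite -ge0_integralZl // -ge0_integralZl //; first by meas.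
    by move=> z2 _; rewrite mule_ge0.
  rewrite (integral_spacetime_prod mlam mHz) //.
  apply: lee_wpmul2l => //; apply: lee_wpmul2l => //.
  have -> : \int[lebesgue_rV R n]_y H (z1.1, y) = N3 by exact: integral_sqr_chart_slices.
  exact: lee_wpmul2r.
have IB : \int[mu2]_zz B zz <= (Cl * Ck)%:E * N2.
  rewrite (fubini_tonelli2 _ mB B0) /fubini_G.
  have -> : N2 = \int[mu]_z \int[leb]_x F2 (c (z, x)) ^+ 2.
    rewrite /N2; apply: (integral_paraboloid_chart k); first by meas.
    by move=> q; exact: sqre_ge0.
  have CC0 : 0 <= (Cl * Ck)%:E by rewrite lee_fin mulr_ge0.
  have mF2 : measurable_fun setT (fun zx => F2 (c zx) ^+ 2) by meas.
  have mG2 := measurable_integral_snd leb mF2 (fun zx => sqre_ge0 _).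
  rewrite -ge0_integralZl //; last by move=> z _; apply: integral_ge0 => x _; exact: sqre_ge0.
  apply: ge0_le_integral => //.
  - by move=> z _; apply: integral_ge0 => z1 _; exact: B0.
  - exact: (measurable_integral_fst mu mB B0).
  - exact: measurable_funeM.
  move=> z2 _.
  pose E (zx : ST n * mR) := (lam zx.1.2)%:E * phi ((zx.1, z2), zx.2).
  have mE : measurable_fun setT E by rewrite /E; meas.
  have E0 zx : 0 <= E zx by rewrite /E mule_ge0 // lee_fin.
  have mF2z : measurable_fun setT (fun x : mR => F2 (c (z2, x)) ^+ 2) by meas.
  have -> : \int[mu]_z1 B (z1, z2) = \int[mu]_z1 \int[leb]_x E (z1, x).
    apply: eq_integral => z1 _; rewrite /B /Phi /= -ge0_integralZl ?lee_fin //.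
      have mp : measurable_fun setT (fun x : mR => phi ((z1, z2), x)) by meas.
      exact: mp.
    by move=> x _; exact: (phi0 ((z1, z2), x)).
  rewrite (@fubini_tonelli _ _ _ _ _ mu leb E mE E0) -ge0_integralZl //; last first.
    by move=> x _; exact: sqre_ge0.
  apply: ge0_le_integral => //.
  - by move=> x _; apply: integral_ge0 => z1 _; exact: E0.
  - exact: (measurable_integral_fst mu mE E0).
  - exact: measurable_funeM.
  move=> x _.
  have mlam : measurable_fun setT (fun t => (lam t)%:E) by meas.
  have lam0 t : 0 <= (lam t)%:E by rewrite lee_fin.
  have mkx : measurable_fun setT (fun y => (kap (insert_coord k (z2.1, x), y))%:E) by meas.
  have kx0 y : 0 <= (kap (insert_coord k (z2.1, x), y))%:E by rewrite lee_fin.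
  have -> : \int[mu]_z1 E (z1, x) = F2 (c (z2, x)) ^+ 2 *
      \int[mu]_z1 ((lam z1.2)%:E * (kap (insert_coord k (z2.1, x), z1.1))%:E).
    transitivity (\int[mu]_z1 (F2 (c (z2, x)) ^+ 2 *
        ((lam z1.2)%:E * (kap (insert_coord k (z2.1, x), z1.1))%:E))).
      by apply: eq_integral => z _; exact: muleCA.
    apply: ge0_integralZl; [exact: measurableT|by meas|by move=> z _; rewrite mule_ge0|].
    exact: sqre_ge0.
  rewrite (integral_spacetime_prod mlam mkx) // muleC.
  apply: lee_wpmul2r; first exact: sqre_ge0.
  rewrite EFinM; apply: lee_pmul => //; apply: integral_ge0 => *; rewrite lee_fin //.
apply: le_trans (lee_pmul _ _ IA IB) _; try by apply: integral_ge0.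
rewrite le_eqVlt; apply/orP; left; apply/eqP.
rewrite expr2 !EFinM !muleA [LHS](ACl (1*3*5*6*2*7*4)%AC) //.
Qed.

End freezing.

(** * Integrals of powers of brackets *)

Section bracket_integrals.
Context {R : realType}.
Local Notation mR := (measurableTypeR R).
Local Notation leb := (@lebesgue_measure R).

Lemma bracket_ge1 (x : R) : 1 <= bracket x.
Proof. by rewrite -[leLHS]sqrtr1 ler_wsqrtr // lerDl sqr_ge0. Qed.

Lemma bracket_gt0 (x : R) : 0 < bracket x.
Proof. exact: lt_le_trans (bracket_ge1 x). Qed.

Lemma sqr_bracket (x : R) : bracket x ^+ 2 = 1 + x ^+ 2.
Proof. by rewrite sqr_sqrtr // addr_ge0 // sqr_ge0. Qed.

Lemma ler_sqr_pos (x y : R) : 0 <= y -> x ^+ 2 <= y ^+ 2 -> x <= y.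
Proof.
by move=> y0 xy; have := ler_wsqrtr xy; rewrite !sqrtr_sqr (ger0_norm y0);
  apply: le_trans; exact: ler_norm.
Qed.

Lemma bracket_ge_norm (x : R) : `|x| <= bracket x.
Proof.
apply: ler_sqr_pos; first exact/ltW/bracket_gt0.
by rewrite sqr_bracket real_normK ?num_real // lerDr.
Qed.

Lemma bracket_ge_half (x : R) : (1 + `|x|) / 2 <= bracket x.
Proof. by rewrite ler_pdivrMr // mulr_natr mulr2n lerD ?bracket_ge1 ?bracket_ge_norm. Qed.

Lemma ler_powRN (b x y : R) : 0 <= b -> 0 < x -> x <= y -> y `^ (- b) <= x `^ (- b).
Proof.
move=> b0 x0 xy; rewrite !powRN lef_pV2 ?posrE ?powR_gt0 //; last exact: lt_le_trans xy.
by apply: ge0_ler_powR => //; rewrite nnegrE ltW //; exact: lt_le_trans xy.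
Qed.

Lemma bracket_powRN_le (b x : R) : 0 <= b ->
  bracket x `^ (- b) <= 2 `^ b * (1 + `|x|) `^ (- b).
Proof.
move=> b0; apply: le_trans (ler_powRN b0 _ (bracket_ge_half x)) _.
  by rewrite divr_gt0 // ltr_pwDl.
rewrite powRM ?addr_ge0 // ?invr_ge0 // mulrC ler_wpM2r ?powR_ge0 //.
by rewrite -powR_inv1 // -powRrM mulN1r opprK.
Qed.

Lemma is_derive_powR1D (p x : R) : 0 <= x -> p != 0 ->
  is_derive x (1 : R) (fun x : R => (1 + x) `^ p / p) ((1 + x) `^ (p - 1)).
Proof.
move=> x0 p0.
have x1 : 0 < 1 + x by rewrite ltr_pwDl.
have d1 := is_derive1_powR p x1.
have d2 : is_derive x (1 : R) (fun x : R => 1 + x) 1.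
  by have := is_deriveD (is_derive_cst (1:R) x (1:R)) (is_derive_id x (1:R)); rewrite add0r.
have d3 := is_derive1_comp d1 d2.
have -> : (fun x : R => (1 + x) `^ p / p) = p^-1 \*: ((@powR R ^~ p) \o (fun x : R => 1 + x)).
  by apply/funext => y; rewrite /= mulrC.
apply: is_derive_eq; rewrite /GRing.scale /= mulr1.
by rewrite mulrA mulVf // mul1r.
Qed.

Lemma continuous_powR1D (p x : R) : 0 <= x -> continuous_at x (fun x : R => (1 + x) `^ p).
Proof.
move=> x0; have [->|p0] := eqVneq p 0.
  have -> : (fun x : R => (1 + x) `^ 0) = cst 1 by apply/funext => y; rewrite powRr0.
  exact: cvg_cst.
have -> : (fun x : R => (1 + x) `^ p) = p \*: (fun x : R => (1 + x) `^ p / p).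
  by apply/funext => y; rewrite /= /GRing.scale /= mulrC divfK.
apply: differentiable_continuous; apply/derivable1_diffP; apply: derivableZ.
exact: (@ex_derive _ _ _ _ _ _ _ (is_derive_powR1D x0 p0)).
Qed.

Lemma integral_powR1D_itv (p r : R) : p != 0 -> 0 < r ->
  (\int[leb]_(x in `[0%R, r]) ((1 + x) `^ (p - 1))%:E = (((1 + r) `^ p - 1) / p)%:E)%E.
Proof.
move=> p0 r0.
rewrite (@continuous_FTC2 _ _ (fun x : R => (1 + x) `^ p / p)) //.
- by rewrite -EFinB addr0 powR1 -mulrBl.
- apply: (@continuous_in_subspaceT _ _ `[0, r]%classic) => x; rewrite inE /= in_itv /= => /andP[x0 _].
  exact: continuous_powR1D.
- have cF (x : R) : 0 <= x -> continuous_at x (fun x : R => (1 + x) `^ p / p).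
    by move=> x0; apply: cvgM; [exact: continuous_powR1D|exact: cvg_cst].
  split.
  + move=> x; rewrite in_itv /= => /andP[/ltW x0 _].
    exact: (@ex_derive _ _ _ _ _ _ _ (is_derive_powR1D x0 p0)).
  + by apply: cvg_at_right_filter; exact: cF.
  + by apply: cvg_at_left_filter; apply: cF; exact: ltW.
- move=> x; rewrite in_itv /= => /andP[/ltW x0 _].
  by rewrite derive1E (@derive_val _ _ _ _ _ _ _ (is_derive_powR1D x0 p0)).
Qed.

Lemma cvg_powR1D_pinfty (p : R) : p < 0 -> (1 + x) `^ p @[x --> +oo] --> (0 : R).
Proof.
move=> p0; apply/cvgrPdist_le => e e0.
near=> x; rewrite sub0r normrN ger0_norm ?powR_ge0 //.
have x0 : 0 < x by near: x; exact: nbhs_pinfty_gt.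
have ex : e `^ p^-1 <= 1 + x.
  by apply: (@le_trans _ _ x); [near: x; exact: nbhs_pinfty_ge|rewrite lerDr].
rewrite -[p]opprK; apply: le_trans (ler_powRN _ _ ex) _.
- by rewrite oppr_ge0 ltW.
- exact: powR_gt0.
- by rewrite opprK -powRrM mulVf ?lt_eqF // powRr1 // ltW.
Unshelve. all: by end_near. Qed.

Lemma integral_powR1D_pinfty (p : R) : p < 0 ->
  (\int[leb]_(x in `[0%R, +oo[) ((1 + x) `^ (p - 1))%:E = (- p^-1)%:E)%E.
Proof.
move=> p0; have pn0 : p != 0 by rewrite lt_eqF.
rewrite (@ge0_continuous_FTC2y _ _ (fun x : R => (1 + x) `^ p / p) 0 0) //.
- by rewrite addr0 powR1 div1r sub0e EFinN.
- by move=> x _; exact: powR_ge0.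
- apply: continuous_in_subspaceT => x.
  by rewrite inE /= in_itv /= andbT => x0; exact: continuous_powR1D.
- by rewrite -[X in _ --> X](mul0r p^-1); apply: cvgM; [exact: cvg_powR1D_pinfty|exact: cvg_cst].
- move=> x /ltW x0; exact: (@ex_derive _ _ _ _ _ _ _ (is_derive_powR1D x0 pn0)).
- apply: cvg_at_right_filter; apply: cvgM; [exact: continuous_powR1D|exact: cvg_cst].
- move=> x; rewrite in_itv /= andbT => /ltW x0.
  by rewrite derive1E (@derive_val _ _ _ _ _ _ _ (is_derive_powR1D x0 pn0)).
Qed.
Local Open Scope ereal_scope.

Lemma integral_even_le (f : mR -> \bar R) :
  measurable_fun setT f -> (forall x, 0 <= f x) ->
  \int[leb]_x f `|x|%R <= 2%:E * \int[leb]_(x in `[0%R, +oo[) f x.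
Proof.
move=> mf f0; pose g := f \_ `[0%R, +oo[.
have mg : measurable_fun setT g.
  have mD : measurable (`[0%R, +oo[%classic : set mR) by exact: measurable_itv.
  by apply/(measurable_restrictT _ mD); exact: measurable_funTS.
have g0 x : 0 <= g x by rewrite /g /patch; case: ifP.
have mgN : measurable_fun setT (fun x : mR => g (0 - x)%R) by meas.
rewrite [X in 2%:E * X]integral_mkcond -/g.
have -> : 2%:E * \int[leb]_x g x = \int[leb]_x (g x + g (0 - x)%R).
  by rewrite ge0_integralD // (integral_lebesgue_reflect 0 mg g0) -mule2n -mule_natl.
apply: ge0_le_integral => //.
- by meas.
- exact: emeasurable_funD.
have memE (y : mR) : (y \in (`[0%R, +oo[%classic : set mR)) = (0 <= y)%R.
  by apply/idP/idP; rewrite inE /= in_itv /= andbT.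
move=> x _; rewrite /g /patch !memE sub0r.
have [x0|x0] := leP 0%R x; first by rewrite ger0_norm // leeDl //; case: ifP.
by rewrite (ltr0_norm x0) oppr_ge0 (ltW x0) [X in X + _](_ : _ = 0) // add0e.
Qed.

Lemma integral_bracket_lty (b : R) : (1 < b)%R ->
  exists2 C : R, (0 <= C)%R & \int[leb]_x (bracket x `^ (- b))%:E <= C%:E.
Proof.
move=> b1; have b0 : (0 <= b)%R by exact: ltW (lt_trans _ b1).
exists (2 * (2 `^ b * - (1 - b)^-1))%R.
  by rewrite !mulr_ge0 ?powR_ge0 // -invrN opprB invr_ge0 subr_ge0 ltW.
pose f (x : mR) := (2 `^ b)%:E * ((1 + x) `^ (- b))%:E.
have mf : measurable_fun setT f by rewrite /f; meas.
have f0 x : 0 <= f x by rewrite mule_ge0 // lee_fin powR_ge0.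
apply: (@le_trans _ _ (\int[leb]_x f `|x|%R)).
  apply: ge0_le_integral => //.
  - by move=> x _; rewrite lee_fin powR_ge0.
  - by meas.
  - by meas.
  - by move=> x _; rewrite /f -EFinM lee_fin; exact: bracket_powRN_le.
apply: le_trans (integral_even_le mf f0) _.
rewrite EFinM lee_pmul2l ?fin_numE // ?lte_fin //.
rewrite /f ge0_integralZl_EFin ?powR_ge0 //; last 2 first.
- by move=> x _; rewrite lee_fin powR_ge0.
- by apply: measurable_funTS; meas.
have -> : \int[leb]_(x in `[0%R, +oo[) ((1 + x) `^ (- b))%:E = (- (1 - b)^-1)%:E.
  have E : (1 - b - 1 = - b)%R by ring.
  by rewrite -integral_powR1D_pinfty ?subr_lt0 // E.
by rewrite -EFinM.
Qed.

Lemma integral_bracket_ball_le (b : R) : (0 <= b < 1)%R ->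
  exists2 C : R, (0 <= C)%R & forall r : R, (1 <= r)%R ->
    \int[leb]_x ((`|x| <= r)%R%:R * bracket x `^ (- b))%:E <= (C * r `^ (1 - b))%:E.
Proof.
move=> /andP[b0 b1]; have b10 : (0 < 1 - b)%R by rewrite subr_gt0.
exists (2 * (2 `^ b * (2 `^ (1 - b) / (1 - b))))%R.
  by rewrite !mulr_ge0 ?powR_ge0 // invr_ge0 ltW.
move=> r r1; have r0 : (0 < r)%R by exact: lt_le_trans r1.
pose f (x : mR) := ((x <= r)%R%:R * (2 `^ b * (1 + x) `^ (- b)))%:E.
have mf : measurable_fun setT f by rewrite /f; meas.
have f0 x : 0 <= f x by rewrite lee_fin !mulr_ge0 ?powR_ge0.
apply: (@le_trans _ _ (\int[leb]_x f `|x|%R)).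
  apply: ge0_le_integral => //.
  - by move=> x _; rewrite lee_fin mulr_ge0 ?powR_ge0.
  - by meas.
  - by meas.
  - by move=> x _; rewrite /f lee_fin ler_wpM2l //; exact: bracket_powRN_le.
apply: le_trans (integral_even_le mf f0) _.
have -> : \int[leb]_(x in `[0%R, +oo[) f x =
    \int[leb]_(x in `[0%R, r]) ((2 `^ b)%:E * ((1 + x) `^ ((1 - b) - 1))%:E).
  rewrite integral_mkcond [RHS]integral_mkcond; apply: eq_integral => x _.
  rewrite /patch /f mem_setE [in RHS]mem_setE !in_itv /= andbT.
  have -> : (1 - b - 1 = - b)%R by ring.
  by case: (leP 0%R x); case: (leP x r); rewrite ?mul1r ?mul0r //= -EFinM.
rewrite ge0_integralZl_EFin ?powR_ge0 //; last 2 first.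
- by move=> x _; rewrite lee_fin powR_ge0.
- by apply: measurable_funTS; meas.
rewrite integral_powR1D_itv ?gt_eqF // -!EFinM lee_fin.
rewrite -!mulrA ler_wpM2l // ler_wpM2l ?powR_ge0 //.
rewrite [leRHS](_ : _ = (2 * r) `^ (1 - b) / (1 - b))%R; last first.
  by rewrite powRM ?(ltW r0) // mulrCA mulrC.
rewrite ler_pM2r ?invr_gt0 //.
rewrite lerBlDr; apply: (@le_trans _ _ ((2 * r) `^ (1 - b))%R); last by rewrite lerDl.
apply: ge0_ler_powR; rewrite ?nnegrE; [exact: ltW| | |].
- by rewrite addr_ge0 // ltW.
- by rewrite mulr_ge0 // ltW.
- by rewrite mulr_natl mulr2n lerD2r.
Qed.

End bracket_integrals.

Section product_integrals.
Context {R : realType}.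
Local Notation mR := (measurableTypeR R).
Local Notation leb := (@lebesgue_measure R).
Local Open Scope ereal_scope.

Lemma measurable_rV_prod n (f : 'I_n -> mR -> \bar R) :
  (forall i, measurable_fun setT (f i)) ->
  measurable_fun setT (fun x : 'rV[R]_n => \prod_(i < n) f i (x ord0 i)).
Proof.
move=> mf; elim: n f mf => [|n IH] f mf.
  by under eq_fun do rewrite big_ord0; exact: measurable_cst.
have -> : (fun x : 'rV[R]_n.+1 => \prod_(i < n.+1) f i (x ord0 i)) =
    (fun x : 'rV[R]_n.+1 => f ord0 (x ord0 ord0) *
      (fun y : 'rV[R]_n => \prod_(i < n) f (lift ord0 i) (y ord0 i)) (\row_i x ord0 (lift ord0 i))).
  apply/funext => x; rewrite big_ord_recl; congr (_ * _).
  by apply: eq_bigr => i _; rewrite mxE.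
apply: emeasurable_funM; first by have := mf ord0; move=> mf0; meas.
apply: (measurableT_comp (IH _ (fun i => mf _))).
by apply: measurable_fun_rV => i; under eq_fun do rewrite mxE; exact: measurable_coord_rV.
Qed.

Lemma integral_rV_prod n (f : 'I_n -> mR -> \bar R) :
  (forall i, measurable_fun setT (f i)) -> (forall i x, 0 <= f i x) ->
  \int[lebesgue_rV R n]_x \prod_(i < n) f i (x ord0 i) = \prod_(i < n) \int[leb]_x f i x.
Proof.
move=> mf f0; elim: n f mf f0 => [|n IH] f mf f0.
  under eq_integral do rewrite big_ord0.
  rewrite integral_cst // big_ord0 mul1e.
  by rewrite [LHS](_ : _ = \d_(0%R : 'rV[R]_0) setT) // diracT.
rewrite (integral_insert_coord ord0 (measurable_rV_prod mf)); last by move=> x; exact: prode_ge0.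
rewrite big_ord_recl -(IH (fun i => f (lift ord0 i))) //.
have mf0 := mf ord0.
rewrite -ge0_integralZl //; last 3 first.
- exact: (measurable_rV_prod (fun i => mf (lift ord0 i))).
- by move=> y _; exact: prode_ge0.
- exact: integral_ge0.
apply: eq_integral => y _.
rewrite -ge0_integralZr //; last exact: prode_ge0.
apply: eq_integral => x _; rewrite big_ord_recl insert_coord_same; congr (_ * _).
by apply: eq_bigr => i _; rewrite insert_coord_lift.
Qed.

End product_integrals.

(** * Cubes and annuli *)

Section annulus.
Context {R : realType}.
Local Notation mR := (measurableTypeR R).
Local Notation leb := (@lebesgue_measure R).

Definition cube n (r : R) (y : 'rV[R]_n) : R := \prod_(j < n) (`|y ord0 j| <= r)%R%:R.

Lemma cube_ge0 n r (y : 'rV[R]_n) : 0 <= cube r y.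
Proof. by apply: prodr_ge0. Qed.

Lemma cube1 n r (y : 'rV[R]_n) : (forall j, `|y ord0 j| <= r) -> cube r y = 1.
Proof. by move=> H; rewrite /cube big1 // => j _; rewrite H. Qed.

Lemma cubeP n r (y : 'rV[R]_n) : cube r y = 0 \/ (cube r y = 1 /\ forall j, `|y ord0 j| <= r).
Proof.
have [/forallP H|/forallPn [j Hj]] := boolP [forall j, `|y ord0 j| <= r].
  by right; split => //; exact: cube1.
by left; rewrite /cube (bigD1 j) //= (negbTE Hj) mul0r.
Qed.

Lemma measurable_cube d (T : measurableType d) n (f : T -> R) (g : T -> 'rV[R]_n) :
  measurable_fun setT f -> measurable_fun setT g ->
  measurable_fun setT (fun t => cube (f t) (g t)).
Proof. by move=> mf mg; apply: measurable_prod => j _; meas. Qed.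

Local Open Scope ereal_scope.

Lemma integral_norm_le (r : R) : (0 <= r)%R ->
  \int[leb]_x ((`|x| <= r)%R%:R)%:E = (2 * r)%:E.
Proof.
move=> r0.
transitivity (\int[leb]_(x in `[(- r)%R, r]) 1).
  rewrite [RHS]integral_mkcond; apply: eq_integral => x _.
  by rewrite /patch mem_setE in_itv /= ler_norml; case: ifP.
rewrite integral_cst // mul1e; transitivity (leb `[(- r)%R, r]) => //.
rewrite lebesgue_measure_itv /= lte_fin; case: ltP => [_|h].
  by rewrite opprK mulr_natl mulr2n.
by congr EFin; lra.
Qed.

Lemma integral_cube n (r : R) : (0 <= r)%R ->
  \int[lebesgue_rV R n]_y (cube r y)%:E = ((2 * r) ^+ n)%:E.
Proof.
move=> r0.
under eq_integral do rewrite /cube -prodEFin.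
rewrite (@integral_rV_prod _ _ (fun _ x => ((`|x| <= r)%R%:R)%:E)); last 2 first.
- by move=> i; meas.
- by move=> i x; rewrite lee_fin.
rewrite integral_norm_le //.
by rewrite prodEFin prodr_const card_ord.
Qed.

Lemma sum_sqr_le_cube n (r : R) (y : 'rV[R]_n) :
  (forall j, `|y ord0 j| <= r)%R -> (dot y y <= n%:R * r ^+ 2)%R.
Proof.
move=> H; rewrite /dot mulr_natl -[X in (_ <= _ *+ X)%R]card_ord -sumr_const.
apply: ler_sum => i _; rewrite -expr2 -real_normK ?num_real //.
by rewrite ler_sqr ?nnegrE ?H // (le_trans _ (H i)).
Qed.

(** Here x is the largest coordinate and y stands for the n + 1 others.  For
    fixed y the substitution s = 2 (|y|^2 + x^2) contributes a factor of order
    1 / |x|, and y runs over a cube of volume of order |x|^(n+1); together they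
    cancel the weight |x|^(-n). *)
Lemma integral_frozen_annulus_le n (g : mR -> \bar R) (F : mR -> 'rV[R]_n.+1 -> \bar R) :
  measurable_fun setT g -> (forall s, 0 <= g s) ->
  measurable_fun setT (fun w : 'rV[R]_n.+1 * mR => F w.2 w.1) -> (forall x y, 0 <= F x y) ->
  (forall x y, x != 0%R ->
     F x y <= (cube `|x| y * `|x| `^ (- n%:R))%:E * g (2 * (dot y y + x ^+ 2))%R) ->
  \int[lebesgue_rV R n.+1]_y \int[leb]_x F x y
    <= (2 * ((2 ^+ n.+1 * ((n.+2)%:R `^ ((n.+1)%:R / 2)))))%:E * \int[leb]_s g s.
Proof.
move=> mg g0 mF F0 HF; set N : R := ((n.+1)%:R / 2)%R.
have N0 : (0 < N)%R by rewrite divr_gt0.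
pose psi (w : 'rV[R]_n.+1 * mR) := (cube (Num.sqrt (w.2 / 2)) w.1 *
  ((0 < w.2)%R%:R * (w.2 / (2 * n.+2%:R)) `^ (- N)))%:E * g w.2.
have mpsi : measurable_fun setT psi.
  rewrite /psi; apply: emeasurable_funM; last by meas.
  apply/measurable_EFinP; apply: measurable_funM; last by meas.
  by apply: measurable_cube; [apply: measurable_sqrtr; meas|meas].
have psi0 w : 0 <= psi w.
  by rewrite mule_ge0 // lee_fin !mulr_ge0 ?cube_ge0 ?powR_ge0.
have step (y : 'rV[R]_n.+1) : \int[leb]_x F x y <= 2%:E * \int[leb]_s psi (y, s).
  have mpy : measurable_fun setT (fun s : mR => psi (y, s)) by meas.
  rewrite -(integral_lebesgue_shift (2 * dot y y)%R mpy (fun s => psi0 _)).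
  apply: integral_normM_le => //.
  - exact: (measurableT_comp mF (pair1_measurable y)).
  - by meas.
  move=> x x0; apply: le_trans (HF x y x0) _; rewrite /psi /= muleA.
  have -> : (2 * dot y y + 2 * x ^+ 2 = 2 * (dot y y + x ^+ 2))%R by ring.
  apply: lee_wpmul2r => //; rewrite -EFinM lee_fin.
  have [->|[-> Hy]] := cubeP `|x|%R y.
    by rewrite mul0r !mulr_ge0 ?cube_ge0 ?powR_ge0.
  have dy := sum_sqr_le_cube Hy; rewrite real_normK ?num_real // in dy.
  have d0 := dot_ge0 y.
  have x2 : (0 < x ^+ 2)%R by rewrite exprn_even_gt0.
  set s := (2 * (dot y y + x ^+ 2))%R.
  have s0 : (0 < s)%R by rewrite mulr_gt0 // ltr_wpDl.
  rewrite cube1; last first.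
    move=> j; apply: le_trans (Hy j) _; rewrite -[leLHS]ger0_norm // -sqrtr_sqr.
    apply: ler_wsqrtr; rewrite /s [(2 * _)%R]mulrC mulfK // real_normK ?num_real //.
    by rewrite lerDr.
  rewrite s0 !mul1r; set t := (s / (2 * n.+2%:R))%R.
  have t0 : (0 < t)%R by rewrite divr_gt0.
  have tx : (t <= x ^+ 2)%R.
    rewrite /t ler_pdivrMr ?mulr_gt0 // /s -[n.+2]addn1 natrD; nra.
  have -> : (`|x| `^ (- n%:R) = `|x| * (x ^+ 2) `^ (- N))%R.
    rewrite -{1}(real_normK (num_real x)) -powR_mulrn // -powRrM.
    have -> : (2%:R * - N = - n%:R - 1 :> R)%R.
      by rewrite /N -[n.+1]addn1 natrD; field.
    by rewrite powRD ?normr_eq0 ?x0 ?implybT // powR_inv1 // mulrCA mulfV ?normr_eq0 // mulr1.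
  by rewrite ler_wpM2l //; apply: ler_powRN => //; exact: ltW.
apply: (@le_trans _ _ (\int[lebesgue_rV R n.+1]_y (2%:E * \int[leb]_s psi (y, s)))).
  apply: ge0_le_integral => //.
  - by move=> y _; exact: integral_ge0.
  - apply: (@measurable_integral_snd _ _ _ _ _ leb (fun w => F w.2 w.1)) => //.
  - by apply: measurable_funeM; exact: measurable_integral_snd.
rewrite ge0_integralZl //; last 2 first.
- exact: measurable_integral_snd.
- by move=> y _; exact: integral_ge0.
rewrite EFinM -muleA; apply: lee_wpmul2l => //.
rewrite (@fubini_tonelli _ _ _ _ _ (lebesgue_rV R n.+1) leb psi mpsi psi0).
rewrite -ge0_integralZl ?lee_fin ?mulr_ge0 ?powR_ge0 ?exprn_ge0 //.
apply: ge0_le_integral => //.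
- by move=> s _; exact: integral_ge0.
- exact: measurable_integral_fst.
- exact: measurable_funeM.
move=> s _; rewrite /psi /=.
rewrite ge0_integralZr //; last 2 first.
- apply/measurable_EFinP; apply: measurable_funM => //; apply: measurable_cube => //.
- by move=> y _; rewrite lee_fin !mulr_ge0 ?cube_ge0 ?powR_ge0.
apply: lee_wpmul2r => //.
under eq_integral do rewrite EFinM.
rewrite ge0_integralZr //; last 3 first.
- by apply/measurable_EFinP; exact: measurable_cube.
- by move=> y _; rewrite lee_fin cube_ge0.
- by rewrite lee_fin mulr_ge0 ?powR_ge0.
rewrite integral_cube ?sqrtr_ge0 // -EFinM lee_fin.
have [s0|s0] := ltP 0%R s; last by rewrite mul0r mulr0 mulr_ge0 ?powR_ge0 ?exprn_ge0.
rewrite mul1r exprMn -mulrA ler_wpM2l ?exprn_ge0 //.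
have s20 : (0 < s / 2)%R by rewrite divr_gt0.
have -> : (Num.sqrt (s / 2) ^+ n.+1 = (s / 2) `^ N)%R.
  by rewrite -powR12_sqrt ?(ltW s20) // -powR_mulrn ?powR_ge0 // -powRrM; congr (_ `^ _)%R; rewrite /N mulrC.
have -> : (s / (2 * n.+2%:R) = (s / 2) * n.+2%:R^-1)%R by rewrite invfM mulrA.
move: (s / 2)%R s20 => u u0.
rewrite powRM ?invr_ge0 ?(ltW u0) // mulrA -powRD; last by apply/implyP => _; rewrite gt_eqF.
by rewrite subrr powRr0 mul1r -powR_inv1 // -powRrM mulN1r opprK.
Qed.

(** A substitute for polar coordinates: the space is divided according to
    which coordinate is the largest. *)
Lemma integral_annulus_le n (g : mR -> \bar R) (f : 'rV[R]_n.+2 -> \bar R) :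
  measurable_fun setT g -> (forall s, 0 <= g s) ->
  measurable_fun setT f -> (forall x, 0 <= f x) ->
  (forall (x : 'rV[R]_n.+2) k, (forall j, `|x ord0 j| <= `|x ord0 k|)%R -> x ord0 k != 0%R ->
     f x <= (`|x ord0 k| `^ (- n%:R))%:E * g (2 * dot x x)%R) ->
  \int[lebesgue_rV R n.+2]_x f x <=
    (n.+2%:R * (2 * ((2 ^+ n.+1 * ((n.+2)%:R `^ ((n.+1)%:R / 2))))))%:E * \int[leb]_s g s.
Proof.
move=> mg g0 mf f0 Hf.
pose w k (x : 'rV[R]_n.+2) : R := cube `|x ord0 k|%R (\row_j x ord0 (lift k j)).
have mw k : measurable_fun setT (w k).
  apply: measurable_cube; first by meas.
  by apply: measurable_fun_rV => j; under eq_fun do rewrite mxE; exact: measurable_coord_rV.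
have w0 k x : (0 <= w k x)%R by exact: cube_ge0.
apply: (@le_trans _ _ (\int[lebesgue_rV R n.+2]_x \sum_(k < n.+2) ((w k x)%:E * f x))).
  apply: ge0_le_integral => //.
  - apply: emeasurable_sum => k; apply: emeasurable_funM => //.
    by apply/measurable_EFinP; exact: mw.
  move=> x _; pose k := [arg max_(k > ord0) `|x ord0 k|%R]%O.
  have kP j : (`|x ord0 j| <= `|x ord0 k|)%R.
    by rewrite /k; case: arg_maxP => // i _; apply.
  have wk : w k x = 1%R by apply: cube1 => j; rewrite mxE.
  rewrite (bigD1 k) //= wk mul1e leeDl // sume_ge0 // => j _.
  by rewrite mule_ge0 // lee_fin.
rewrite ge0_integral_sum //; last 2 first.
- by move=> k; apply: emeasurable_funM => //; apply/measurable_EFinP; exact: mw.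
- by move=> k x _; rewrite mule_ge0 // lee_fin.
set C := (2 * _)%R.
have C0 : (0 <= C)%R by rewrite !mulr_ge0 ?powR_ge0 ?exprn_ge0.
rewrite (_ : (n.+2%:R * C)%:E * _ = \sum_(k < n.+2) (C%:E * \int[leb]_s g s)); last first.
  by rewrite sumr_const card_ord EFinM -muleA mule_natl.
apply: lee_sum => k _.
have mwf : measurable_fun setT (fun x => (w k x)%:E * f x).
  by apply: emeasurable_funM => //; apply/measurable_EFinP; exact: mw.
have wf0 x : 0 <= (w k x)%:E * f x by rewrite mule_ge0 // lee_fin.
rewrite (integral_insert_coord k mwf wf0).
pose F (x : mR) (y : 'rV[R]_n.+1) := (w k (insert_coord k (y, x)))%:E * f (insert_coord k (y, x)).
apply: (@integral_frozen_annulus_le n g F) => //.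
- by rewrite /F; apply: (measurableT_comp mwf); meas.
- by move=> x y; exact: wf0.
move=> x y x0; rewrite /F /w insert_coord_same /=.
have -> : \row_j insert_coord k (y, x) ord0 (lift k j) = y.
  by apply/rowP => j; rewrite mxE insert_coord_lift.
have [->|[-> Hy]] := cubeP `|x|%R y; first by rewrite mul0e mul0r mul0e.
rewrite mul1e mul1r; have := Hf (insert_coord k (y, x)) k.
rewrite insert_coord_same dot_insert_coord /=; apply => // j.
by have [i ->|->] := unliftP k j; rewrite ?insert_coord_lift ?insert_coord_same.
Qed.

End annulus.

(** * Output frequencies comparable to the inputs *)

Section schur_kernel.
Context {R : realType}.
Local Notation mR := (measurableTypeR R).
Local Notation leb := (@lebesgue_measure R).
Local Notation ST n := ('rV[R]_n * mR)%type.
Local Notation mu := (@lebesgue_spacetime R _).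

Definition freq_bracket n (q : ST n) : R := bracket (enorm q.1).
Definition modulation_bracket n (q : ST n) : R := bracket (q.2 - enorm q.1 ^+ 2).

Lemma freq_bracket_ge1 n (q : ST n) : 1 <= freq_bracket q.
Proof. exact: bracket_ge1. Qed.

Lemma freq_bracket_gt0 n (q : ST n) : 0 < freq_bracket q.
Proof. exact: bracket_gt0. Qed.

Lemma modulation_bracket_ge1 n (q : ST n) : 1 <= modulation_bracket q.
Proof. exact: bracket_ge1. Qed.

Lemma modulation_bracket_gt0 n (q : ST n) : 0 < modulation_bracket q.
Proof. exact: bracket_gt0. Qed.

Lemma bracketN (x : R) : bracket (- x) = bracket x.
Proof. by rewrite /bracket sqrrN. Qed.

Lemma coord_le_enorm n (x : 'rV[R]_n) k : `|x ord0 k| <= enorm x.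
Proof.
rewrite -[leLHS]ger0_norm // -sqrtr_sqr; apply: ler_wsqrtr.
rewrite real_normK ?num_real // /dot (bigD1 k) //= -expr2 lerDl.
by apply: sumr_ge0 => i _; rewrite -expr2 sqr_ge0.
Qed.

Lemma coord_le_freq_bracket n (q : ST n) k : `|q.1 ord0 k| <= freq_bracket q.
Proof.
apply: le_trans (coord_le_enorm _ _) _; apply: le_trans (bracket_ge_norm _).
exact: ler_norm.
Qed.

(** The model for an output frequency as large as the inputs, with the spatial
    decay N^(-(d-2)/2) in dimension d = n + 2. *)
Definition elliptic_kernel n (theta : R) (pq : ST n.+2 * ST n.+2) : R :=
  (freq_bracket pq.1 + freq_bracket pq.2) `^ (- (n%:R / 2)) *
  (modulation_bracket pq.1 `^ (- theta) * modulation_bracket pq.2 `^ (- theta)).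

Lemma measurable_elliptic_kernel n theta : measurable_fun setT (@elliptic_kernel n theta).
Proof. by rewrite /elliptic_kernel /freq_bracket /modulation_bracket; meas. Qed.

Lemma elliptic_kernel_ge0 n theta pq : 0 <= @elliptic_kernel n theta pq.
Proof. by rewrite !mulr_ge0 ?powR_ge0. Qed.

Lemma sqr_powR (x p : R) : (x `^ p) ^+ 2 = x `^ (2 * p).
Proof. by rewrite -powR_mulrn ?powR_ge0 // -powRrM mulrC. Qed.

(** For two frequencies of prescribed sum, the sum of their squared lengths
    depends only on the distance of the first to the midpoint.  With the first
    modulation fixed, the second one is thus a function of this distance, and
    the spatial decay makes its integral over annuli uniformly bounded. *)
Lemma trilinear_bounded_elliptic n (theta : R) : 1 / 2 < theta ->
  trilinear_bounded (@elliptic_kernel n theta).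
Proof.
move=> th.
pose K' (pq : ST n.+2 * ST n.+2) := elliptic_kernel theta (pq.1, third pq.1 pq.2).
have mK' : measurable_fun setT K'.
  by apply: (measurableT_comp (@measurable_elliptic_kernel n theta)); meas.
have -> : @elliptic_kernel n theta = (fun pq => K' (pq.1, third pq.1 pq.2)).
  by apply/funext => -[p q]; rewrite /K' /= thirdK.
apply: trilinear_bounded_third => //; first by move=> pq; exact: elliptic_kernel_ge0.
have th2 : 1 < 2 * theta by lra.
have [Cl Cl0 HCl] := integral_bracket_lty th2.
pose lam (t : mR) : R := bracket t `^ (- (2 * theta)).
have lam0 t : 0 <= lam t by exact: powR_ge0.
have mlam : measurable_fun setT lam by rewrite /lam; meas.
set C := (n.+2%:R * (2 * ((2 ^+ n.+1 * ((n.+2)%:R `^ ((n.+1)%:R / 2))))) : R).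
have C0 : 0 <= C by rewrite !mulr_ge0 ?powR_ge0 ?exprn_ge0.
apply: (@trilinear_bounded_schur _ _ _ (Cl * (C * Cl))) => //.
- by move=> pq; exact: elliptic_kernel_ge0.
- by rewrite !mulr_ge0.
move=> q.
pose c (p : ST n.+2) : R := q.2 + (dot p.1 p.1 + dot (- p.1 - q.1) (- p.1 - q.1)).
pose B (x : 'rV[R]_n.+2) : R :=
  (freq_bracket (x, 0 : mR) + freq_bracket (- x - q.1, 0 : mR)) `^ (- n%:R).
have mB : measurable_fun setT B by rewrite /B /freq_bracket /=; meas.
have B0 x : 0 <= B x by exact: powR_ge0.
have KE x t : K' ((x, t), q) ^+ 2 =
    B x * (lam (t - dot x x) * lam (- t - q.2 - dot (- x - q.1) (- x - q.1))).
  rewrite /K' /elliptic_kernel /modulation_bracket /= !exprMn !sqr_powR !sqr_enorm.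
  by rewrite /lam /B !mulrN; congr (_ `^ _ * (_ * _)); field.
have mK2 : measurable_fun setT (fun p => ((K' (p, q)) ^+ 2)%:E) by meas.
have K20 p : (0 <= ((K' (p, q)) ^+ 2)%:E)%E by rewrite lee_fin sqr_ge0.
rewrite (integral_spacetime mK2 K20).
pose G (xM : 'rV[R]_n.+2 * mR) : \bar R :=
  (B xM.1 * (lam xM.2 * lam (xM.2 + q.2 + (dot xM.1 xM.1 + dot (- xM.1 - q.1) (- xM.1 - q.1)))))%:E.
have mG : measurable_fun setT G by rewrite /G; meas.
have G0 w : (0 <= G w)%E by rewrite lee_fin !mulr_ge0.
have lamN t : lam (- t) = lam t by rewrite /lam bracketN.
have KG x M : (B x * (lam ((dot x x + M) - dot x x) *
    lam (- (dot x x + M) - q.2 - dot (- x - q.1) (- x - q.1))))%:E = G (x, M).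
  have -> : dot x x + M - dot x x = M by ring.
  by rewrite /G /= -[lam (- (dot x x + M) - _ - _)]lamN; congr (_ * (_ * lam _))%:E; ring.
have -> : (\int[lebesgue_rV R n.+2]_x \int[leb]_t (K' ((x, t), q) ^+ 2)%:E =
    \int[lebesgue_rV R n.+2]_x \int[leb]_M G (x, M))%E.
  apply: eq_integral => x _.
  have mt : measurable_fun setT (fun t : mR => (K' ((x, t), q) ^+ 2)%:E) by meas.
  rewrite -(integral_lebesgue_shift (dot x x) mt); last by move=> t; rewrite lee_fin sqr_ge0.
  by apply: eq_integral => M _; rewrite KE KG.
rewrite (@fubini_tonelli _ _ _ _ _ (lebesgue_rV R n.+2) leb G mG G0).
pose h : 'rV[R]_n.+2 := 2^-1 *: q.1.
have inner M : (\int[lebesgue_rV R n.+2]_x G (x, M) <= (lam M)%:E * (C * Cl)%:E)%E.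
  pose f (x : 'rV[R]_n.+2) := (B x * lam (M + q.2 + (dot x x + dot (- x - q.1) (- x - q.1))))%:E.
  have mf : measurable_fun setT f by rewrite /f; meas.
  have f0 x : (0 <= f x)%E by rewrite lee_fin !mulr_ge0.
  have -> : (\int[lebesgue_rV R n.+2]_x G (x, M) = (lam M)%:E * \int[lebesgue_rV R n.+2]_x f x)%E.
    transitivity (\int[lebesgue_rV R n.+2]_x ((lam M)%:E * f x))%E.
      by apply: eq_integral => x _; rewrite /G /f /= -EFinM mulrCA.
    apply: ge0_integralZl; [exact: measurableT|exact: mf|by move=> x _; exact: f0|].
    by rewrite lee_fin.
  apply: lee_wpmul2l; first by rewrite lee_fin.
  rewrite -(integral_rV_shift (- h) mf f0).
  pose g (s : mR) := (lam (M + q.2 + 2 * dot h h + s))%:E.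
  have mg : measurable_fun setT g by rewrite /g; meas.
  have g0 s : (0 <= g s)%E by rewrite lee_fin.
  have mfh : measurable_fun setT (fun x => f (- h + x)) by meas.
  apply: le_trans (integral_annulus_le mg g0 mfh (fun x => f0 _) _) _; last first.
    rewrite -/C [X in (_ <= X)%E]EFinM; apply: lee_wpmul2l; first by rewrite lee_fin.
    have mlamE : measurable_fun setT (fun t => (lam t)%:E) by meas.
    have lamE0 t : (0 <= (lam t)%:E)%E by rewrite lee_fin.
    by rewrite /g (integral_lebesgue_shift _ mlamE lamE0).
  move=> x k _ xk; rewrite /f /g -EFinM lee_fin.
  have -> : - (- h + x) - q.1 = - h - x.
    by apply/rowP => i; rewrite !mxE; field.
  have -> : dot (- h + x) (- h + x) + dot (- h - x) (- h - x) = 2 * dot h h + 2 * dot x x.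
    rewrite /dot !mulr_sumr -!big_split /=; apply: eq_bigr => i _; rewrite !mxE; ring.
  rewrite [M + q.2 + (_ + _)]addrA ler_wpM2r // /B.
  have -> : - (- h + x) - q.1 = - h - x.
    by apply/rowP => i; rewrite !mxE; field.
  apply: ler_powRN => //; first by rewrite normr_gt0.
  have e1 := coord_le_freq_bracket (- h + x, 0 : mR) k.
  have e2 := coord_le_freq_bracket (- h - x, 0 : mR) k.
  rewrite /= !mxE in e1 e2.
  have -> : x ord0 k = ((- h ord0 k + x ord0 k) - (- h ord0 k - x ord0 k)) / 2 by field.
  rewrite normrM [`|2^-1|]ger0_norm // ler_pdivrMr //.
  apply: le_trans (ler_normB _ _) _.
  have b1 := freq_bracket_gt0 (- h + x, 0 : mR).
  have b2 := freq_bracket_gt0 (- h - x, 0 : mR).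
  by rewrite !mxE in e1 e2 *; lra.
apply: (@le_trans _ _ (\int[leb]_M ((lam M)%:E * (C * Cl)%:E))%E).
  apply: ge0_le_integral => //.
  - by move=> M _; apply: integral_ge0 => x _; exact: G0.
  - exact: (measurable_integral_fst (lebesgue_rV R n.+2) mG G0).
  - by meas.
rewrite ge0_integralZr //; last 3 first.
- by meas.
- by move=> M _; rewrite lee_fin.
- by rewrite lee_fin mulr_ge0.
by rewrite [X in (_ <= X)%E]EFinM; apply: lee_wpmul2r => //; rewrite lee_fin mulr_ge0.
Qed.

(** One coordinate carries the decay <y>^(-b) with b <= 2 a, which costs
    r^(1-b), and each of the m others costs r.  If 2 a > 1 in dimension one,
    the integral converges. *)
Lemma integral_cube_bracket_le m (a e : R) : 0 <= a ->
  (exists b, [/\ 0 <= b <= 2 * a, b < 1 & m.+1%:R - b <= 1 - 2 * e]) \/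
  [/\ m = 0%N, 1 < 2 * a & 0 <= 1 - 2 * e] ->
  exists2 C : R, 0 <= C & forall r : R, 1 <= r ->
    (\int[lebesgue_rV R m.+1]_y (cube r y * bracket (enorm y) `^ (- (2 * a)))%:E
      <= (C * r `^ (1 - 2 * e))%:E)%E.
Proof.
move=> a0 HV.
have br_y0 (y : 'rV[R]_m.+1) : bracket (y ord0 ord0) <= bracket (enorm y).
  apply: ler_wsqrtr; rewrite lerD2l sqr_enorm /dot (bigD1 ord0) //= -expr2 lerDl.
  by apply: sumr_ge0 => i _; rewrite -expr2 sqr_ge0.
pose f (p r : R) (j : 'I_m.+1) (x : mR) : \bar R :=
  ((`|x| <= r)%R%:R * (if j == ord0 then bracket x `^ (- p) else 1))%:E.
have mf p r j : measurable_fun setT (f p r j).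
  by rewrite /f; case: (j == ord0); meas.
have f0 p r j x : (0 <= f p r j x)%E.
  by rewrite lee_fin mulr_ge0 //; case: ifP => // _; exact: powR_ge0.
have step (p r : R) : 0 <= p <= 2 * a -> 1 <= r ->
    (\int[lebesgue_rV R m.+1]_y (cube r y * bracket (enorm y) `^ (- (2 * a)))%:E <=
     \int[leb]_x ((`|x| <= r)%R%:R * bracket x `^ (- p))%:E * ((2 * r) ^+ m)%:E)%E.
  move=> /andP[p0 p2a] r1.
  have -> : (\int[leb]_x ((`|x| <= r)%R%:R * bracket x `^ (- p))%:E * ((2 * r) ^+ m)%:E =
     \int[lebesgue_rV R m.+1]_y \prod_(j < m.+1) f p r j (y ord0 j))%E.
    rewrite integral_rV_prod // big_ord_recl; congr (_ * _)%E.
    rewrite -(integral_cube m (le_trans ler01 r1)).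
    rewrite -[RHS](@integral_rV_prod _ m (fun j => f p r (lift ord0 j))) //.
    apply: eq_integral => y _; rewrite /cube -prodEFin; apply: eq_bigr => j _.
    by rewrite /f /= mulr1.
  apply: ge0_le_integral => //.
  - by move=> y _; rewrite lee_fin mulr_ge0 ?cube_ge0 ?powR_ge0.
  - by apply/measurable_EFinP; apply: measurable_funM; [exact: measurable_cube|meas].
  - by apply: measurable_rV_prod => j; exact: mf.
  move=> y _; rewrite /f prodEFin lee_fin big_split /=; apply: ler_pM => //.
  - exact: cube_ge0.
  - exact: powR_ge0.
  rewrite (bigD1 ord0) //= big1 ?mulr1; last by move=> j /negbTE ->.
  apply: (@le_trans _ _ (bracket (enorm y) `^ (- p))).
    by apply: ler_powR; [exact: bracket_ge1|rewrite lerN2].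
  by apply: ler_powRN => //; exact: bracket_gt0.
case: HV => [[b [/andP[b0 b2] b1 hb]]|[m0 a1 he]].
  have b01 : 0 <= b < 1 by rewrite b0 b1.
  have [C C0 HC] := integral_bracket_ball_le b01.
  exists (C * 2 ^+ m); first by rewrite mulr_ge0 ?exprn_ge0.
  move=> r r1; have r0 : 0 < r by apply: lt_le_trans r1.
  apply: le_trans (step b r _ r1) _; first by rewrite b0 b2.
  apply: (@le_trans _ _ ((C * r `^ (1 - b))%:E * ((2 * r) ^+ m)%:E)%E).
    by apply: lee_wpmul2r; [rewrite lee_fin exprn_ge0 ?mulr_ge0 ?(ltW r0)|exact: HC].
  rewrite -EFinM lee_fin exprMn mulrACA ler_wpM2l ?mulr_ge0 ?exprn_ge0 //.
  rewrite -powR_mulrn ?(ltW r0) // -powRD; last by rewrite (gt_eqF r0) implybT.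
  by apply: ler_powR => //; move: hb; rewrite -natr1; lra.
have [C C0 HC] := integral_bracket_lty a1.
exists C => // r r1; have r0 : 0 < r by apply: lt_le_trans r1.
have aa : 0 <= 2 * a <= 2 * a by rewrite lexx mulr_ge0.
apply: le_trans (step (2 * a) r aa r1) _.
rewrite m0 expr0 mule1.
apply: (@le_trans _ _ C%:E).
  apply: le_trans HC; apply: ge0_le_integral => //.
  - by move=> x _; rewrite lee_fin mulr_ge0 ?powR_ge0.
  - by meas.
  - by meas.
  by move=> x _; rewrite lee_fin ler_piMl ?powR_ge0 // lern1 leq_b1.
rewrite lee_fin ler_peMr // -[leLHS](powRr0 r); exact: ler_powR.
Qed.

End schur_kernel.

(** * Low output frequencies *)

Section transverse.
Context {R : realType}.
Local Notation mR := (measurableTypeR R).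
Local Notation leb := (@lebesgue_measure R).
Local Notation ST n := ('rV[R]_n * mR)%type.
Local Notation mu := (@lebesgue_spacetime R _).

(** The model for a low output frequency, where coordinate k separates p from q.
    The low frequency is third p q for c = 1 and p for c = 0. *)
Definition transverse_kernel n (k : 'I_n) (c a e theta : R) (pq : ST n * ST n) : R :=
  ((freq_bracket pq.2 / 8 <= `|pq.1.1 ord0 k - pq.2.1 ord0 k|) &&
   (bracket (enorm (pq.1.1 + c *: pq.2.1)) <= freq_bracket pq.2))%R%:R *
  (freq_bracket pq.2 `^ e * bracket (enorm (pq.1.1 + c *: pq.2.1)) `^ (- a)) *
  (modulation_bracket pq.1 `^ (- theta) * modulation_bracket pq.2 `^ (- theta)).

Lemma measurable_transverse_kernel n k c a e theta :
  measurable_fun setT (@transverse_kernel n k c a e theta).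
Proof.
by rewrite /transverse_kernel /freq_bracket /modulation_bracket; meas.
Qed.

Lemma transverse_kernel_ge0 n k c a e theta pq : 0 <= @transverse_kernel n k c a e theta pq.
Proof. by rewrite !mulr_ge0 ?powR_ge0. Qed.

Lemma modulation_bracket_chart n (k : 'I_n.+1) (z : ST n) (x : mR) :
  modulation_bracket (paraboloid_chart k (z, x)) = bracket z.2.
Proof. by rewrite /modulation_bracket /paraboloid_chart /= sqr_enorm addrK. Qed.

Lemma sqr_transverse_weight_le (r low y l1 l2 d a e theta : R) :
  1 <= r -> 0 < y -> y <= low -> r / 8 <= d -> 0 <= a ->
  (r `^ e * low `^ (- a) * (l1 `^ (- theta) * l2 `^ (- theta))) ^+ 2 <=
  8 * r `^ (2 * e - 1) * y `^ (- (2 * a)) *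
    (l1 `^ (- (2 * theta)) * l2 `^ (- (2 * theta))) * d.
Proof.
move=> r1 y0 ylow rd a0; have r0 : 0 < r by apply: lt_le_trans r1.
rewrite !exprMn !sqr_powR !mulrN [leRHS]mulrAC.
apply: ler_wpM2r; first by rewrite mulr_ge0 ?powR_ge0.
rewrite [leRHS]mulrAC; apply: ler_pM; try exact: powR_ge0.
  have -> : r `^ (2 * e) = r `^ (2 * e - 1) * r.
    by rewrite -{3}[r]powRr1 ?(ltW r0) // -powRD ?subrK // (gt_eqF r0) implybT.
  by rewrite -mulrA mulrCA ler_wpM2l ?powR_ge0 //; lra.
by apply: ler_powRN => //; rewrite mulr_ge0.
Qed.

(** Separation in coordinate k supplies the factor |p_k - q_k| >= <q> / 8 asked
    for by the freezing lemma, and the low frequency confines the other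
    coordinates of p to a cube of side <q>. *)
Lemma trilinear_bounded_transverse m k (c a e theta : R) : 1 / 2 < theta -> 0 <= a ->
  (exists b, [/\ 0 <= b <= 2 * a, b < 1 & m.+1%:R - b <= 1 - 2 * e]) \/
  [/\ m = 0%N, 1 < 2 * a & 0 <= 1 - 2 * e] ->
  trilinear_bounded (@transverse_kernel m.+2 k c a e theta).
Proof.
move=> th a0 HV.
have th2 : 1 < 2 * theta by lra.
have [Cl Cl0 HCl] := integral_bracket_lty th2.
have [C C0 HC] := integral_cube_bracket_le a0 HV.
pose lam (t : mR) : R := bracket t `^ (- (2 * theta)).
pose rem (x : 'rV[R]_m.+2) : 'rV[R]_m.+1 := \row_j x ord0 (lift k j).
pose ker (r : R) (v : 'rV[R]_m.+1) : R := cube r v * bracket (enorm v) `^ (- (2 * a)).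
pose kap (w : 'rV[R]_m.+2 * 'rV[R]_m.+1) : R :=
  (8 * bracket (enorm w.1) `^ (2 * e - 1)) *
    ker (bracket (enorm w.1)) (c *: rem w.1 + w.2).
have mker d (T : measurableType d) (f : T -> R) (g : T -> 'rV[R]_m.+1) :
    measurable_fun setT f -> measurable_fun setT g ->
    measurable_fun setT (fun t => ker (f t) (g t)).
  by move=> mf mg; apply: measurable_funM; [exact: measurable_cube|meas].
have ker0 r v : 0 <= ker r v by rewrite mulr_ge0 ?cube_ge0 ?powR_ge0.
have kap0 w : 0 <= kap w.
  by apply: mulr_ge0; [rewrite mulr_ge0 ?powR_ge0|exact: ker0].
apply: (@trilinear_bounded_freeze _ _ k _ lam kap Cl (8 * C)) => //.
- exact: measurable_transverse_kernel.
- by rewrite /lam; meas.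
- apply: measurable_funM; first by meas.
  apply: mker; first by meas.
  apply: measurable_rV_add; last by meas.
  apply: measurable_rV_scale; apply: measurable_fun_rV => j.
  by under eq_fun do rewrite mxE; apply: measurable_fun_coord; meas.
- by move=> pq; exact: transverse_kernel_ge0.
- by move=> t; exact: powR_ge0.
- by rewrite mulr_ge0.
- move=> xi; set r := bracket (enorm xi).
  have r1 : 1 <= r by exact: bracket_ge1.
  have r0 : 0 < r by apply: lt_le_trans r1.
  have c0 : 0 <= 8 * r `^ (2 * e - 1) by rewrite mulr_ge0 ?powR_ge0.
  have mk : measurable_fun setT (fun y : 'rV[R]_m.+1 => (ker r y)%:E).
    by apply/measurable_EFinP; exact: mker.
  have k0 y : (0 <= (ker r y)%:E)%E by rewrite lee_fin; exact: ker0.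
  have mks : measurable_fun setT (fun y : 'rV[R]_m.+1 => (ker r (c *: rem xi + y))%:E).
    by apply: (measurableT_comp mk (measurable_rV_shift _)).
  have -> : (\int[lebesgue_rV R m.+1]_y (kap (xi, y))%:E =
     (8 * r `^ (2 * e - 1))%:E * \int[lebesgue_rV R m.+1]_y (ker r (c *: rem xi + y))%:E)%E.
    transitivity (\int[lebesgue_rV R m.+1]_y
        ((8 * r `^ (2 * e - 1))%:E * (ker r (c *: rem xi + y))%:E))%E.
      by apply: eq_integral => y _; rewrite -EFinM.
    apply: ge0_integralZl; [exact: measurableT|exact: mks| |].
      by move=> y _; exact: k0.
    by rewrite lee_fin.
  rewrite (integral_rV_shift (c *: rem xi) mk k0).
  apply: (@le_trans _ _ ((8 * r `^ (2 * e - 1))%:E * (C * r `^ (1 - 2 * e))%:E)%E).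
    by apply: lee_wpmul2l; [rewrite lee_fin|exact: HC].
  rewrite -EFinM lee_fin mulrACA -powRD; last by rewrite (gt_eqF r0) implybT.
  have -> : 2 * e - 1 + (1 - 2 * e) = 0 by ring.
  by rewrite powRr0 mulr1.
move=> z1 z2 x1 x2; rewrite /transverse_kernel !modulation_bracket_chart.
rewrite /freq_bracket /paraboloid_chart /= !insert_coord_same.
set xi1 := insert_coord k (z1.1, x1); set xi2 := insert_coord k (z2.1, x2).
set r := bracket (enorm xi2); set low := bracket (enorm (xi1 + c *: xi2)).
have r1 : 1 <= r by exact: bracket_ge1.
have r0 : 0 < r by apply: lt_le_trans r1.
case: andP => [[h1 h2]|_]; last first.
  rewrite !mul0r expr0n /=; apply: (mulr_ge0 _ (normr_ge0 _)).
  by apply: (mulr_ge0 (kap0 _)); apply: mulr_ge0; exact: powR_ge0.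
set v := c *: rem xi2 + z1.1.
have vE j : v ord0 j = (xi1 + c *: xi2) ord0 (lift k j).
  by rewrite /v !mxE !liftK addrC.
have vlow : bracket (enorm v) <= low.
  apply: ler_wsqrtr; rewrite lerD2l !sqr_enorm.
  rewrite [leRHS]/dot (bigD1_ord k) //= -[leLHS]add0r; apply: lerD.
    by rewrite -expr2 sqr_ge0.
  by apply: ler_sum => j _; rewrite !vE.
have cv : cube r v = 1.
  apply: cube1 => j; rewrite vE; apply: le_trans h2.
  apply: le_trans (coord_le_enorm _ _) _; apply: le_trans (bracket_ge_norm _).
  exact: ler_norm.
have kapE : kap (xi2, z1.1) = 8 * r `^ (2 * e - 1) * bracket (enorm v) `^ (- (2 * a)).
  by rewrite /kap /ker /= -/r -/v cv mul1r.
rewrite kapE mul1r.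
by apply: sqr_transverse_weight_le => //; exact: bracket_gt0.
Qed.

End transverse.

(** * Reduction of the weight to the model kernels *)

Section weight.
Context {R : realType}.
Local Notation mR := (measurableTypeR R).
Local Notation ST n := ('rV[R]_n * mR)%type.
Implicit Types a e theta : R.

Lemma powR_comparable (x y e : R) : 0 < x -> 0 < y -> x <= 2 * y -> y <= 2 * x ->
  x `^ e <= 2 `^ `|e| * y `^ e.
Proof.
move=> x0 y0 xy yx; have [e0|e0] := leP 0 e.
  by rewrite ger0_norm // -powRM ?(ltW y0) // ge0_ler_powR // ?nnegrE ?(ltW x0) // mulr_ge0 ?(ltW y0).
rewrite ltr0_norm //; set f := - e; have f0 : 0 <= f by rewrite oppr_ge0 ltW.
have -> : e = - f by rewrite opprK.
have -> : 2 `^ f = 2^-1 `^ (- f) :> R.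
  by rewrite -[2^-1]powR_inv1 // -powRrM mulrN mulN1r opprK.
rewrite -powRM ?invr_ge0 ?(ltW y0) //; apply: ler_powRN => //; lra.
Qed.

(** The modulations add up to - (|xi_1|^2 + |xi_2|^2 + |xi_3|^2), and L is at
    least 1 and at least the modulation. *)
Lemma sum_sqr_modulation_le n (p q : ST n) :
  (freq_bracket p + freq_bracket q + freq_bracket (third p q)) ^+ 2 / 6 <=
  modulation_bracket p + modulation_bracket q + modulation_bracket (third p q).
Proof.
have P1 := modulation_bracket_ge1 p; have P2 := modulation_bracket_ge1 q.
have P3 := modulation_bracket_ge1 (third p q).
have M1 := le_trans (ler_norm _) (bracket_ge_norm (- (p.2 - enorm p.1 ^+ 2))).
have M2 := le_trans (ler_norm _) (bracket_ge_norm (- (q.2 - enorm q.1 ^+ 2))).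
have M3 := le_trans (ler_norm _)
  (bracket_ge_norm (- ((third p q).2 - enorm (third p q).1 ^+ 2))).
rewrite !bracketN in M1 M2 M3.
rewrite -/(modulation_bracket _) in M1; rewrite -/(modulation_bracket _) in M2.
rewrite -/(modulation_bracket _) in M3.
have B1 := sqr_bracket (enorm p.1); have B2 := sqr_bracket (enorm q.1).
have B3 := sqr_bracket (enorm (third p q).1).
rewrite -/(freq_bracket _) in B1; rewrite -/(freq_bracket _) in B2.
rewrite -/(freq_bracket _) in B3.
have T : (third p q).2 = - p.2 - q.2 by [].
move: M1 M2 M3; rewrite T => M1 M2 M3; move: B1 B2 B3 M1 M2 M3 P1 P2 P3.
move: (freq_bracket _) (freq_bracket _) (freq_bracket _) => b1 b2 b3.
move: (modulation_bracket _) (modulation_bracket _) (modulation_bracket _) => l1 l2 l3.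
move: (enorm _ ^+ 2) (enorm _ ^+ 2) (enorm _ ^+ 2) => d1 d2 d3 *.
have := sqr_ge0 (b1 - b2); have := sqr_ge0 (b2 - b3); have := sqr_ge0 (b1 - b3).
rewrite !sqrrB !sqrrD; nra.
Qed.

(** The largest modulation pays for the exponent theta - 1.  If it is not the
    third one, l1 say, then l1^-theta l3^(2 theta - 1) <= x^(theta - 1) because
    2 theta - 1 > 0 and l3 < x <= l1. *)
Lemma modulation_weight_le (l1 l2 l3 x theta : R) : 1 / 2 < theta -> theta <= 1 ->
  1 <= l1 -> 1 <= l2 -> 1 <= l3 -> 0 < x -> [\/ x <= l1, x <= l2 | x <= l3] ->
  l1 `^ (- theta) * l2 `^ (- theta) * l3 `^ (theta - 1) <=
  x `^ (theta - 1) * (l1 `^ (- theta) * l2 `^ (- theta)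
    + l3 `^ (- theta) * l1 `^ (- theta) + l3 `^ (- theta) * l2 `^ (- theta)).
Proof.
move=> th1 th2 l11 l21 l31 x0 H.
have l30 : 0 < l3 by apply: lt_le_trans l31.
have thE : theta - 1 = - (1 - theta) by rewrite opprB.
have [xl3|l3x] := leP x l3.
  apply: (@le_trans _ _ (x `^ (theta - 1) * (l1 `^ (- theta) * l2 `^ (- theta)))).
    rewrite mulrC; apply: ler_wpM2r; first by rewrite mulr_ge0 ?powR_ge0.
    by rewrite thE; apply: ler_powRN => //; lra.
  rewrite ler_wpM2l ?powR_ge0 // -addrA lerDl.
  by rewrite addr_ge0 // mulr_ge0 ?powR_ge0.
have key l : x <= l -> l `^ (- theta) * l3 `^ (theta - 1) <= x `^ (theta - 1) * l3 `^ (- theta).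
  move=> xl; have -> : theta - 1 = - theta + (2 * theta - 1) by ring.
  have nz y : 0 < y -> y `^ (- theta + (2 * theta - 1)) = y `^ (- theta) * y `^ (2 * theta - 1).
    by move=> y0; rewrite powRD // (gt_eqF y0) implybT.
  rewrite !nz // [leRHS]mulrAC mulrA; apply: ler_pM; rewrite ?mulr_ge0 ?powR_ge0 //.
    by rewrite ler_wpM2r ?powR_ge0 //; apply: ler_powRN => //; lra.
  by rewrite ge0_ler_powR ?nnegrE ?ltW //; lra.
have lt0 := powR_ge0 l1 (- theta); have lt1 := powR_ge0 l2 (- theta).
have lt2 := powR_ge0 l3 (- theta); have lt3 := powR_ge0 x (theta - 1).
have := mulr_ge0 lt3 (mulr_ge0 lt0 lt1); have := mulr_ge0 lt3 (mulr_ge0 lt2 lt0).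
have := mulr_ge0 lt3 (mulr_ge0 lt2 lt1).
by case: H => [/key/(ler_wpM2l lt1)|/key/(ler_wpM2l lt0)|]; last rewrite leNgt l3x //; lra.
Qed.

Lemma comparable_weight_le (b1 b2 b3 a theta h : R) : 0 <= a ->
  1 <= b1 -> 1 <= b2 -> 1 <= b3 -> b1 <= 22 * b3 -> b2 <= 20 * b3 ->
  a + 2 * theta - 2 <= - h ->
  b1 `^ a * b2 `^ a * b3 `^ (- a) * (b1 + b2 + b3) `^ (2 * theta - 2) <=
  43 `^ a * (b1 + b2 + b3) `^ (- h).
Proof.
move=> a0 b11 b21 b31 h1 h2 hh; set N := b1 + b2 + b3.
have N1 : 1 <= N by rewrite /N; lra.
have N0 : 0 < N by apply: lt_le_trans N1.
have nz u v : N `^ (u + v) = N `^ u * N `^ v by rewrite powRD // (gt_eqF N0) implybT.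
have e1 : b1 `^ a <= N `^ a by rewrite ge0_ler_powR ?nnegrE //; rewrite /N; lra.
have e2 : b2 `^ a <= N `^ a by rewrite ge0_ler_powR ?nnegrE //; rewrite /N; lra.
(* N <= (22 + 20 + 1) b3 *)
have e3 : b3 `^ (- a) <= 43 `^ a * N `^ (- a).
  have -> : 43 `^ a = 43^-1 `^ (- a) :> R.
    by rewrite -[43^-1]powR_inv1 // -powRrM mulrN mulN1r opprK.
  rewrite -powRM ?invr_ge0 ?(ltW N0) //; apply: ler_powRN => //; first by rewrite mulr_gt0.
  by rewrite /N; lra.
apply: (@le_trans _ _ (N `^ a * N `^ a * (43 `^ a * N `^ (- a)) * N `^ (2 * theta - 2))).
  rewrite ler_wpM2r ?powR_ge0 //; apply: ler_pM; rewrite ?mulr_ge0 ?powR_ge0 //.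
  by apply: ler_pM; rewrite ?powR_ge0.
have -> : N `^ a * N `^ a * (43 `^ a * N `^ (- a)) * N `^ (2 * theta - 2) =
    43 `^ a * N `^ (a + 2 * theta - 2).
  have -> : a + 2 * theta - 2 = a + a + - a + (2 * theta - 2) by ring.
  by rewrite !nz; ring.
by rewrite ler_wpM2l ?powR_ge0 //; exact: ler_powR.
Qed.

Lemma low_output_weight_le (b1 b2 b3 a theta : R) : 0 <= a -> theta <= 1 ->
  1 <= b1 -> 1 <= b2 -> 1 <= b3 -> b1 <= 2 * b2 ->
  b1 `^ a * b2 `^ a * b3 `^ (- a) * (b1 + b2 + b3) `^ (2 * theta - 2) <=
  2 `^ a * (b2 `^ (2 * a + 2 * theta - 2) * b3 `^ (- a)).
Proof.
move=> a0 th b11 b21 b31 h1.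
have b20 : 0 < b2 by lra.
have nz u v : b2 `^ (u + v) = b2 `^ u * b2 `^ v by rewrite powRD // (gt_eqF b20) implybT.
have e1 : b1 `^ a <= 2 `^ a * b2 `^ a.
  by rewrite -powRM ?(ltW b20) // ge0_ler_powR ?nnegrE //; lra.
have e2 : (b1 + b2 + b3) `^ (2 * theta - 2) <= b2 `^ (2 * theta - 2).
  have -> : 2 * theta - 2 = - (2 - 2 * theta) by ring.
  by apply: ler_powRN; lra.
apply: (@le_trans _ _ (2 `^ a * b2 `^ a * b2 `^ a * b3 `^ (- a) * b2 `^ (2 * theta - 2))).
  apply: ler_pM; rewrite ?mulr_ge0 ?powR_ge0 //.
  by rewrite ler_wpM2r ?powR_ge0 // ler_wpM2r ?powR_ge0.
have -> : 2 * a + 2 * theta - 2 = a + a + (2 * theta - 2) by ring.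
by rewrite !nz le_eqVlt; apply/orP; left; apply/eqP; ring.
Qed.

Lemma parallelogram n (x y : 'rV[R]_n) :
  dot (x - y) (x - y) + dot (x + y) (x + y) = 2 * dot x x + 2 * dot y y.
Proof.
by rewrite /dot !mulr_sumr -!big_split /=; apply: eq_bigr => i _; rewrite !mxE; ring.
Qed.

Lemma dotNN n (x : 'rV[R]_n) : dot (- x) (- x) = dot x x.
Proof. by rewrite /dot; apply: eq_bigr => i _; rewrite !mxE mulrNN. Qed.

Lemma dot_add_young n (x y : 'rV[R]_n) :
  dot (x + y) (x + y) <= 9 / 8 * dot x x + 9 * dot y y.
Proof.
rewrite /dot !mulr_sumr -big_split /=; apply: ler_sum => i _; rewrite !mxE.
by have := sqr_ge0 (x ord0 i - 8 * y ord0 i); rewrite sqrrB; nra.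
Qed.

(** Pigeonhole on the coordinates. *)
Lemma exists_large_coord n (x : 'rV[R]_n.+1) (c : R) : 0 <= c ->
  n.+1%:R * c ^+ 2 <= dot x x -> exists k, c <= `|x ord0 k|.
Proof.
move=> c0 H; apply: contrapT => /forallNP N; move: H; apply/negP; rewrite -ltNge.
rewrite /dot mulr_natl -[X in _ *+ X]card_ord -sumr_const.
apply: ltr_sum; first by apply/hasP; exists ord0; rewrite ?mem_index_enum.
move=> i _; rewrite -expr2 -real_normK ?num_real // ltr_pXn2r ?nnegrE //.
by rewrite ltNge; apply/negP/N.
Qed.

Lemma weight_le_sum (b1 b2 b3 l1 l2 l3 a theta : R) : 1 / 2 < theta -> theta <= 1 ->
  1 <= b1 -> 1 <= b2 -> 1 <= b3 -> 1 <= l1 -> 1 <= l2 -> 1 <= l3 ->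
  (b1 + b2 + b3) ^+ 2 / 6 <= l1 + l2 + l3 ->
  b1 `^ a * b2 `^ a * b3 `^ (- a) * (l1 `^ (- theta) * l2 `^ (- theta) * l3 `^ (theta - 1)) <=
  18 * (b1 `^ a * b2 `^ a * b3 `^ (- a) * (b1 + b2 + b3) `^ (2 * theta - 2) *
    (l1 `^ (- theta) * l2 `^ (- theta)
    + l3 `^ (- theta) * l1 `^ (- theta) + l3 `^ (- theta) * l2 `^ (- theta))).
Proof.
move=> th1 th2 b11 b21 b31 l11 l21 l31.
have : 0 < b1 + b2 + b3 by lra.
have : 0 <= b1 `^ a * b2 `^ a * b3 `^ (- a) by rewrite !mulr_ge0 ?powR_ge0.
move: (b1 `^ a * b2 `^ a * b3 `^ (- a)) (b1 + b2 + b3) => f N f0 N0 sm.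
(* the largest of three numbers is at least a third of their sum *)
have x0 : 0 < N ^+ 2 / 18 by rewrite divr_gt0 // exprn_gt0.
have Hmax : [\/ N ^+ 2 / 18 <= l1, N ^+ 2 / 18 <= l2 | N ^+ 2 / 18 <= l3].
  have [?|h1] := leP (N ^+ 2 / 18) l1; first by constructor 1.
  have [?|h2] := leP (N ^+ 2 / 18) l2; first by constructor 2.
  by constructor 3; lra.
have := modulation_weight_le th1 th2 l11 l21 l31 x0 Hmax.
have xN : (N ^+ 2 / 18) `^ (theta - 1) <= 18 * N `^ (2 * theta - 2).
  rewrite powRM ?sqr_ge0 ?invr_ge0 // mulrC; apply: ler_pM; rewrite ?powR_ge0 //.
    rewrite -[18^-1]powR_inv1 // -powRrM.
    by rewrite -[leRHS]powRr1 //; apply: ler_powR; lra.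
  rewrite -powR_mulrn ?(ltW N0) // -powRrM.
  by have -> : 2%:R * (theta - 1) = 2 * theta - 2 by ring.
set S := _ + _ + _; have S0 : 0 <= S by rewrite !addr_ge0 // mulr_ge0 ?powR_ge0.
move=> mw; apply: le_trans (ler_wpM2l f0 mw) _.
have -> : 18 * (f * N `^ (2 * theta - 2) * S) = f * (18 * N `^ (2 * theta - 2) * S) by ring.
by rewrite ler_wpM2l // ler_wpM2r.
Qed.

(** Either the output b3 is comparable to the inputs, or the inputs have almost
    equal lengths.  In the second case the squared differences of the three
    frequencies, given by the parallelogram identity on the right-hand sides,
    are at least a quarter of the square of an input bracket. *)
Lemma frequency_dichotomy (b1 b2 b3 d1 d2 d3 : R) : 1 <= b1 -> 1 <= b2 -> 1 <= b3 ->
  b1 ^+ 2 = 1 + d1 -> b2 ^+ 2 = 1 + d2 -> b3 ^+ 2 = 1 + d3 ->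
  d1 <= 9 / 8 * d2 + 9 * d3 -> d2 <= 9 / 8 * d1 + 9 * d3 ->
  b1 <= 22 * b3 /\ b2 <= 20 * b3 \/
  [/\ [/\ b1 <= 2 * b2, b2 <= 2 * b1, b3 <= b1 & b3 <= b2],
    b2 ^+ 2 / 4 <= 2 * d1 + 2 * d2 - d3, b1 ^+ 2 / 4 <= 2 * d3 + 2 * d1 - d2
    & b2 ^+ 2 / 4 <= 2 * d3 + 2 * d2 - d1].
Proof.
move=> b11 b21 b31 s1 s2 s3 y1 y2.
(* 22^2 > (9/8) 20^2 + 9 covers b1 when b2 <= 20 b3 *)
have [hb|hb] := leP b2 (20 * b3).
  left; split => //; apply: ler_sqr_pos; first by lra.
  have : b2 ^+ 2 <= (20 * b3) ^+ 2 by rewrite ler_pXn2r ?nnegrE //; lra.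
  have : 1 <= b3 ^+ 2 by rewrite exprn_ege1.
  by rewrite !exprMn; lra.
right.
have q3 : (20 * b3) ^+ 2 <= b2 ^+ 2 by rewrite ler_pXn2r ?nnegrE //; lra.
have : 1 <= b3 ^+ 2 by rewrite exprn_ege1.
rewrite exprMn in q3 => q31.
split; first split; [apply: ler_sqr_pos; rewrite ?exprMn; lra..| | | ]; lra.
Qed.

Lemma pair_sums_le (x y z : R) : 1 <= x -> 1 <= y -> 1 <= z ->
  [/\ x + y <= x + y + z, z + x <= x + y + z & z + y <= x + y + z].
Proof. by split; lra. Qed.

(** The multiplier of the estimate once <xi>^s L^theta |u^|, <xi>^s L^theta |v^|
    and the dual function are taken in L^2; here a = -s. *)
Definition bilinear_weight n a theta (pq : ST n * ST n) : R :=
  freq_bracket pq.1 `^ a * freq_bracket pq.2 `^ a * freq_bracket (third pq.1 pq.2) `^ (- a) *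
  (modulation_bracket pq.1 `^ (- theta) * modulation_bracket pq.2 `^ (- theta) *
   modulation_bracket (third pq.1 pq.2) `^ (theta - 1)).

Definition model_kernel n (c a e theta : R) (pq : ST n.+2 * ST n.+2) : R :=
  elliptic_kernel theta pq + \sum_(k < n.+2) transverse_kernel k c a e theta pq.
Arguments model_kernel : clear implicits.

Lemma model_kernel_ge0 n c a e theta pq : 0 <= model_kernel n c a e theta pq.
Proof.
apply: addr_ge0; first exact: elliptic_kernel_ge0.
by apply: sumr_ge0 => k _; exact: transverse_kernel_ge0.
Qed.

Lemma elliptic_le_model n c a e theta (p q : ST n.+2) (N : R) :
  freq_bracket p + freq_bracket q <= N ->
  N `^ (- (n%:R / 2)) * (modulation_bracket p `^ (- theta) * modulation_bracket q `^ (- theta))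
    <= model_kernel n c a e theta (p, q).
Proof.
move=> H; rewrite /model_kernel; apply: ler_wpDr.
  by apply: sumr_ge0 => k _; exact: transverse_kernel_ge0.
rewrite ler_wpM2r ?mulr_ge0 ?powR_ge0 //; apply: ler_powRN => //.
by rewrite addr_gt0 // freq_bracket_gt0.
Qed.

Lemma transverse_le_model n c a e theta (p q : ST n.+2) : (n <= 14)%N ->
  freq_bracket q ^+ 2 / 4 <= dot (p.1 - q.1) (p.1 - q.1) ->
  bracket (enorm (p.1 + c *: q.1)) <= freq_bracket q ->
  freq_bracket q `^ e * bracket (enorm (p.1 + c *: q.1)) `^ (- a) *
    (modulation_bracket p `^ (- theta) * modulation_bracket q `^ (- theta))
    <= model_kernel n c a e theta (p, q).
Proof.
move=> n14 sep low.
have b0 : 0 <= freq_bracket q / 8 by rewrite divr_ge0 // ltW // freq_bracket_gt0.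
have [|k] := @exists_large_coord _ (p.1 - q.1) _ b0.
  (* 16 (b / 8)^2 = b^2 / 4 *)
  have n16 : (n.+2%:R <= 16 :> R) by rewrite ler_nat.
  apply: le_trans sep; rewrite expr_div_n.
  by have := sqr_ge0 (freq_bracket q); nra.
rewrite !mxE => hk; rewrite /model_kernel; apply: ler_wpDl; first exact: elliptic_kernel_ge0.
rewrite (bigD1 k) //=; apply: ler_wpDr.
  by apply: sumr_ge0 => j _; exact: transverse_kernel_ge0.
by rewrite /transverse_kernel /= hk low mul1r.
Qed.

Lemma sqr_freq_bracket n (p : ST n) : freq_bracket p ^+ 2 = 1 + dot p.1 p.1.
Proof. by rewrite sqr_bracket sqr_enorm. Qed.

Lemma freq_bracketE n (p : ST n) : bracket (enorm p.1) = freq_bracket p.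
Proof. by []. Qed.

Lemma freq_bracket_third n (p q : ST n) :
  bracket (enorm (p.1 + 1 *: q.1)) = freq_bracket (third p q).
Proof.
rewrite /freq_bracket scale1r /= /enorm -[in LHS]dotNN.
by congr (bracket (Num.sqrt (dot _ _))); apply/rowP => i; rewrite !mxE; ring.
Qed.

Local Opaque freq_bracket modulation_bracket powR.

(** With w = third p q, the two modulations that remain once the largest one is
    used up belong to (p, q), (w, p) or (w, q); each pair has its own model
    kernel, the low frequency w coming first in the last two. *)
Lemma bilinear_weight_le_model n a theta : (n <= 14)%N -> 0 <= a ->
  1 / 2 < theta -> theta <= 1 -> a + 2 * theta - 2 <= - (n%:R / 2) ->
  exists2 C : R, 0 <= C & forall p q : ST n.+2,
  bilinear_weight a theta (p, q) <= C *
    (model_kernel n 1 a (2 * a + 2 * theta - 2) theta (p, q)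
     + model_kernel n 0 a (2 * a + 2 * theta - 2) theta (third p q, p)
     + model_kernel n 0 a (2 * a + 2 * theta - 2) theta (third p q, q)).
Proof.
move=> n14 a0 th1 th2 hh; set e := 2 * a + 2 * theta - 2.
exists (18 * (43 `^ a + 2 `^ a * 2 `^ `|e|)).
  by rewrite mulr_ge0 // addr_ge0 ?mulr_ge0 ?powR_ge0.
move=> p q; rewrite /bilinear_weight /=; set w := third p q.
have b11 := freq_bracket_ge1 p; have b21 := freq_bracket_ge1 q.
have b31 := freq_bracket_ge1 w.
have l11 := modulation_bracket_ge1 p; have l21 := modulation_bracket_ge1 q.
have l31 := modulation_bracket_ge1 w.
have sm := sum_sqr_modulation_le p q; rewrite -/w in sm.
have [N NE] : {N | N = freq_bracket p + freq_bracket q + freq_bracket w} by exists (freq_bracket p + freq_bracket q + freq_bracket w).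
have [S1 S1E] : {S | S = modulation_bracket p `^ (- theta) * modulation_bracket q `^ (- theta)}.
  by eexists; reflexivity.
have [S2 S2E] : {S | S = modulation_bracket w `^ (- theta) * modulation_bracket p `^ (- theta)}.
  by eexists; reflexivity.
have [S3 S3E] : {S | S = modulation_bracket w `^ (- theta) * modulation_bracket q `^ (- theta)}.
  by eexists; reflexivity.
have S10 : 0 <= S1 by rewrite S1E; exact: mulr_ge0 (powR_ge0 _ _) (powR_ge0 _ _).
have S20 : 0 <= S2 by rewrite S2E; exact: mulr_ge0 (powR_ge0 _ _) (powR_ge0 _ _).
have S30 : 0 <= S3 by rewrite S3E; exact: mulr_ge0 (powR_ge0 _ _) (powR_ge0 _ _).
have [f fE] : {f | f = freq_bracket p `^ a * freq_bracket q `^ a * freq_bracket w `^ (- a)}.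
  by eexists; reflexivity.
have mw : freq_bracket p `^ a * freq_bracket q `^ a * freq_bracket w `^ (- a) *
   (modulation_bracket p `^ (- theta) * modulation_bracket q `^ (- theta) *
     modulation_bracket w `^ (theta - 1)) <= 18 * (f * N `^ (2 * theta - 2) * (S1 + S2 + S3)).
  by rewrite fE S1E S2E S3E NE; exact: weight_le_sum.
apply: le_trans mw _; rewrite -[leRHS]mulrA; apply: ler_wpM2l => //.
have [D10 D20 D30] : [/\ 0 <= model_kernel n 1 a e theta (p, q),
    0 <= model_kernel n 0 a e theta (w, p) & 0 <= model_kernel n 0 a e theta (w, q)].
  by split; exact: model_kernel_ge0.
have T1 := @transverse_le_model n 1 a e theta p q n14.
have T2 := @transverse_le_model n 0 a e theta w p n14.
have T3 := @transverse_le_model n 0 a e theta w q n14.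
have U1 := @elliptic_le_model n 1 a e theta p q N.
have U2 := @elliptic_le_model n 0 a e theta w p N.
have U3 := @elliptic_le_model n 0 a e theta w q N.
rewrite -S1E in T1 U1; rewrite -S2E in T2 U2; rewrite -S3E in T3 U3.
move: D10 D20 D30 T1 T2 T3 U1 U2 U3.
move: (model_kernel n 1 a e theta (p, q)) (model_kernel n 0 a e theta (w, p))
  (model_kernel n 0 a e theta (w, q)) => D1 D2 D3 D10 D20 D30 T1 T2 T3 U1 U2 U3.
suff [c [hc [d1 d2 d3]]] : exists c, 0 <= c <= 43 `^ a + 2 `^ a * 2 `^ `|e| /\
    [/\ f * N `^ (2 * theta - 2) * S1 <= c * D1, f * N `^ (2 * theta - 2) * S2 <= c * D2
      & f * N `^ (2 * theta - 2) * S3 <= c * D3].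
  case/andP: hc => c0 cC; rewrite !mulrDr; apply: (@le_trans _ _ (c * D1 + c * D2 + c * D3)).
    by apply: lerD d3; apply: lerD d1 d2.
  by apply: lerD; [apply: lerD|]; apply: ler_wpM2r.
have sq1 := sqr_freq_bracket p; have sq2 := sqr_freq_bracket q.
have sq3 := sqr_freq_bracket w.
have y1 : dot p.1 p.1 <= 9 / 8 * dot q.1 q.1 + 9 * dot w.1 w.1.
  have := dot_add_young q.1 w.1; have -> : q.1 + w.1 = - p.1.
    by apply/rowP => i; rewrite !mxE; ring.
  by rewrite dotNN.
have y2 : dot q.1 q.1 <= 9 / 8 * dot p.1 p.1 + 9 * dot w.1 w.1.
  have := dot_add_young p.1 w.1; have -> : p.1 + w.1 = - q.1.
    by apply/rowP => i; rewrite !mxE; ring.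
  by rewrite dotNN.
have [[h1 hb]|[[h12 h21 h31 h32] g1 g2 g3]] :=
    frequency_dichotomy b11 b21 b31 sq1 sq2 sq3 y1 y2.
  exists (43 `^ a); split; first by rewrite powR_ge0 lerDl mulr_ge0 ?powR_ge0.
  have W : f * N `^ (2 * theta - 2) <= 43 `^ a * N `^ (- (n%:R / 2)).
    by rewrite fE NE; exact: comparable_weight_le.
  have [N1 N2 N3] : [/\ freq_bracket p + freq_bracket q <= N,
      freq_bracket w + freq_bracket p <= N & freq_bracket w + freq_bracket q <= N].
    by rewrite NE; exact: pair_sums_le.
  split.
  - apply: le_trans (ler_wpM2r S10 W) _; rewrite -mulrA.
    by apply: ler_wpM2l; [exact: powR_ge0|exact: U1].
  - apply: le_trans (ler_wpM2r S20 W) _; rewrite -mulrA.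
    by apply: ler_wpM2l; [exact: powR_ge0|exact: U2].
  - apply: le_trans (ler_wpM2r S30 W) _; rewrite -mulrA.
    by apply: ler_wpM2l; [exact: powR_ge0|exact: U3].
exists (2 `^ a * 2 `^ `|e|); split; first by rewrite mulr_ge0 ?powR_ge0 // lerDr powR_ge0.
have E1 : p.1 + q.1 = - w.1 by apply/rowP => i; rewrite !mxE; ring.
have E2 : w.1 + p.1 = - q.1 by apply/rowP => i; rewrite !mxE; ring.
have E3 : w.1 + q.1 = - p.1 by apply/rowP => i; rewrite !mxE; ring.
have p1 : dot (p.1 - q.1) (p.1 - q.1) = 2 * dot p.1 p.1 + 2 * dot q.1 q.1 - dot w.1 w.1.
  by rewrite -parallelogram E1 dotNN addrK.
have p2 : dot (w.1 - p.1) (w.1 - p.1) = 2 * dot w.1 w.1 + 2 * dot p.1 p.1 - dot q.1 q.1.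
  by rewrite -parallelogram E2 dotNN addrK.
have p3 : dot (w.1 - q.1) (w.1 - q.1) = 2 * dot w.1 w.1 + 2 * dot q.1 q.1 - dot p.1 p.1.
  by rewrite -parallelogram E3 dotNN addrK.
have W : f * N `^ (2 * theta - 2) <=
    2 `^ a * (freq_bracket q `^ e * freq_bracket w `^ (- a)).
  by rewrite fE NE; exact: low_output_weight_le.
have cmp : freq_bracket q `^ e <= 2 `^ `|e| * freq_bracket p `^ e.
  by apply: powR_comparable => //; exact: freq_bracket_gt0.
have e1 : 1 <= 2 `^ `|e| :> R by rewrite -[leLHS](powRr0 2); apply: ler_powR => //; rewrite ler1n.
have f2 := powR_ge0 2 a : 0 <= 2 `^ a.
have e0 := powR_ge0 2 `|e| : 0 <= 2 `^ `|e|.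
have wa := powR_ge0 (freq_bracket w) (- a).
have lowE (x y : 'rV[R]_n.+2) : bracket (enorm (x + 0 *: y)) = bracket (enorm x).
  by rewrite scale0r addr0.
rewrite freq_bracket_third in T1; rewrite lowE freq_bracketE in T2.
rewrite lowE freq_bracketE in T3.
rewrite p1 in T1; rewrite p2 in T2; rewrite p3 in T3.
have {}T1 := T1 g1 h32; have {}T2 := T2 g2 h31; have {}T3 := T3 g3 h32.
move: (freq_bracket q `^ e) (freq_bracket p `^ e) (freq_bracket w `^ (- a)) (2 `^ a) (2 `^ `|e|)
  wa W cmp f2 e0 e1 T1 T2 T3.
move: (f * _) => F y x z u v z0 W cmp u0 v0 v1 T1 T2 T3.
have gain D : 0 <= D -> u * D <= u * v * D by move=> D0; rewrite -mulrA ler_wpM2l // ler_peMl.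
split.
- apply: le_trans (ler_wpM2r S10 W) (le_trans _ (gain _ D10)).
  by rewrite -mulrA ler_wpM2l.
- apply: le_trans (ler_wpM2r S20 W) _; rewrite -mulrA -[leRHS]mulrA ler_wpM2l //.
  apply: (@le_trans _ _ (v * (x * z * S2))); last by rewrite ler_wpM2l.
  by rewrite !mulrA ler_wpM2r // ler_wpM2r.
- apply: le_trans (ler_wpM2r S30 W) (le_trans _ (gain _ D30)).
  by rewrite -mulrA ler_wpM2l.
Qed.

End weight.

(** * Boundedness for admissible exponents *)

Section weight_bounded.
Context {R : realType}.
Local Notation mR := (measurableTypeR R).
Local Notation ST n := ('rV[R]_n * mR)%type.
Implicit Types a e theta : R.

Lemma trilinear_bounded0 n : trilinear_bounded (fun _ : ST n * ST n => 0 : R).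
Proof.
exists 0 => // F1 F2 F3 _ _ _ _ _ _.
rewrite /trilinear (eq_integral (fun=> 0%E)); last by move=> pq _; rewrite mul0e.
by rewrite integral0 mul0e expe2 mul0e.
Qed.

Lemma trilinear_bounded_sum n m (K : 'I_m -> ST n * ST n -> R) :
  (forall k, measurable_fun setT (K k)) -> (forall k pq, 0 <= K k pq) ->
  (forall k, trilinear_bounded (K k)) ->
  trilinear_bounded (fun pq => \sum_(k < m) K k pq).
Proof.
elim: m K => [|m IH] K mK K0 HK.
  under eq_fun do rewrite big_ord0; exact: trilinear_bounded0.
under eq_fun do rewrite big_ord_recr.
apply: trilinear_bounded_add => //.
- by apply: measurable_sum.
- by move=> pq; apply: sumr_ge0.
- exact: IH.
Qed.

Lemma measurable_model_kernel n c a e theta :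
  measurable_fun setT (@model_kernel R n c a e theta).
Proof.
apply: measurable_funD; first exact: measurable_elliptic_kernel.
by apply: measurable_sum => k; exact: measurable_transverse_kernel.
Qed.

Lemma trilinear_bounded_model n c a e theta : 1 / 2 < theta -> 0 <= a ->
  (exists b, [/\ 0 <= b <= 2 * a, b < 1 & n.+1%:R - b <= 1 - 2 * e]) \/
  [/\ n = 0%N, 1 < 2 * a & 0 <= 1 - 2 * e] ->
  trilinear_bounded (@model_kernel R n c a e theta).
Proof.
move=> th a0 HV; apply: trilinear_bounded_add.
- exact: measurable_elliptic_kernel.
- by apply: measurable_sum => k; exact: measurable_transverse_kernel.
- by move=> pq; exact: elliptic_kernel_ge0.
- by move=> pq; apply: sumr_ge0 => k _; exact: transverse_kernel_ge0.
- exact: trilinear_bounded_elliptic.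
apply: trilinear_bounded_sum => k.
- exact: measurable_transverse_kernel.
- by move=> pq; exact: transverse_kernel_ge0.
- exact: trilinear_bounded_transverse.
Qed.

Lemma measurable_bilinear_weight n a theta :
  measurable_fun setT (@bilinear_weight R n a theta).
Proof. by rewrite /bilinear_weight /freq_bracket /modulation_bracket; meas. Qed.

Lemma bilinear_weight_ge0 n a theta pq : 0 <= @bilinear_weight R n a theta pq.
Proof. by rewrite !mulr_ge0 ?powR_ge0. Qed.

Lemma trilinear_bounded_weight n a theta : (n <= 14)%N -> 0 <= a ->
  1 / 2 < theta -> theta <= 1 -> a + 2 * theta - 2 <= - (n%:R / 2) ->
  (exists b, [/\ 0 <= b <= 2 * a, b < 1
     & n.+1%:R - b <= 1 - 2 * (2 * a + 2 * theta - 2)]) \/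
  [/\ n = 0%N, 1 < 2 * a & 0 <= 1 - 2 * (2 * a + 2 * theta - 2)] ->
  trilinear_bounded (@bilinear_weight R n.+2 a theta).
Proof.
move=> n14 a0 th1 th2 hh HV; set e := 2 * a + 2 * theta - 2 in HV.
have [C C0 HC] := bilinear_weight_le_model n14 a0 th1 th2 hh.
pose K c := @model_kernel R n c a e theta.
have mK c : measurable_fun setT (K c) by exact: measurable_model_kernel.
have K0 c pq : 0 <= K c pq by exact: model_kernel_ge0.
have bK c : trilinear_bounded (K c) by exact: trilinear_bounded_model.
have {}HC p q : bilinear_weight a theta (p, q) <=
  C * (K 1 (p, q) + K 0 (third p q, p) + K 0 (third p q, q)) by exact: HC.
move: K mK K0 bK HC => K mK K0 bK HC.
have mKs : measurable_fun setT (fun pq : ST n.+2 * ST n.+2 => K 0 (pq.2, pq.1)).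
  by apply: (measurableT_comp (mK 0)); meas.
have bKs : trilinear_bounded (fun pq : ST n.+2 * ST n.+2 => K 0 (pq.2, pq.1)).
  exact: trilinear_bounded_swap.
have mKt : measurable_fun setT (fun pq : ST n.+2 * ST n.+2 => K 0 (third pq.1 pq.2, pq.1)).
  by apply: (measurableT_comp (mK 0)); meas.
have bKt : trilinear_bounded (fun pq : ST n.+2 * ST n.+2 => K 0 (third pq.1 pq.2, pq.1)).
  exact: (trilinear_bounded_third mKs _ bKs).
have mKu : measurable_fun setT (fun pq : ST n.+2 * ST n.+2 => K 0 (third pq.1 pq.2, pq.2)).
  by apply: (measurableT_comp (mK 0)); meas.
have bKu : trilinear_bounded (fun pq : ST n.+2 * ST n.+2 => K 0 (third pq.1 pq.2, pq.2)).
  have -> : (fun pq => K 0 (third pq.1 pq.2, pq.2)) =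
      (fun pq => K 0 (third pq.2 pq.1, pq.2)).
    by apply/funext => -[p q]; rewrite (thirdC p).
  exact: (trilinear_bounded_swap mKt (fun=> K0 _ _) bKt).
have s0 (f g : ST n.+2 * ST n.+2 -> R) : (forall pq, 0 <= f pq) -> (forall pq, 0 <= g pq) ->
    forall pq, 0 <= f pq + g pq by move=> f0 g0 pq; exact: addr_ge0.
have mS := measurable_funD (measurable_funD (mK 1) mKt) mKu.
have S0 := s0 _ _ (s0 _ _ (K0 1) (fun pq => K0 0 (third pq.1 pq.2, pq.1)))
  (fun pq => K0 0 (third pq.1 pq.2, pq.2)).
apply: (trilinear_bounded_le (@measurable_bilinear_weight n.+2 a theta) mS C0
  (@bilinear_weight_ge0 n.+2 a theta) S0); first by move=> [p q]; exact: HC.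
refine (trilinear_bounded_add (measurable_funD (mK 1) mKt) mKu
  (s0 _ _ (K0 1) (fun pq => K0 0 (third pq.1 pq.2, pq.1)))
  (fun pq => K0 0 (third pq.1 pq.2, pq.2)) _ bKu).
exact: (trilinear_bounded_add (mK 1) mKt (K0 1) (fun pq => K0 0 (third pq.1 pq.2, pq.1))
  (bK 1) bKt).
Qed.

(** In dimension 2 at theta = 3/4 the value a = 1/2 would require b = 1, where
    the integral of <y>^(-b) over a cube grows logarithmically: this is the
    endpoint that admissibility leaves out. *)
Lemma trilinear_bounded_admissible n s theta : admissible n s theta ->
  trilinear_bounded (@bilinear_weight R n (- s) theta).
Proof.
case=> [[-> th tn]|[-> -> s1 s0]|[-> th s1 s0]].
- rewrite ge_max => /andP[s1 s2] s0.
  apply: trilinear_bounded_weight => //; try by rewrite ?mul0r; lra.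
  have [sa|sa] := ltP (- s) (1 / 2).
    by left; exists (- (2 * s)); split; [apply/andP; split|..]; lra.
  have t4 : theta < 3 / 4 by rewrite lt_neqAle tn; lra.
  have [sb|sb] := ltP (1 / 2) (- s); first by right; split => //; lra.
  by left; exists (4 * theta - 2); split; [apply/andP; split|..]; lra.
- apply: trilinear_bounded_weight => //; try by rewrite ?mul0r; lra.
  by left; exists (- (2 * s)); split; [apply/andP; split|..]; lra.
- apply: trilinear_bounded_weight => //; try lra.
  by left; exists (- (2 * s)); split; [apply/andP; split|..]; lra.
Qed.

End weight_bounded.

(** * Integrals of complex functions *)

Section complex_integral.
Local Open Scope complex_scope.
Context {R : realType}.
Local Notation C := R[i].
Local Notation Re := complex.Re.
Local Notation Im := complex.Im.
Local Notation normc := Normc.normc.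

Lemma Re_mulc (x y : C) : Re (x * y) = Re x * Re y - Im x * Im y.
Proof. by case: x y => [a b] [c d]. Qed.

Lemma Im_mulc (x y : C) : Im (x * y) = Re x * Im y + Im x * Re y.
Proof. by case: x y => [a b] [c d]. Qed.

Lemma normc_sqrtE (x : C) : normc x = Num.sqrt (Re x ^+ 2 + Im x ^+ 2).
Proof. by case: x. Qed.

Lemma normc_ge0 (x : C) : 0 <= normc x.
Proof. by rewrite normc_sqrtE sqrtr_ge0. Qed.

Lemma normr_Re_le (x : C) : `|Re x| <= normc x.
Proof. by rewrite normc_sqrtE -sqrtr_sqr ler_wsqrtr // lerDl sqr_ge0. Qed.

Lemma normr_Im_le (x : C) : `|Im x| <= normc x.
Proof. by rewrite normc_sqrtE -sqrtr_sqr ler_wsqrtr // lerDr sqr_ge0. Qed.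

Lemma sqr_modulus (x : C) : normc x ^+ 2 = Re x ^+ 2 + Im x ^+ 2.
Proof. by rewrite normc_sqrtE sqr_sqrtr // addr_ge0 ?sqr_ge0. Qed.

Lemma normc_conjc (x : C) : normc (conjc x) = normc x.
Proof. by case: x => a b; rewrite /normc /= sqrrN. Qed.

Lemma normc_expi (a : R) : normc (expi a) = 1.
Proof. by rewrite /normc /= cos2Dsin2 sqrtr1. Qed.

Lemma normc_real (a : R) : normc (a +i* 0) = `|a|.
Proof. by rewrite normc_sqrtE /= expr0n addr0 sqrtr_sqr. Qed.

Lemma expiD (a b : R) : expi (a + b) = expi a * expi b.
Proof. by apply/eqP; rewrite eq_complex /= cosD sinD eqxx /= addrC. Qed.

Lemma conjc_expi (a : R) : conjc (expi a) = expi (- a).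
Proof. by rewrite /expi cosN sinN. Qed.

Definition cmeasurable d (T : measurableType d) (h : T -> C) :=
  measurable_fun setT (fun x => Re (h x) : measurableTypeR R) /\
  measurable_fun setT (fun x => Im (h x) : measurableTypeR R).

Definition cintegrable d (T : measurableType d) (mu : {measure set T -> \bar R}) (h : T -> C) :=
  mu.-integrable setT (EFin \o (fun x => Re (h x))) /\
  mu.-integrable setT (EFin \o (fun x => Im (h x))).

Definition cint d (T : measurableType d) (mu : {measure set T -> \bar R}) (h : T -> C) : C :=
  (\int[mu]_x Re (h x)) +i* (\int[mu]_x Im (h x)).

Section measurability.
Context d (T : measurableType d).

Lemma cmeasurableM (f g : T -> C) :
  cmeasurable f -> cmeasurable g -> cmeasurable (fun x => f x * g x).
Proof.
move=> [f1 f2] [g1 g2]; split.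
  by under eq_fun do rewrite Re_mulc; apply: measurable_funB; apply: measurable_funM.
by under eq_fun do rewrite Im_mulc; apply: measurable_funD; apply: measurable_funM.
Qed.

Lemma cmeasurable_cst (c : C) : cmeasurable (fun _ : T => c).
Proof. by split; exact: measurable_cst. Qed.

Lemma cmeasurable_real (f : T -> R) :
  measurable_fun setT (f : T -> measurableTypeR R) -> cmeasurable (fun x => f x +i* 0).
Proof. by move=> mf; split => //=; exact: measurable_cst. Qed.

Lemma cmeasurable_conjc (f : T -> C) : cmeasurable f -> cmeasurable (fun x => conjc (f x)).
Proof.
move=> [f1 f2]; split.
  rewrite (_ : (fun x => _) = (fun x => Re (f x))) //.
  by apply/funext => x; case: (f x).
rewrite (_ : (fun x => _) = (fun x => - Im (f x))); first exact: measurable_fun_opp.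
by apply/funext => x; case: (f x).
Qed.

Lemma cmeasurable_expi (f : T -> R) :
  measurable_fun setT (f : T -> measurableTypeR R) -> cmeasurable (fun x => expi (f x)).
Proof.
move=> mf; split => /=.
  by apply: (measurableT_comp _ mf); apply: continuous_measurable_fun; exact: continuous_cos.
by apply: (measurableT_comp _ mf); apply: continuous_measurable_fun; exact: continuous_sin.
Qed.

Lemma measurable_normc (f : T -> C) : cmeasurable f ->
  measurable_fun setT (fun x => normc (f x) : measurableTypeR R).
Proof.
move=> [f1 f2]; under eq_fun do rewrite normc_sqrtE.
by apply: measurable_sqrtr; apply: measurable_funD; exact: measurable_funX.
Qed.

End measurability.

Lemma cmeasurable_comp d1 d2 (T1 : measurableType d1) (T2 : measurableType d2)
    (phi : T1 -> T2) (h : T2 -> C) :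
  cmeasurable h -> measurable_fun setT phi -> cmeasurable (fun x => h (phi x)).
Proof. by move=> [h1 h2] mphi; split; [apply: (measurableT_comp h1)|apply: (measurableT_comp h2)]. Qed.

Section one_measure.
Context d (T : measurableType d) (mu : {measure set T -> \bar R}).

Lemma cintegrable_measurable h : cintegrable mu h -> cmeasurable h.
Proof.
by move=> [/integrableP[h1 _] /integrableP[h2 _]]; split; exact/measurable_EFinP.
Qed.

Lemma cintegrable_le (h : T -> C) (g : T -> R) : cmeasurable h ->
  mu.-integrable setT (EFin \o g) -> (forall x, normc (h x) <= g x) -> cintegrable mu h.
Proof.
move=> [h1 h2] ig hg; split.
  apply: (le_integrable _ _ _ ig) => //; first exact/measurable_EFinP.
  move=> x _; rewrite /= lee_fin (le_trans (normr_Re_le _)) // (le_trans (hg x)) //.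
  exact: ler_norm.
apply: (le_integrable _ _ _ ig) => //; first exact/measurable_EFinP.
move=> x _; rewrite /= lee_fin (le_trans (normr_Im_le _)) // (le_trans (hg x)) //.
exact: ler_norm.
Qed.

Lemma integrable_normc (h : T -> C) : cintegrable mu h ->
  mu.-integrable setT (EFin \o (fun x => normc (h x))).
Proof.
move=> ih; have mh := cintegrable_measurable ih; case: ih => i1 i2.
have := integrableD measurableT (integrable_abse i1) (integrable_abse i2).
apply: le_integrable => //; first by apply/measurable_EFinP; exact: measurable_normc.
move=> x _ /=; rewrite lee_fin ger0_norm ?normc_ge0 // ger0_norm ?addr_ge0 //.
apply: ler_sqr_pos; first exact: addr_ge0.
by rewrite sqr_modulus sqrrD !real_normK ?num_real // lerD2r lerDl mulrn_wge0 // mulr_ge0.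
Qed.

Lemma cintegrableZ (c : C) h : cintegrable mu h -> cintegrable mu (fun x => c * h x).
Proof.
move=> ih; apply: (@cintegrable_le _ (fun x => normc c * normc (h x))).
- by apply: cmeasurableM; [exact: cmeasurable_cst|exact: cintegrable_measurable].
- exact: (integrableZl measurableT _ (integrable_normc ih)).
by move=> x; rewrite Normc.normcM.
Qed.

Lemma cintZ (c : C) h : cintegrable mu h -> cint mu (fun x => c * h x) = c * cint mu h.
Proof.
case: c => a b [i1 i2]; rewrite /cint.
have Zl r f : mu.-integrable setT (EFin \o f) -> mu.-integrable setT (EFin \o (fun x => r * f x)).
  by move=> i; exact: (integrableZl measurableT r i).
congr (_ +i* _).
  under eq_Rintegral do rewrite Re_mulc /=.
  by rewrite RintegralB ?RintegralZl //; exact: Zl.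
under eq_Rintegral do rewrite Im_mulc /=.
by rewrite RintegralD ?RintegralZl //; exact: Zl.
Qed.

Lemma eq_cint g h : g =1 h -> cint mu g = cint mu h.
Proof. by move=> gh; congr cint; apply/funext. Qed.

Lemma cint_conjc h : cintegrable mu h -> cint mu (fun x => conjc (h x)) = conjc (cint mu h).
Proof.
move=> [i1 i2]; rewrite /cint /=; congr (_ +i* _).
  by apply: eq_Rintegral => x _; case: (h x).
rewrite -mulN1r -RintegralZl //.
by apply: eq_Rintegral => x _; case: (h x) => a b /=; rewrite mulN1r.
Qed.

(** Multiplying by the conjugate of the integral makes the integral real. *)
Lemma normc_cint_le h : cintegrable mu h ->
  ((normc (cint mu h))%:E <= \int[mu]_x (normc (h x))%:E)%E.
Proof.
move=> ih; set z := cint mu h; have [->|z0] := eqVneq (normc z) 0.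
  by apply: integral_ge0 => x _; rewrite lee_fin normc_ge0.
have zp : 0 < normc z by rewrite lt_neqAle eq_sym z0 normc_ge0.
have ic := cintegrableZ (conjc z) ih.
have E : \int[mu]_x Re (conjc z * h x) = normc z ^+ 2.
  transitivity (Re (cint mu (fun x => conjc z * h x))) => //.
  by rewrite cintZ // -/z sqr_modulus Re_mulc; case: (z) => a b /=; ring.
have H : (\int[mu]_x (Re (conjc z * h x))%:E = (normc z ^+ 2)%:E)%E.
  by rewrite -E /Rintegral fineK //; exact: (integrable_fin_num measurableT ic.1).
rewrite -(@lee_pmul2l _ (normc z)%:E) ?lte_fin // -EFinM -expr2 -H.
have mn := measurable_normc (cintegrable_measurable ih).
rewrite -ge0_integralZl ?lee_fin ?(ltW zp) //; last 2 first.
- exact/measurable_EFinP.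
- by move=> x _; rewrite lee_fin normc_ge0.
apply: le_trans (lee_abs _) _; apply: le_trans (le_abse_integral _ measurableT _) _.
  by case/integrableP: ic.1.
apply: ge0_le_integral => //.
- by apply: measurableT_comp => //; case/integrableP: ic.1.
- by apply: measurable_funeM; apply/measurable_EFinP.
move=> x _; rewrite -EFinM lee_fin; apply: le_trans (normr_Re_le _) _.
by rewrite Normc.normcM normc_conjc.
Qed.

(** Dominated convergence for a bound that is uniform along the sequence. *)
Lemma cint_cvg (h_ : nat -> T -> C) (h : T -> C) (g : T -> R) (B : \bar R) :
  (forall j, cmeasurable (h_ j)) -> cmeasurable h -> mu.-integrable setT (EFin \o g) ->
  (forall j x, normc (h_ j x) <= g x) ->
  (forall x, Re (h_ j x) @[j --> \oo] --> Re (h x)) ->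
  (forall x, Im (h_ j x) @[j --> \oo] --> Im (h x)) ->
  (forall j, (normc (cint mu (h_ j)))%:E <= B)%E -> ((normc (cint mu h))%:E <= B)%E.
Proof.
move=> mh_ mh ig hg cR cI HB.
have ih j : cintegrable mu (h_ j) by exact: (cintegrable_le (mh_ j) ig (hg j)).
case: B HB => [b|_|/(_ 0%N)] //; last by rewrite leey.
move=> HB; have b0 : 0 <= b by have := HB 0%N; rewrite lee_fin; apply: le_trans; exact: normc_ge0.
have real_cvg (p : C -> R) : (forall z, `|p z| <= normc z) ->
    (forall j, measurable_fun setT (fun x => p (h_ j x) : measurableTypeR R)) ->
    measurable_fun setT (fun x => p (h x) : measurableTypeR R) ->
    (forall x, p (h_ j x) @[j --> \oo] --> p (h x)) ->
    (\int[mu]_x p (h_ j x)) @[j --> \oo] --> \int[mu]_x p (h x).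
  move=> pn mp_ mp cp.
  have m1 j : measurable_fun setT (fun x => (p (h_ j x))%:E) by apply/measurable_EFinP; exact: mp_.
  have m2 : measurable_fun setT (fun x => (p (h x))%:E) by apply/measurable_EFinP; exact: mp.
  have c1 : {ae mu, forall x, setT x -> (p (h_ j x))%:E @[j --> \oo] --> (p (h x))%:E}.
    apply: aeW => x _; apply/fine_cvgP; split; first by apply: nearW.
    exact: cp.
  have c2 : {ae mu, forall x j, setT x -> (`|(p (h_ j x))%:E| <= (EFin \o g) x)%E}.
    by apply: aeW => x j _; rewrite /= lee_fin; exact: le_trans (pn _) (hg j x).
  have [ip _ cvgp] := dominated_convergence measurableT m1 m2 c1 ig c2.
  rewrite /Rintegral; apply: fine_cvg; rewrite fineK //.
  exact: integrable_fin_num.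
have cr := real_cvg (@complex.Re R) normr_Re_le (fun j => (mh_ j).1) mh.1 cR.
have ci := real_cvg (@complex.Im R) normr_Im_le (fun j => (mh_ j).2) mh.2 cI.
rewrite lee_fin; apply: ler_sqr_pos => //; rewrite sqr_modulus /cint /=.
have cs := cvgD (cvgM cr cr) (cvgM ci ci); rewrite -!expr2 in cs.
apply: (cvgr_to_le (cs _ _ _)).
apply: nearW => j; have := HB j; rewrite lee_fin => Hj.
change (Re (cint mu (h_ j)) ^+ 2 + Im (cint mu (h_ j)) ^+ 2 <= b ^+ 2).
by rewrite -sqr_modulus ler_pXn2r ?nnegrE ?normc_ge0.
Qed.

End one_measure.

Section two_measures.
Context d1 d2 (T1 : measurableType d1) (T2 : measurableType d2).
Variables (m1 : {sigma_finite_measure set T1 -> \bar R})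
  (m2 : {sigma_finite_measure set T2 -> \bar R}).

Lemma cint_fubini1 (h : T1 * T2 -> C) : cintegrable (m1 \x m2)%E h ->
  (forall x, cintegrable m2 (fun y => h (x, y))) ->
  cint m1 (fun x => cint m2 (fun y => h (x, y))) = cint (m1 \x m2)%E h.
Proof.
move=> [i1 i2] ih; congr (_ +i* _); rewrite /Rintegral /=.
  rewrite -(@integral12_prod_meas1 _ _ _ _ _ _ _ (fun z => (Re (h z))%:E)) //.
  congr fine; apply: eq_integral => x _; rewrite /fubini_F fineK //.
  exact: (integrable_fin_num measurableT (ih x).1).
rewrite -(@integral12_prod_meas1 _ _ _ _ _ _ _ (fun z => (Im (h z))%:E)) //.
congr fine; apply: eq_integral => x _; rewrite /fubini_F fineK //.
exact: (integrable_fin_num measurableT (ih x).2).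
Qed.

Lemma cint_fubini2 (h : T1 * T2 -> C) : cintegrable (m1 \x m2)%E h ->
  (forall y, cintegrable m1 (fun x => h (x, y))) ->
  cint m2 (fun y => cint m1 (fun x => h (x, y))) = cint (m1 \x m2)%E h.
Proof.
move=> [i1 i2] ih; congr (_ +i* _); rewrite /Rintegral /=.
  rewrite -(@integral21_prod_meas1 _ _ _ _ _ _ _ (fun z => (Re (h z))%:E)) //.
  congr fine; apply: eq_integral => x _; rewrite /fubini_G fineK //.
  exact: (integrable_fin_num measurableT (ih x).1).
rewrite -(@integral21_prod_meas1 _ _ _ _ _ _ _ (fun z => (Im (h z))%:E)) //.
congr fine; apply: eq_integral => x _; rewrite /fubini_G fineK //.
exact: (integrable_fin_num measurableT (ih x).2).
Qed.

Lemma measurable_Rintegral_snd (f : T1 * T2 -> R) :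
  measurable_fun setT (f : _ -> measurableTypeR R) ->
  measurable_fun setT (fun x => \int[m2]_y f (x, y) : measurableTypeR R).
Proof.
move=> mf; have mF : measurable_fun setT (EFin \o f) by exact/measurable_EFinP.
apply: measurableT_comp => /=; first exact: fine_measurable.
under eq_fun do rewrite integralE; apply: emeasurable_funB.
  have := measurable_integral_snd m2 (measurable_funepos mF) (fun=> funepos_ge0 _ _).
  rewrite (_ : (fun x => _) = (fun x => \int[m2]_y (fun y => (f (x, y))%:E)^\+ y)%E) //.
  by apply/funext => x; apply: eq_integral => y _; rewrite !funepos.unlock.
have := measurable_integral_snd m2 (measurable_funeneg mF) (fun=> funeneg_ge0 _ _).
rewrite (_ : (fun x => _) = (fun x => \int[m2]_y (fun y => (f (x, y))%:E)^\- y)%E) //.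
by apply/funext => x; apply: eq_integral => y _; rewrite !funeneg.unlock.
Qed.

Lemma cmeasurable_cint_snd (h : T1 * T2 -> C) : cmeasurable h ->
  cmeasurable (fun x => cint m2 (fun y => h (x, y))).
Proof.
move=> [h1 h2]; split => /=.
  exact: (@measurable_Rintegral_snd (fun z => Re (h z))).
exact: (@measurable_Rintegral_snd (fun z => Im (h z))).
Qed.

Lemma integrable_prod (a : T1 -> R) (b : T2 -> R) :
  m1.-integrable setT (EFin \o a) -> m2.-integrable setT (EFin \o b) ->
  (m1 \x m2)%E.-integrable setT (EFin \o (fun z => a z.1 * b z.2)).
Proof.
move=> ia ib; have ma : measurable_fun setT (a : _ -> measurableTypeR R).
  by case/integrableP: ia => /measurable_EFinP.
have mb : measurable_fun setT (b : _ -> measurableTypeR R).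
  by case/integrableP: ib => /measurable_EFinP.
apply/integrable12ltyP.
  by apply/measurable_EFinP; apply: measurable_funM; exact: measurableT_comp.
case/integrableP: ia => _ ia; case/integrableP: ib => mb' ib.
rewrite (_ : (\int[m1]_x _)%E = (\int[m1]_x `|(a x)%:E| * \int[m2]_y `|(b y)%:E|)%E).
  by apply: lte_mul_pinfty => //; [exact: integral_ge0|rewrite ge0_fin_numE //; exact: integral_ge0].
transitivity (\int[m1]_x (`|(a x)%:E| * \int[m2]_y `|(b y)%:E|))%E.
  apply: eq_integral => x _; rewrite -ge0_integralZl //; last exact: measurableT_comp.
  by apply: eq_integral => y _; rewrite /= normrM EFinM.
rewrite ge0_integralZr //; last exact: integral_ge0.
by apply: measurableT_comp => //; exact/measurable_EFinP.
Qed.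

End two_measures.
End complex_integral.

(** * The Abel kernel and its Fourier transform *)

Section abel_kernel.
Local Open Scope complex_scope.
Context {R : realType}.
Local Notation mR := (measurableTypeR R).
Local Notation leb := (@lebesgue_measure R).

Lemma is_derive_damped_cos (x t : R) :
  is_derive t 1 (fun t : R => expR (- t) * ((x * sin (t * x) - cos (t * x)) / (1 + x ^+ 2) - 1))
    (expR (- t) * (1 + cos (t * x))).
Proof.
have x0 : 1 + x ^+ 2 != 0 by rewrite gt_eqF // ltr_pwDl // sqr_ge0.
by apply: is_derive_eq; rewrite !scaler1 /GRing.scale /=; field.
Qed.

Lemma continuous_damped_cos (x : R) : continuous (fun t : R => expR (- `|t|) * (1 + cos (t * x))).
Proof.
move=> t; apply: cvgM.
  apply: continuous_comp; last exact: continuous_expR.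
  by apply: cvgN; exact: norm_continuous.
apply: cvgD; first exact: cvg_cst.
apply: continuous_comp; last exact: continuous_cos.
by apply: cvgM; [exact: cvg_id|exact: cvg_cst].
Qed.

(** Adding 1 to the cosine makes the integrand nonnegative, which allows the
    fundamental theorem of calculus on a half-line. *)
Lemma integral_damped_cos_half (x : R) :
  (\int[leb]_(t in `[0%R, +oo[) (expR (- `|t|) * (1 + cos (t * x)))%:E
    = (1 + (1 + x ^+ 2)^-1)%:E)%E.
Proof.
pose F (t : R) := expR (- t) * ((x * sin (t * x) - cos (t * x)) / (1 + x ^+ 2) - 1).
have x0 : 0 < 1 + x ^+ 2 by rewrite ltr_pwDl // sqr_ge0.
have dF t : derivable F t 1 by exact: (@ex_derive _ _ _ _ _ _ _ (is_derive_damped_cos x t)).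
rewrite (@ge0_continuous_FTC2y _ _ F 0 0) //.
- by rewrite sub0e -EFinN /F oppr0 expR0 mul0r sin0 cos0 mulr0; congr EFin; field; exact: lt0r_neq0.
- exact/continuous_subspaceT/continuous_damped_cos.
- have bnd t : `|F t| <= ((`|x| + 1) / (1 + x ^+ 2) + 1) * expR (- t).
    rewrite /F normrM [`|expR _|]ger0_norm ?expR_ge0 // mulrC ler_wpM2r ?expR_ge0 //.
    apply: le_trans (ler_normB _ _) _; rewrite normr1 lerD2r normrM.
    rewrite [`|_^-1|]ger0_norm ?invr_ge0 ?(ltW x0) // ler_wpM2r ?invr_ge0 ?(ltW x0) //.
    apply: le_trans (ler_normB _ _) _; apply: lerD; last exact: cos_max.
    by rewrite normrM ler_piMr // sin_max.
  have c0 : ((`|x| + 1) / (1 + x ^+ 2) + 1) * expR (- t) @[t --> +oo] --> (0 : R).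
    rewrite -[X in _ --> X](mulr0 ((`|x| + 1) / (1 + x ^+ 2) + 1)).
    by apply: cvgM; [exact: cvg_cst|exact: cvgr_expR].
  apply/norm_cvg0P; apply: (squeeze_cvgr _ (cvg_cst 0) c0).
  by apply: nearW => t; rewrite normr_ge0 bnd.
- by apply: cvg_at_right_filter; apply: differentiable_continuous; exact/derivable1_diffP.
- move=> t; rewrite in_itv /= andbT => t0.
  rewrite derive1E (@derive_val _ _ _ _ _ _ _ (is_derive_damped_cos x t)).
  by rewrite gtr0_norm.
Qed.

Lemma integral_damped_cos (x : R) :
  (\int[leb]_t (expR (- `|t|) * (1 + cos (t * x)))%:E = (2 * (1 + (1 + x ^+ 2)^-1))%:E)%E.
Proof.
rewrite (@ge0_symfun_integralT _ (fun t => expR (- `|t|) * (1 + cos (t * x)))) //.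
- by rewrite -set_itvcy integral_damped_cos_half.
- exact: continuous_damped_cos.
- by move=> t /=; rewrite normrN mulNr cosN.
Qed.

Lemma integrable_expRN_norm : leb.-integrable setT (EFin \o (fun t : mR => expR (- `|t|))).
Proof.
have m1 : measurable_fun setT (fun t : R => expR (- `|t|) * (1 + cos (t * 0))).
  by apply: continuous_measurable_fun; exact: continuous_damped_cos.
have e t : expR (- `|t|) * (1 + cos (t * 0)) = 2 * expR (- `|t|) :> R.
  by rewrite mulr0 cos0 mulrC.
have m2 : measurable_fun setT (fun t : R => expR (- `|t|)).
  rewrite (_ : (fun t => _) = (fun t => 2^-1 * (expR (- `|t|) * (1 + cos (t * 0))))).
    by apply: measurable_funM => //; exact: measurable_cst.
  by apply/funext => t; rewrite e mulKf.
apply/integrableP; split; first exact/measurable_EFinP.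
apply: (@le_lt_trans _ _ (\int[leb]_t (expR (- `|t|) * (1 + cos (t * 0)))%:E)%E); last first.
  by rewrite integral_damped_cos ltry.
apply: ge0_le_integral => //.
- by apply: measurableT_comp => //; exact/measurable_EFinP.
- exact/measurable_EFinP.
- move=> t _ /=; rewrite lee_fin e ger0_norm ?expR_ge0 //.
  by have := expR_ge0 (- `|t|); lra.
Qed.

Lemma integrable_fourier_abel (x : R) :
  cintegrable leb (fun t : mR => (expR (- `|t|) +i* 0) * expi (t * x)).
Proof.
apply: (cintegrable_le _ integrable_expRN_norm).
  apply: cmeasurableM; first apply: cmeasurable_real.
    by case/integrableP: integrable_expRN_norm => /measurable_EFinP.
  by apply: cmeasurable_expi; meas.
by move=> t; rewrite Normc.normcM normc_expi mulr1 normc_real ger0_norm // expR_ge0.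
Qed.

(** The sine part is odd. *)
Lemma fourier_abel (x : R) :
  cint leb (fun t : mR => (expR (- `|t|) +i* 0) * expi (t * x)) = (2 / (1 + x ^+ 2)) +i* 0.
Proof.
have [i1 i2] := integrable_fourier_abel x; congr (_ +i* _).
  have mE y : \int[leb]_t (expR (- `|t|) * (1 + cos (t * y))) = 2 * (1 + (1 + y ^+ 2)^-1).
    by rewrite /Rintegral integral_damped_cos.
  have I0 : \int[leb]_t expR (- `|t|) = 2.
    have := mE 0; rewrite expr0n addr0 invr1.
    under eq_Rintegral do rewrite mulr0 cos0 mulrC.
    by rewrite RintegralZl //; [lra|exact: integrable_expRN_norm].
  have := mE x; under eq_Rintegral do rewrite mulrDr mulr1.
  have ic : leb.-integrable setT (EFin \o (fun t : mR => expR (- `|t|) * cos (t * x))).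
    move: i1; apply: eq_integrable => // t _ /=.
    by rewrite mul0r subr0.
  rewrite RintegralD //; last exact: integrable_expRN_norm.
  rewrite I0 => E; transitivity (\int[leb]_t (expR (- `|t|) * cos (t * x))); last by lra.
  by apply: eq_Rintegral => t _; rewrite Re_mulc /= mul0r subr0.
set I := \int[leb]_t _.
have mS : measurable_fun setT (fun t : mR => (complex.Im ((expR (- `|t|) +i* 0) * expi (t * x)))%:E).
  by case/integrableP: i2.
suff : I = - I by lra.
have mN : measurable_fun setT (fun t : mR => 0 - t : mR) by meas.
rewrite {1}/I /Rintegral (integral_preserving mN (@lebesgue_measure_reflect R 0) mS).
rewrite -mulN1r /I -RintegralZl //; congr fine; apply: eq_integral => t _.
rewrite sub0r !Im_mulc /= normrN mulNr sinN; congr EFin; ring.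
Qed.

End abel_kernel.

(** * Tensor products *)

Section tensor_products.
Local Open Scope complex_scope.
Context {R : realType}.
Local Notation mR := (measurableTypeR R).
Local Notation leb := (@lebesgue_measure R).
Local Notation ST n := ('rV[R]_n * mR)%type.
Local Notation mu := (@lebesgue_spacetime R _).

Lemma cint_preserving d1 d2 (X : measurableType d1) (Y : measurableType d2) (phi : X -> Y)
    (mphi : measurable_fun setT phi) (m : {measure set X -> \bar R})
    (m' : {measure set Y -> \bar R}) :
  (forall A, measurable A -> m (phi @^-1` A) = m' A) ->
  forall h, cmeasurable h -> cint m' h = cint m (fun x => h (phi x)).
Proof.
move=> pres h [h1 h2]; congr (_ +i* _); rewrite /Rintegral.
  by rewrite (integral_preserving mphi pres) //; exact/measurable_EFinP.
by rewrite (integral_preserving mphi pres) //; exact/measurable_EFinP.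
Qed.

Lemma cint_prod d1 d2 (T1 : measurableType d1) (T2 : measurableType d2)
    (m1 : {sigma_finite_measure set T1 -> \bar R}) (m2 : {sigma_finite_measure set T2 -> \bar R})
    (a : T1 -> R[i]) (b : T2 -> R[i]) :
  cintegrable m1 a -> cintegrable m2 b ->
  cint (m1 \x m2)%E (fun z => a z.1 * b z.2) = cint m1 a * cint m2 b.
Proof.
move=> ia ib; have ma := cintegrable_measurable ia; have mb := cintegrable_measurable ib.
rewrite -cint_fubini1.
- rewrite -[RHS]mulrC -cintZ //; apply: eq_cint => x /=.
  by rewrite cintZ // mulrC.
- apply: (cintegrable_le _ (integrable_prod (integrable_normc ia) (integrable_normc ib))).
    apply: cmeasurableM; first exact: (cmeasurable_comp ma measurable_fst).
    exact: (cmeasurable_comp mb measurable_snd).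
  by move=> z; rewrite Normc.normcM.
- by move=> x; exact: (cintegrableZ (a x) ib).
Qed.

Lemma integrable_rV_pow n (f : mR -> R) : (forall x, 0 <= f x) ->
  leb.-integrable setT (EFin \o f) ->
  (lebesgue_rV R n).-integrable setT (EFin \o (fun x : 'rV[R]_n => \prod_(j < n) f (x ord0 j))).
Proof.
move=> f0 /integrableP[mf fi].
have mF : measurable_fun setT (fun x : 'rV[R]_n => \prod_(j < n) (EFin \o f) (x ord0 j))%E.
  exact: (@measurable_rV_prod _ n (fun _ => EFin \o f) (fun _ => mf)).
have E (x : 'rV[R]_n) : (EFin \o (fun x : 'rV[R]_n => \prod_(j < n) f (x ord0 j))) x =
    (\prod_(j < n) (EFin \o f) (x ord0 j))%E by rewrite /= prodEFin.
rewrite (funext E); apply/integrableP; split => //.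
have -> : (\int[lebesgue_rV R n]_x `|\prod_(j < n) (EFin \o f) (x ord0 j)| =
   \int[lebesgue_rV R n]_x \prod_(j < n) (EFin \o f) (x ord0 j))%E.
  by apply: eq_integral => x _; rewrite prodEFin gee0_abs // lee_fin prodr_ge0.
rewrite (@integral_rV_prod _ n (fun _ => EFin \o f)) //.
have fin : (\int[leb]_x (EFin \o f) x)%E \is a fin_num.
  rewrite ge0_fin_numE; last by apply: integral_ge0 => x _; rewrite lee_fin.
  by move: fi; under eq_integral do rewrite gee0_abs ?lee_fin //.
by rewrite -(fineK fin) prodEFin ltry.
Qed.

Definition tensor n (f : mR -> R) (p : ST n) : R := (\prod_(j < n) f (p.1 ord0 j)) * f p.2.

Lemma tensor_ge0 n f (p : ST n) : (forall x, 0 <= f x) -> 0 <= tensor f p.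
Proof. by move=> f0; rewrite mulr_ge0 ?prodr_ge0. Qed.

Lemma integrable_tensor n (f : mR -> R) : (forall x, 0 <= f x) ->
  leb.-integrable setT (EFin \o f) ->
  (@lebesgue_spacetime R n).-integrable setT (EFin \o tensor f).
Proof. by move=> f0 fi; exact: (integrable_prod (integrable_rV_pow n f0 fi) fi). Qed.

Definition stdot n (p q : ST n) : R := dot p.1 q.1 + p.2 * q.2.

Lemma integrable_tensor_expi n (f : mR -> R) (z : ST n) : (forall x, 0 <= f x) ->
  leb.-integrable setT (EFin \o f) ->
  cintegrable mu (fun q : ST n => (tensor f q +i* 0) * expi (stdot q z)).
Proof.
move=> f0 fi; have it := integrable_tensor n f0 fi.
apply: (cintegrable_le _ it).
  apply: cmeasurableM; first apply: cmeasurable_real.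
    by case/integrableP: it => /measurable_EFinP.
  by apply: cmeasurable_expi; rewrite /stdot; meas.
by move=> t; rewrite Normc.normcM normc_expi mulr1 normc_real ger0_norm // tensor_ge0.
Qed.

Lemma fourier_tensor n (f g : mR -> R) (z : ST n) : (forall x, 0 <= f x) ->
  leb.-integrable setT (EFin \o f) ->
  (forall x, cint leb (fun t => (f t +i* 0) * expi (t * x)) = g x +i* 0) ->
  cint mu (fun q : ST n => (tensor f q +i* 0) * expi (stdot q z)) = tensor g z +i* 0.
Proof.
move=> f0 fi Hg.
have mf : measurable_fun setT (f : mR -> mR).
  by case/integrableP: fi => /measurable_EFinP.
have realM (a b : R) : (a * b) +i* 0 = (a +i* 0) * (b +i* 0).
  by apply/eqP; rewrite eq_complex /= !mulr0 !mul0r subr0 addr0 !eqxx.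
have i1 x : cintegrable leb (fun t => (f t +i* 0) * expi (t * x)).
  apply: (cintegrable_le _ fi).
    by apply: cmeasurableM; [exact: cmeasurable_real|apply: cmeasurable_expi; meas].
  by move=> t; rewrite Normc.normcM normc_expi mulr1 normc_real ger0_norm.
have iV m (x : 'rV[R]_m) : cintegrable (lebesgue_rV R m)
    (fun y => ((\prod_(j < m) f (y ord0 j)) +i* 0) * expi (dot y x)).
  have ip := integrable_rV_pow m f0 fi.
  apply: (cintegrable_le _ ip).
    apply: cmeasurableM; first apply: cmeasurable_real.
      by case/integrableP: ip => /measurable_EFinP.
    by apply: cmeasurable_expi; meas.
  by move=> t; rewrite Normc.normcM normc_expi mulr1 normc_real ger0_norm // prodr_ge0.
have FV m (x : 'rV[R]_m) : cint (lebesgue_rV R m)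
    (fun y => ((\prod_(j < m) f (y ord0 j)) +i* 0) * expi (dot y x)) =
    (\prod_(j < m) g (x ord0 j)) +i* 0.
  elim: m x => [|m IH] x.
    have E (y : 'rV[R]_0) : ((\prod_(j < 0) f (y ord0 j)) +i* 0) * expi (dot y x) = 1.
      by rewrite big_ord0 /dot big_ord0 mul1r /expi cos0 sin0.
    rewrite (eq_cint _ E) big_ord0 /cint /=; congr (_ +i* _).
      rewrite Rintegral_cst // mul1r; exact: (congr1 fine (@diracT _ _ R (0 : 'rV[R]_0))).
    by rewrite Rintegral_cst // mul0r.
  rewrite (cint_preserving (measurable_insert_coord ord0) (@insert_coord_preserving R m ord0)); last first.
    exact: cintegrable_measurable.
  pose x' : 'rV[R]_m := \row_j x ord0 (lift ord0 j).
  have gE : \prod_(j < m.+1) g (x ord0 j) = (\prod_(j < m) g (x' ord0 j)) * g (x ord0 ord0).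
    by rewrite big_ord_recl mulrC; congr (_ * _); apply: eq_bigr => j _; rewrite mxE.
  rewrite gE realM -IH -Hg -cint_prod //.
  apply: eq_cint => -[y t] /=; rewrite big_ord_recl insert_coord_same.
  have -> : dot (insert_coord ord0 (y, t)) x = dot y x' + t * x ord0 ord0.
    rewrite /dot big_ord_recl insert_coord_same addrC; congr (_ + _).
    by apply: eq_bigr => j _; rewrite insert_coord_lift mxE.
  rewrite expiD realM /=.
  under eq_bigr do rewrite insert_coord_lift /=.
  by rewrite [_ * ((\prod_(i < m) _) +i* 0)]mulrC mulrACA.
rewrite [in RHS]/tensor realM -FV -Hg -cint_prod //; apply: eq_cint => -[y t].
by rewrite /tensor /stdot realM expiD mulrACA.
Qed.

End tensor_products.

(** * Dilations *)

Section dilation.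
Local Open Scope complex_scope.
Context {R : realType}.
Local Notation mR := (measurableTypeR R).
Local Notation leb := (@lebesgue_measure R).
Local Notation ST n := ('rV[R]_n * mR)%type.
Local Notation normc := Normc.normc.
Local Notation mu := (@lebesgue_spacetime R _).

Lemma cint_mscale d (T : measurableType d) (m : {measure set T -> \bar R}) (r : {nonneg R})
    (h : T -> R[i]) : cintegrable m h ->
  cint (mscale r m) h = (r%:num +i* 0) * cint m h.
Proof.
have key (f : T -> R) : m.-integrable setT (EFin \o f) ->
    \int[mscale r m]_x f x = r%:num * \int[m]_x f x.
  move=> fi; have mf := measurable_int _ fi; rewrite /Rintegral integralE [in RHS]integralE.
  have p1 := integrable_fin_num measurableT (integrable_funepos measurableT fi).
  have p2 := integrable_fin_num measurableT (integrable_funeneg measurableT fi).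
  rewrite ge0_integral_mscale //; last exact: measurable_funepos.
  rewrite ge0_integral_mscale //; last exact: measurable_funeneg.
  by rewrite -(fineK p1) -(fineK p2) /= mulrBr.
move=> [h1 h2]; rewrite /cint !key //.
by apply/eqP; rewrite eq_complex /= !mul0r subr0 addr0 !eqxx.
Qed.

Definition dilate n (eps : R) (y z : ST n) : ST n := (y.1 + eps *: z.1, y.2 + eps * z.2).

Lemma measurable_dilate n eps (y : ST n) : measurable_fun setT (dilate eps y).
Proof. by rewrite /dilate; meas. Qed.

Lemma lebesgue_dilate1 (eps c : R) (A : set mR) : 0 < eps -> measurable A ->
  (eps%:E * leb ((fun x : mR => (c + eps * x)%R : mR) @^-1` A))%E = leb A.
Proof.
move=> e0 mA; rewrite -(lebesgue_measure_shift c mA).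
rewrite -(@lebesgue_measure_scale _ _ ((fun x : mR => c + x : mR) @^-1` A) e0) //.
rewrite -[X in measurable X]setTI; apply: measurable_funD => //.
Qed.

Lemma spacetime_dilate n (eps : R) (y : ST n) (E : set (ST n)) : 0 < eps -> measurable E ->
  ((eps ^+ n.+1)%:E * mu (dilate eps y @^-1` E))%E = mu E.
Proof.
move=> e0; have en : 0 <= eps ^+ n.+1 by rewrite exprn_ge0 // ltW.
pose m := [the measure _ _ of mscale (NngNum en)
  (measure_function_pushforward__canonical__measure_function_Measure mu (measurable_dilate eps y))].
move=> mE; apply/esym; apply: (@product_measure_unique _ _ _ _ _ (lebesgue_rV R n) leb m) => //.
move=> A B mA mB; rewrite /m /= /mscale /= /pushforward.
have -> : dilate eps y @^-1` (A `*` B) =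
    ((fun x : 'rV[R]_n => \row_i (y.1 ord0 i + eps * x ord0 i)) @^-1` A) `*`
    ((fun x : mR => y.2 + eps * x : mR) @^-1` B).
  have E1 (x : 'rV[R]_n) : \row_i (y.1 ord0 i + eps * x ord0 i) = y.1 + eps *: x.
    by apply/rowP => i; rewrite !mxE.
  by apply/seteqP; split => -[a b] [/=]; rewrite E1.
have mf c : measurable_fun setT (fun x : mR => c + eps * x : mR) by meas.
have mT : measurable_fun setT (fun x : 'rV[R]_n => \row_i (y.1 ord0 i + eps * x ord0 i)).
  apply: measurable_fun_rV => i; under eq_fun do rewrite mxE.
  exact: (measurableT_comp (mf _) (measurable_coord_rV i)).
set S1 := (S1 in S1 `*` _); set S2 := (S2 in _ `*` S2).
have mS1 : measurable S1 by rewrite -[S1]setTI; exact: mT.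
have mS2 : measurable S2 by rewrite -[S2]setTI; exact: mf.
have -> : mu (S1 `*` S2) = (lebesgue_rV R n S1 * leb S2)%E by exact: product_measure1E.
have HA : ((eps ^+ n)%:E * lebesgue_rV R n S1)%E = lebesgue_rV R n A.
  apply: (@lebesgue_rV_coordwise R n eps (fun i x => y.1 ord0 i + eps * x)) => //.
    exact: ltW.
  by move=> i D mD; exact: lebesgue_dilate1.
have HB : (eps%:E * leb S2)%E = leb B by exact: lebesgue_dilate1.
by rewrite -HA -HB exprSr EFinM muleACA.
Qed.

Lemma dilate_preserving n (eps : R) (e0 : 0 < eps) (y : ST n) (E : set (ST n)) : measurable E ->
  mscale (NngNum (exprn_ge0 n.+1 (ltW e0))) mu (dilate eps y @^-1` E) = mu E.
Proof. by move=> mE; rewrite /mscale /=; exact: spacetime_dilate. Qed.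

Lemma ge0_integral_dilate n (eps : R) (y : ST n) (f : ST n -> \bar R) : 0 < eps ->
  measurable_fun setT f -> (forall z, 0 <= f z)%E ->
  (\int[mu]_z f z = (eps ^+ n.+1)%:E * \int[mu]_z f (dilate eps y z))%E.
Proof.
move=> e0 mf f0.
rewrite (ge0_integral_preserving (measurable_dilate eps y) (dilate_preserving e0 y)) //.
by rewrite ge0_integral_mscale //; exact: (measurableT_comp mf (measurable_dilate eps y)).
Qed.

Lemma cint_dilate n (eps : R) (y : ST n) (h : ST n -> R[i]) : 0 < eps -> cintegrable mu h ->
  cint mu h = ((eps ^+ n.+1) +i* 0) * cint mu (fun z => h (dilate eps y z)) /\
  cintegrable mu (fun z => h (dilate eps y z)).
Proof.
move=> e0 ih; have mh := cintegrable_measurable ih.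
have i2 : cintegrable mu (fun z => h (dilate eps y z)).
  have mhd : cmeasurable (fun z => h (dilate eps y z)).
    exact: (cmeasurable_comp mh (measurable_dilate eps y)).
  apply: (@cintegrable_le _ _ _ _ _ (fun z => normc (h (dilate eps y z)))) => //.
  apply/integrableP; split; first by apply/measurable_EFinP; exact: measurable_normc.
  have := integrable_normc ih => /integrableP[mn].
  rewrite (@ge0_integral_dilate _ eps y) //; last exact: measurableT_comp.
  pose I := (\int[@lebesgue_spacetime R n]_z `|(normc (h (dilate eps y z)))%:E|)%E.
  change (((eps ^+ n.+1)%:E * I < +oo)%E -> (I < +oo)%E).
  rewrite !ltey; apply: contra => /eqP ->.
  by rewrite gt0_muley // lte_fin exprn_gt0.
split=> //.
rewrite (cint_preserving (measurable_dilate eps y) (dilate_preserving e0 y)) //.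
by rewrite cint_mscale.
Qed.

End dilation.

(** * Fourier bound for the integral of a product *)

Section convolution.
Local Open Scope complex_scope.
Context {R : realType}.
Local Notation mR := (measurableTypeR R).
Local Notation leb := (@lebesgue_measure R).
Local Notation ST n := ('rV[R]_n * mR)%type.
Local Notation normc := Normc.normc.
Local Notation mu := (@lebesgue_spacetime R _).

Definition abel n : ST n -> R := tensor (fun t : mR => expR (- `|t|)).
Definition poisson n : ST n -> R := tensor (fun x : mR => 2 / (1 + x ^+ 2)).

Lemma inv1sqr_ge0 (x : R) : 0 <= (1 + x ^+ 2)^-1.
Proof. by rewrite invr_ge0 addr_ge0 ?sqr_ge0. Qed.

Lemma integrable_inv1sqr : leb.-integrable setT (EFin \o (fun x : mR => (1 + x ^+ 2)^-1)).
Proof.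
have [C C0 HC] := @integral_bracket_lty R 2 ltac:(by rewrite ltr1n).
have E (x : R) : (1 + x ^+ 2)^-1 = bracket x `^ (- 2).
  by rewrite -sqr_bracket powRN powR_mulrn // ltW // bracket_gt0.
have -> : (fun x : mR => (1 + x ^+ 2)^-1) = (fun x => bracket x `^ (- 2)) by apply/funext.
have mb : measurable_fun setT (fun x : mR => bracket x `^ (- 2)) by meas.
apply/integrableP; split; first exact/measurable_EFinP.
apply: le_lt_trans (ltry C); apply: le_trans HC; apply: ge0_le_integral => //.
- by apply: measurableT_comp => //; exact/measurable_EFinP.
- exact/measurable_EFinP.
- by move=> x _; rewrite /= lee_fin ger0_norm // powR_ge0.
Qed.

Lemma poisson_ge0 n (z : ST n) : 0 <= poisson z.
Proof. by apply: tensor_ge0 => x; rewrite mulr_ge0 // inv1sqr_ge0. Qed.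

Lemma abel_ge0 n (z : ST n) : 0 <= abel z.
Proof. by apply: tensor_ge0 => x; exact: expR_ge0. Qed.

Lemma abel_le1 n (z : ST n) : abel z <= 1.
Proof.
have e1 (x : R) : expR (- `|x|) <= 1 by rewrite -expR0 ler_expR oppr_le0.
by apply: mulr_ile1; rewrite ?expR_ge0 ?prodr_ge0 ?prodr_ile1 // => i _; rewrite expR_ge0 e1.
Qed.

Lemma integrable_poisson n : (@lebesgue_spacetime R n).-integrable setT (EFin \o @poisson n).
Proof.
apply: integrable_tensor; first by move=> x; rewrite mulr_ge0 // inv1sqr_ge0.
exact: (integrableZl measurableT 2 integrable_inv1sqr).
Qed.

Lemma integrable_abel n : (@lebesgue_spacetime R n).-integrable setT (EFin \o @abel n).
Proof. by apply: integrable_tensor => //; exact: integrable_expRN_norm. Qed.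

Lemma fourier_abel_poisson n (z : ST n) :
  cint mu (fun q => (abel q +i* 0) * expi (stdot q z)) = poisson z +i* 0.
Proof.
apply: fourier_tensor; first by move=> x; exact: expR_ge0.
  exact: integrable_expRN_norm.
exact: fourier_abel.
Qed.

Lemma measurable_integrable d (T : measurableType d) (m : {measure set T -> \bar R}) (f : T -> R) :
  m.-integrable setT (EFin \o f) -> measurable_fun setT (f : T -> measurableTypeR R).
Proof. by case/integrableP => /measurable_EFinP. Qed.

Section bound.
Context (n : nat) (w g : ST n -> R[i]) (M : R).
Hypotheses (iw : cintegrable mu w) (ig : cintegrable mu g) (wM : forall x, normc (w x) <= M).
Let mw := cintegrable_measurable iw.
Let mg := cintegrable_measurable ig.

Let what (zeta : ST n) := cint mu (fun x => w x * expi (stdot zeta x)).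
Let ghat (zeta : ST n) := cint mu (fun y => g y * expi (- stdot zeta y)).

(** Integrating over z smooths w at scale eps around y. *)
Definition smoothed (eps : R) (yz : ST n * ST n) : R[i] :=
  g yz.1 * (w (dilate eps yz.1 yz.2) * (poisson yz.2 +i* 0)).

Lemma measurable_stdot d (T : measurableType d) (a b : T -> ST n) :
  measurable_fun setT a -> measurable_fun setT b ->
  measurable_fun setT (fun t => stdot (a t) (b t) : mR).
Proof. by move=> ma mb; rewrite /stdot; meas. Qed.

Lemma cmeasurable_smoothed eps : cmeasurable (smoothed eps).
Proof.
apply: cmeasurableM; first exact: (cmeasurable_comp mg measurable_fst).
apply: cmeasurableM.
  by apply: (cmeasurable_comp mw); rewrite /dilate; meas.
apply: cmeasurable_real.
exact: (measurableT_comp (measurable_integrable (integrable_poisson n)) measurable_snd).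
Qed.

Lemma normc_smoothed_le eps yz :
  normc (smoothed eps yz) <= (normc (g yz.1) * M) * poisson yz.2.
Proof.
rewrite /smoothed !Normc.normcM normc_real ger0_norm ?poisson_ge0 // -mulrA.
by rewrite ler_wpM2l ?normc_ge0 // ler_wpM2r ?poisson_ge0.
Qed.

Lemma integrable_smoothed_bound : (mu \x mu)%E.-integrable setT
  (EFin \o (fun yz : ST n * ST n => (normc (g yz.1) * M) * poisson yz.2)).
Proof.
have iM : (@lebesgue_spacetime R n).-integrable setT (EFin \o (fun y => normc (g y) * M)).
  have := integrableZl measurableT M (integrable_normc ig).
  by apply: eq_integrable => // x _ /=; rewrite mulrC.
exact: (integrable_prod iM (integrable_poisson n)).
Qed.

Lemma cintegrable_smoothed eps : cintegrable (mu \x mu)%E (smoothed eps).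
Proof.
exact: (cintegrable_le (cmeasurable_smoothed eps) integrable_smoothed_bound (normc_smoothed_le eps)).
Qed.

Lemma cintegrable_expiM (h : ST n -> R[i]) (f : ST n -> R) : cintegrable mu h ->
  measurable_fun setT (f : _ -> mR) -> cintegrable mu (fun x => h x * expi (f x)).
Proof.
move=> ih mf; apply: (cintegrable_le _ (integrable_normc ih)).
  by apply: cmeasurableM; [exact: (cintegrable_measurable ih)|exact: cmeasurable_expi].
by move=> x; rewrite Normc.normcM normc_expi mulr1.
Qed.

Lemma normc_cint_expi_le (h : ST n -> R[i]) (f : ST n -> R) : cintegrable mu h ->
  measurable_fun setT (f : _ -> mR) ->
  normc (cint mu (fun x => h x * expi (f x))) <= fine (\int[mu]_x (normc (h x))%:E).
Proof.
move=> ih mf; have hfin := integrable_fin_num measurableT (integrable_normc ih).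
rewrite -lee_fin fineK //; apply: le_trans (normc_cint_le (cintegrable_expiM ih mf)) _.
rewrite le_eqVlt; apply/orP; left; apply/eqP.
by apply: eq_integral => x _; rewrite Normc.normcM normc_expi mulr1.
Qed.

Lemma cmeasurable_what : cmeasurable what.
Proof.
apply: (@cmeasurable_cint_snd _ _ _ _ _ mu (fun z => w z.2 * expi (stdot z.1 z.2))).
apply: cmeasurableM; first exact: (cmeasurable_comp mw measurable_snd).
by apply: cmeasurable_expi; apply: measurable_stdot; meas.
Qed.

Lemma cmeasurable_ghat : cmeasurable ghat.
Proof.
apply: (@cmeasurable_cint_snd _ _ _ _ _ mu (fun z => g z.2 * expi (- stdot z.1 z.2))).
apply: cmeasurableM; first exact: (cmeasurable_comp mg measurable_snd).
by apply: cmeasurable_expi; apply: measurable_fun_opp; apply: measurable_stdot; meas.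
Qed.

Lemma stdot_dilate eps (eta y z : ST n) : eps != 0 ->
  stdot (dilate eps^-1 0 eta) (dilate eps y z) = stdot (dilate eps^-1 0 eta) y + stdot eta z.
Proof.
move=> e0; rewrite /stdot /dilate /= !add0r.
have dotD (a b c : 'rV[R]_n) : dot a (b + c) = dot a b + dot a c.
  by rewrite /dot -big_split; apply: eq_bigr => i _; rewrite !mxE mulrDr.
have dotZ (a b : R) (c e : 'rV[R]_n) : dot (a *: c) (b *: e) = a * b * dot c e.
  by rewrite /dot mulr_sumr; apply: eq_bigr => i _; rewrite !mxE mulrACA.
rewrite dotD dotZ mulVf // mul1r.
have -> : eps^-1 * eta.2 * (y.2 + eps * z.2) = eps^-1 * eta.2 * y.2 + eta.2 * z.2 by field.
by rewrite addrACA.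
Qed.

(** The substitution x = y + eps z turns an oscillatory integral in z into a
    Fourier integral at the frequency eta / eps. *)
Lemma dilated_fourier eps (eta y : ST n) : 0 < eps ->
  ((eps ^+ n.+1) +i* 0) * cint mu (fun z => w (dilate eps y z) * expi (stdot eta z)) =
  expi (- stdot (dilate eps^-1 0 eta) y) * what (dilate eps^-1 0 eta).
Proof.
move=> e0; set zeta := dilate eps^-1 0 eta.
have ih : cintegrable mu (fun x => w x * expi (stdot zeta x - stdot zeta y)).
  apply: cintegrable_expiM => //.
  by apply: measurable_funB => //; apply: measurable_stdot => //; meas.
have [E _] := cint_dilate y e0 ih.
have -> : cint mu (fun z => w (dilate eps y z) * expi (stdot eta z)) =
   cint mu (fun z => w (dilate eps y z) * expi (stdot zeta (dilate eps y z) - stdot zeta y)).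
  by apply: eq_cint => z; rewrite stdot_dilate ?gt_eqF // addrC addKr.
rewrite -E /what -cintZ; last first.
  by apply: cintegrable_expiM => //; apply: measurable_stdot => //; meas.
by apply: eq_cint => x; rewrite addrC expiD mulrCA.
Qed.

Lemma cintegrable_dilated_poisson eps (y : ST n) : 0 < eps ->
  cintegrable mu (fun z => w (dilate eps y z) * (poisson z +i* 0)).
Proof.
move=> e0; have [_ iwd] := cint_dilate y e0 iw.
have iMp := integrableZl measurableT M (integrable_poisson n).
apply: (cintegrable_le _ iMp).
  apply: cmeasurableM; first exact: (cintegrable_measurable iwd).
  by apply: cmeasurable_real; exact: (measurable_integrable (integrable_poisson n)).
move=> z; rewrite Normc.normcM normc_real ger0_norm ?poisson_ge0 //=.
by rewrite ler_wpM2r ?poisson_ge0.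
Qed.

(** The Poisson kernel is the Fourier integral of the Abel kernel, so the
    z-integral becomes a superposition of the previous oscillatory integrals. *)
Lemma smoothed_inner eps (y : ST n) : 0 < eps ->
  ((eps ^+ n.+1) +i* 0) * cint mu (fun z => w (dilate eps y z) * (poisson z +i* 0)) =
  cint mu (fun eta => (abel eta +i* 0) *
    (expi (- stdot (dilate eps^-1 0 eta) y) * what (dilate eps^-1 0 eta))).
Proof.
move=> e0; have [_ iwd] := cint_dilate y e0 iw.
have mwd := cintegrable_measurable iwd.
have ma := measurable_integrable (integrable_abel n).
set r := (eps ^+ n.+1) +i* 0.
pose h (p : ST n * ST n) : R[i] :=
  (w (dilate eps y p.1)) * ((r * (abel p.2 +i* 0)) * expi (stdot p.2 p.1)).
have ia z : cintegrable mu (fun eta : ST n => (abel eta +i* 0) * expi (stdot eta z)).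
  by apply: integrable_tensor_expi; [move=> x; exact: expR_ge0|exact: integrable_expRN_norm].
have iz (eta : ST n) : cintegrable mu (fun z => w (dilate eps y z) * expi (stdot eta z)).
  by apply: cintegrable_expiM => //; apply: measurable_stdot => //; meas.
have hE z eta : h (z, eta) =
    (r * (abel eta +i* 0)) * (w (dilate eps y z) * expi (stdot eta z)).
  by rewrite /h /= mulrCA.
have hE' z eta : h (z, eta) =
    (w (dilate eps y z) * r) * ((abel eta +i* 0) * expi (stdot eta z)).
  by rewrite /h /= !mulrA.
have ih : cintegrable (mu \x mu)%E h.
  have ira := integrableZl measurableT (eps ^+ n.+1) (integrable_abel n).
  apply: (cintegrable_le _ (integrable_prod (integrable_normc iwd) ira)).
    apply: cmeasurableM; first exact: (cmeasurable_comp mwd measurable_fst).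
    apply: cmeasurableM.
      apply: cmeasurableM; first exact: cmeasurable_cst.
      by apply: cmeasurable_real; exact: (measurableT_comp ma measurable_snd).
    by apply: cmeasurable_expi; apply: measurable_stdot; meas.
  move=> p; rewrite !Normc.normcM normc_expi mulr1 !normc_real.
  by rewrite !ger0_norm ?abel_ge0 ?exprn_ge0 // ltW.
have iwp := cintegrable_dilated_poisson y e0.
have -> : r * cint mu (fun z => w (dilate eps y z) * (poisson z +i* 0)) =
    cint mu (fun eta => cint mu (fun z => h (z, eta))).
  rewrite -cintZ // cint_fubini2 //.
    rewrite -cint_fubini1 //.
      apply: eq_cint => z; rewrite (eq_cint _ (hE' z)) cintZ // fourier_abel_poisson.
      by rewrite mulrCA mulrA.
    by move=> z; rewrite (funext (hE' z)); exact: cintegrableZ.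
  by move=> eta; rewrite (funext (fun z => hE z eta)); exact: cintegrableZ.
apply: eq_cint => eta; rewrite (eq_cint _ (fun z => hE z eta)) cintZ //.
by rewrite -dilated_fourier // mulrA [r * _]mulrC.
Qed.

(** The integral over y is a Fourier integral of g at the frequency eta / eps. *)
Lemma smoothed_fourier eps : 0 < eps ->
  ((eps ^+ n.+1) +i* 0) * cint (mu \x mu)%E (smoothed eps) =
  cint mu (fun eta => ((abel eta +i* 0) * what (dilate eps^-1 0 eta)) * ghat (dilate eps^-1 0 eta)).
Proof.
move=> e0.
have ma := measurable_integrable (integrable_abel n).
set r := (eps ^+ n.+1) +i* 0.
pose L := fine (\int[mu]_x (normc (w x))%:E).
have whatL zeta : normc (what zeta) <= L.
  by apply: normc_cint_expi_le => //; apply: measurable_stdot => //; meas.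
have mdil : measurable_fun setT (dilate eps^-1 (0 : ST n)) by exact: measurable_dilate.
pose H (p : ST n * ST n) : R[i] := g p.1 * ((abel p.2 +i* 0) *
  (expi (- stdot (dilate eps^-1 0 p.2) p.1) * what (dilate eps^-1 0 p.2))).
have mA : cmeasurable (fun eta : ST n => abel eta +i* 0) by exact: cmeasurable_real.
have mW : cmeasurable (fun eta : ST n => what (dilate eps^-1 0 eta)).
  exact: (cmeasurable_comp cmeasurable_what mdil).
have mH : cmeasurable H.
  apply: cmeasurableM; first exact: (cmeasurable_comp mg measurable_fst).
  apply: cmeasurableM; first exact: (cmeasurable_comp mA measurable_snd).
  apply: cmeasurableM; last exact: (cmeasurable_comp mW measurable_snd).
  apply: cmeasurable_expi; apply: measurable_fun_opp; apply: measurable_stdot; last by meas.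
  exact: (measurableT_comp mdil measurable_snd).
have HL p : normc (H p) <= normc (g p.1) * (L * abel p.2).
  rewrite /H !Normc.normcM normc_expi mul1r normc_real ger0_norm ?abel_ge0 //.
  by rewrite ler_wpM2l ?normc_ge0 // [L * _]mulrC ler_wpM2l ?abel_ge0.
have iLa : (@lebesgue_spacetime R n).-integrable setT (EFin \o (fun eta => L * abel eta)).
  exact: (integrableZl measurableT L (integrable_abel n)).
have iH : cintegrable (mu \x mu)%E H.
  exact: (cintegrable_le mH (integrable_prod (integrable_normc ig) iLa) HL).
pose F (y eta : ST n) := (abel eta +i* 0) *
  (expi (- stdot (dilate eps^-1 0 eta) y) * what (dilate eps^-1 0 eta)).
have iF y : cintegrable mu (F y).
  apply: (cintegrable_le _ iLa).
    apply: cmeasurableM => //; apply: cmeasurableM => //.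
    apply: cmeasurable_expi; apply: measurable_fun_opp; apply: measurable_stdot; last by meas.
    exact: mdil.
  move=> eta; rewrite !Normc.normcM normc_expi mul1r normc_real ger0_norm ?abel_ge0 //.
  by rewrite [L * _]mulrC ler_wpM2l ?abel_ge0.
have iH1 y : cintegrable mu (fun eta => H (y, eta)) by exact: (cintegrableZ (g y) (iF y)).
have H2E y eta : H (y, eta) = ((abel eta +i* 0) * what (dilate eps^-1 0 eta)) *
   (g y * expi (- stdot (dilate eps^-1 0 eta) y)) by rewrite /H /=; ring.
have ige (zeta : ST n) : cintegrable mu (fun y => g y * expi (- stdot zeta y)).
  apply: cintegrable_expiM => //; apply: measurable_fun_opp.
  by apply: measurable_stdot => //; meas.
have iH2 eta : cintegrable mu (fun y => H (y, eta)).
  by rewrite (funext (fun y => H2E y eta)); exact: cintegrableZ.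
have isz y : cintegrable mu (fun z => smoothed eps (y, z)).
  exact: (cintegrableZ (g y) (cintegrable_dilated_poisson y e0)).
rewrite -cintZ; last exact: cintegrable_smoothed.
rewrite -cint_fubini1; last 2 first.
- exact: (cintegrableZ r (cintegrable_smoothed eps)).
- by move=> y; exact: (cintegrableZ r (isz y)).
transitivity (cint mu (fun y => cint mu (fun eta => H (y, eta)))).
  apply: eq_cint => y; rewrite cintZ // /smoothed /= cintZ; last exact: cintegrable_dilated_poisson.
  by rewrite mulrCA smoothed_inner // -(cintZ _ (iF y)).
rewrite cint_fubini1 // -cint_fubini2 //; apply: eq_cint => eta.
by rewrite (eq_cint _ (fun y => H2E y eta)) cintZ.
Qed.

(** The Abel kernel is at most 1, and rescaling eta produces the same power of
    eps as rescaling z did. *)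
Lemma normc_smoothed_bound eps : 0 < eps ->
  ((normc (cint (mu \x mu)%E (smoothed eps)))%:E
    <= \int[mu]_zeta (normc (what zeta) * normc (ghat zeta))%:E)%E.
Proof.
move=> e0; have r0 : 0 < eps ^+ n.+1 by rewrite exprn_gt0.
have ma := measurable_integrable (integrable_abel n).
pose f (zeta : ST n) : \bar R := (normc (what zeta) * normc (ghat zeta))%:E.
have mf : measurable_fun setT f.
  apply/measurable_EFinP; apply: measurable_funM.
    exact: (measurable_normc cmeasurable_what).
  exact: (measurable_normc cmeasurable_ghat).
have f0 zeta : (0 <= f zeta)%E by rewrite lee_fin mulr_ge0 ?normc_ge0.
have ei0 : 0 < eps^-1 by rewrite invr_gt0.
pose fd eta := f (dilate eps^-1 0 eta).
have mfd : measurable_fun setT fd by exact: (measurableT_comp mf (measurable_dilate _ _)).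
have fE : (\int[mu]_zeta f zeta = (eps^-1 ^+ n.+1)%:E * \int[mu]_eta fd eta)%E.
  exact: ge0_integral_dilate.
rewrite -/f fE; have -> : cint (mu \x mu)%E (smoothed eps) =
    ((eps^-1 ^+ n.+1) +i* 0) * cint mu (fun eta =>
    ((abel eta +i* 0) * what (dilate eps^-1 0 eta)) * ghat (dilate eps^-1 0 eta)).
  rewrite -smoothed_fourier // mulrA.
  have -> : ((eps^-1 ^+ n.+1) +i* 0) * ((eps ^+ n.+1) +i* 0) = 1 :> R[i].
    apply/eqP; rewrite eq_complex /= !mul0r !mulr0 subr0 addr0 -exprMn.
    by rewrite (mulVf (lt0r_neq0 e0)) expr1n !eqxx.
  by rewrite mul1r.
rewrite Normc.normcM normc_real ger0_norm ?exprn_ge0 ?(ltW ei0) // EFinM.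
apply: lee_wpmul2l; first by rewrite lee_fin exprn_ge0 // ltW.
have mh : cmeasurable (fun eta =>
    ((abel eta +i* 0) * what (dilate eps^-1 0 eta)) * ghat (dilate eps^-1 0 eta)).
  have mdil : measurable_fun setT (dilate eps^-1 (0 : ST n)) by exact: measurable_dilate.
  apply: cmeasurableM; last exact: (cmeasurable_comp cmeasurable_ghat mdil).
  apply: cmeasurableM; last exact: (cmeasurable_comp cmeasurable_what mdil).
  exact: cmeasurable_real.
pose L := fine (\int[mu]_x (normc (w x))%:E).
pose G := fine (\int[mu]_x (normc (g x))%:E).
have ih : cintegrable mu (fun eta =>
    ((abel eta +i* 0) * what (dilate eps^-1 0 eta)) * ghat (dilate eps^-1 0 eta)).
  apply: (cintegrable_le mh (integrableZl measurableT (L * G) (integrable_abel n))).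
  move=> eta; rewrite !Normc.normcM normc_real ger0_norm ?abel_ge0 // -mulrA mulrC.
  rewrite ler_wpM2r ?abel_ge0 //; apply: ler_pM; rewrite ?normc_ge0 //.
    by apply: normc_cint_expi_le => //; apply: measurable_stdot => //; meas.
  apply: normc_cint_expi_le => //; apply: measurable_fun_opp.
  by apply: measurable_stdot => //; meas.
apply: le_trans (normc_cint_le ih) _; apply: ge0_le_integral => //.
- by move=> eta _; rewrite lee_fin; exact: normc_ge0.
- by apply/measurable_EFinP; exact: measurable_normc.
- move=> eta _; rewrite lee_fin !Normc.normcM normc_real ger0_norm ?abel_ge0 // -mulrA.
  by rewrite ler_piMl ?abel_le1 // mulr_ge0 // normc_ge0.
Qed.

(** As eps tends to 0, w (y + eps z) tends to w y, and the integral of the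
    Poisson kernel over z factors out. *)
Lemma normc_cint_mul_le : continuous (fun x => complex.Re (w x)) ->
  continuous (fun x => complex.Im (w x)) ->
  (((\int[mu]_z @poisson n z) * normc (cint mu (fun y => g y * w y)))%R%:E
    <= \int[mu]_zeta (normc (what zeta) * normc (ghat zeta))%:E)%E.
Proof.
move=> cR cI.
pose h (yz : ST n * ST n) : R[i] := (g yz.1 * w yz.1) * (poisson yz.2 +i* 0).
have mp := measurable_integrable (integrable_poisson n).
have igw : cintegrable mu (fun y => g y * w y).
  apply: (cintegrable_le _ (integrableZl measurableT M (integrable_normc ig))).
    exact: cmeasurableM.
  by move=> y; rewrite Normc.normcM mulrC ler_wpM2r ?normc_ge0.
have ip : cintegrable mu (fun z : ST n => poisson z +i* 0).
  apply: (cintegrable_le _ (integrable_poisson n)); first exact: cmeasurable_real.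
  by move=> z; rewrite normc_real ger0_norm ?poisson_ge0.
have -> : (\int[mu]_z @poisson n z) * normc (cint mu (fun y => g y * w y)) =
    normc (cint (mu \x mu)%E h).
  have -> : cint (mu \x mu)%E h =
      cint mu (fun y => g y * w y) * cint mu (fun z : ST n => poisson z +i* 0).
    exact: cint_prod.
  rewrite Normc.normcM mulrC; congr (_ * _).
  have -> : cint mu (fun z : ST n => poisson z +i* 0) = (\int[mu]_z @poisson n z) +i* 0.
    by congr (_ +i* _); rewrite /Rintegral integral0.
  rewrite normc_real ger0_norm //.
  by apply: Rintegral_ge0 => z _; exact: poisson_ge0.
have mh : cmeasurable h.
  have mpi : cmeasurable (fun z : ST n => poisson z +i* 0) by exact: cmeasurable_real.
  have mgw := cintegrable_measurable igw.
  by apply: cmeasurableM; [exact: (cmeasurable_comp mgw measurable_fst)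
    |exact: (cmeasurable_comp mpi measurable_snd)].
have dil (y z : ST n) : dilate (j.+1%:R^-1) y z @[j --> \oo] --> y.
  have h0 := @cvg_harmonic R.
  rewrite [X in _ --> X](_ : y = (y.1 + 0 *: z.1, y.2 + 0 * z.2)); last first.
    by rewrite scale0r mul0r !addr0; case: y.
  have c1 : y.1 + (j.+1%:R^-1 : R) *: z.1 @[j --> \oo] --> y.1 + 0 *: z.1.
    by apply: cvgD; [exact: cvg_cst|exact: (cvgZr_tmp h0)].
  have c2 : y.2 + j.+1%:R^-1 * z.2 @[j --> \oo] --> y.2 + 0 * z.2.
    by apply: cvgD; [exact: cvg_cst|exact: (cvgM h0 (cvg_cst _))].
  exact: (cvg_pair c1 c2).
have smE eps (yz : ST n * ST n) : smoothed eps yz =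
    (g yz.1 * (poisson yz.2 +i* 0)) * w (dilate eps yz.1 yz.2).
  by rewrite /smoothed mulrCA mulrC.
have hE (yz : ST n * ST n) : h yz = (g yz.1 * (poisson yz.2 +i* 0)) * w yz.1.
  by rewrite /h mulrAC.
apply: (@cint_cvg _ _ _ _ (fun j => smoothed (j.+1%:R^-1)) h _ _ _ mh
  integrable_smoothed_bound).
- by move=> j; exact: cmeasurable_smoothed.
- by move=> j; exact: normc_smoothed_le.
- move=> [y z]; rewrite hE Re_mulc; under eq_fun do rewrite smE Re_mulc.
  apply: cvgB; apply: cvgM; try exact: cvg_cst.
    exact: (continuous_cvg _ (cR y) (dil y z)).
  exact: (continuous_cvg _ (cI y) (dil y z)).
- move=> [y z]; rewrite hE Im_mulc; under eq_fun do rewrite smE Im_mulc.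
  apply: cvgD; apply: cvgM; try exact: cvg_cst.
    exact: (continuous_cvg _ (cI y) (dil y z)).
  exact: (continuous_cvg _ (cR y) (dil y z)).
- by move=> j; apply: normc_smoothed_bound; rewrite invr_gt0.
Qed.

End bound.
End convolution.

(** * Schwartz functions *)

Section schwartz.
Local Open Scope complex_scope.
Context {R : realType} (n : nat).
Local Notation mR := (measurableTypeR R).
Local Notation leb := (@lebesgue_measure R).
Local Notation ST := ('rV[R]_n * mR)%type.
Local Notation normc := Normc.normc.
Local Notation mu := (@lebesgue_spacetime R n).

Definition lattice_code (N : R) (p : ST) : 'rV[int]_n * int :=
  (\row_i Num.floor (N * p.1 ord0 i), Num.floor (N * p.2)).

Definition lattice_point (N : R) (c : 'rV[int]_n * int) : ST :=
  (\row_i ((c.1 ord0 i)%:~R / N), c.2%:~R / N).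

Lemma measurable_floor_eq (f : ST -> R) (m : int) : measurable_fun setT (f : _ -> mR) ->
  measurable [set p | Num.floor (f p) = m].
Proof.
move=> mf.
have -> : [set p | Num.floor (f p) = m] =
    (fun p => (m%:~R <= f p) && (f p < (m + 1)%:~R)) @^-1` [set true].
  by apply/seteqP; split => p /=; [move=> <-; exact: floor_itv|exact: floor_def].
rewrite -[X in measurable X]setTI.
have mb : measurable_fun setT (fun p => (m%:~R <= f p) && (f p < (m + 1)%:~R)) by meas.
exact: mb.
Qed.

Lemma measurable_lattice (f : ST -> R) (N : R) :
  measurable_fun setT (fun p => f (lattice_point N (lattice_code N p)) : mR).
Proof.
move=> _ Y mY; rewrite setTI.
have -> : (fun p => f (lattice_point N (lattice_code N p))) @^-1` Y =
    \bigcup_c ([set p | lattice_code N p = c] `&` [set _ | Y (f (lattice_point N c))]).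
  by apply/seteqP; split => [p Yp|p [c _ [<-]]] //; exists (lattice_code N p).
apply: countable_bigcupT_measurable => // c; apply: measurableI; last first.
  have [H|H] := pselect (Y (f (lattice_point N c))).
    by rewrite (_ : mkset _ = setT) //; apply/seteqP; split.
  by rewrite (_ : mkset _ = set0) //; apply/seteqP; split.
have -> : [set p | lattice_code N p = c] =
    (\bigcap_(i in [set: 'I_n]) [set p : ST | Num.floor (N * p.1 ord0 i) = c.1 ord0 i])
    `&` [set p : ST | Num.floor (N * p.2) = c.2].
  case: c => c1 c2; apply/seteqP; split => p /=.
    by move=> [<- <-]; split => // i _ /=; rewrite mxE.
  move=> [H1 H2]; rewrite /lattice_code H2; congr pair.
  by apply/rowP => i; rewrite mxE; exact: H1.
apply: measurableI; last by apply: measurable_floor_eq; meas.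
apply: fin_bigcap_measurable => // i _; apply: measurable_floor_eq.
by apply: measurable_funM; meas.
Qed.

Lemma lattice_near (N x : R) : 0 < N -> `|x - (Num.floor (N * x))%:~R / N| <= N^-1.
Proof.
move=> N0; have /andP[h1 h2] := floor_itv (N * x).
have -> : x - (Num.floor (N * x))%:~R / N = (N * x - (Num.floor (N * x))%:~R) / N.
  by field; rewrite gt_eqF.
rewrite normrM [`|N^-1|]gtr0_norm ?invr_gt0 // ler_piMl ?invr_ge0 ?(ltW N0) //.
rewrite ger0_norm ?subr_ge0 // lerBlDl ltW //.
by move: h2; rewrite intrD.
Qed.

(** A continuous function is the limit of its values at the points of finer and
    finer lattices, and rounding to a lattice has measurable cells. *)
Lemma measurable_continuous (f : ST -> R) : continuous f -> measurable_fun setT (f : _ -> mR).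
Proof.
move=> cf; apply: (@measurable_fun_cvg _ _ _ _
  (fun k p => f (lattice_point k.+1%:R (lattice_code k.+1%:R p)))).
  by move=> k; exact: measurable_lattice.
move=> p _; apply: (continuous_cvg _ (cf p)).
have small (e : R) : 0 < e -> \forall k \near \oo, (k.+1%:R^-1 : R) < e.
  move=> e0; have := @cvg_harmonic R; move=> /cvgrPdist_lt /(_ e e0).
  by apply: filterS => k; rewrite sub0r normrN ger0_norm ?invr_ge0.
have c1 : (\row_i ((Num.floor (k.+1%:R * p.1 ord0 i))%:~R / k.+1%:R) : 'rV[R]_n) @[k --> \oo] --> p.1.
  apply/cvg_ballP => e e0; near=> k; split => // i j.
  rewrite !ord1 /ball /= !mxE; apply: le_lt_trans (lattice_near _ _) _ => //.
  by near: k; exact: small.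
have c2 : ((Num.floor (k.+1%:R * p.2))%:~R / k.+1%:R : R) @[k --> \oo] --> p.2.
  apply/cvg_ballP => e e0; near=> k.
  rewrite /ball /=; apply: le_lt_trans (lattice_near _ _) _ => //.
  by near: k; exact: small.
rewrite [X in X @ _ --> _](_ : _ = (fun k : nat =>
    (\row_i ((Num.floor (k.+1%:R * p.1 ord0 i))%:~R / k.+1%:R) : 'rV[R]_n,
     (Num.floor (k.+1%:R * p.2))%:~R / k.+1%:R))).
  by rewrite [X in _ --> X]surjective_pairing; exact: (cvg_pair c1 c2).
apply/funext => k; rewrite /lattice_point /lattice_code /=; congr pair.
by apply/rowP => i; rewrite !mxE.
Unshelve. all: by end_near. Qed.

Lemma real_schwartz_bounded (f : ST -> R) : real_schwartz f ->
  exists M, forall p, `|f p| <= M.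
Proof.
move=> [_ /(_ (fun _ => 0%N) [::])[M HM]]; exists M => p.
by have := HM p; rewrite big1 ?mul1r // => j _; rewrite expr0.
Qed.

(** Expanding the product of the 1 + x_j^2 gives finitely many monomials, each
    of which is controlled by a Schwartz seminorm. *)
Lemma real_schwartz_decay (f : ST -> R) : real_schwartz f ->
  exists M, forall p, `|f p| <= M * tensor (fun x => (1 + x ^+ 2)^-1) p.
Proof.
move=> [_ H].
pose a (h : {ffun option 'I_n -> bool}) (j : option 'I_n) : nat := ((h j) * 2)%N.
have [M HM] := choice (fun h => H (a h) [::]).
exists (\sum_h M h) => p.
have P0 : 0 < \prod_j (st_coord p j ^+ 2 + 1) :> R.
  by apply: prodr_gt0 => j _; rewrite ltr_wpDl ?sqr_ge0.
have -> : tensor (fun x => (1 + x ^+ 2)^-1) p = (\prod_j (st_coord p j ^+ 2 + 1))^-1.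
  rewrite /tensor -prodfV (bigD1 None) //= mulrC addrC; congr (_ * _).
  rewrite (reindex_omap Some id) /=; last by case.
  by apply: eq_big => [i|i _]; rewrite ?eqxx // addrC.
rewrite -ler_pdivrMr ?invr_gt0 // invrK -{1}(gtr0_norm P0) mulrC -normrM.
have -> : \prod_j (st_coord p j ^+ 2 + 1) =
    \sum_(h : {ffun option 'I_n -> bool}) \prod_j st_coord p j ^+ a h j.
  rewrite -(bigA_distr_bigA (fun (j : option 'I_n) (b : bool) => st_coord p j ^+ (b * 2))).
  by apply: eq_bigr => j _; rewrite big_bool /= expr0.
rewrite mulr_suml; apply: le_trans (ler_norm_sum _ _ _) _.
by apply: ler_sum => h _; exact: HM.
Qed.

Lemma integrable_real_schwartz (f : ST -> R) : real_schwartz f ->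
  mu.-integrable setT (EFin \o f).
Proof.
move=> fS; have [M HM] := real_schwartz_decay fS.
have mf := measurable_continuous (proj1 (proj1 fS [::])).
have iT := integrable_tensor n (@inv1sqr_ge0 R) integrable_inv1sqr.
apply: (le_integrable measurableT _ _ (integrableZl measurableT M iT)).
  exact/measurable_EFinP.
by move=> p _ /=; rewrite lee_fin (le_trans (HM p)) // ler_norm.
Qed.

Lemma schwartz_cintegrable (u : ST -> R[i]) : schwartz u -> cintegrable mu u.
Proof. by move=> [u1 u2]; split; exact: integrable_real_schwartz. Qed.

Lemma schwartz_bounded (u : ST -> R[i]) : schwartz u -> exists M, forall p, normc (u p) <= M.
Proof.
move=> [/real_schwartz_bounded[M1 H1] /real_schwartz_bounded[M2 H2]].
exists (M1 + M2) => p; apply: le_trans (lerD (H1 p) (H2 p)).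
apply: ler_sqr_pos; first by rewrite addr_ge0.
by rewrite sqr_modulus sqrrD !real_normK ?num_real // lerD2r lerDl mulrn_wge0 // mulr_ge0.
Qed.

Lemma cintegrable_conjc (u : ST -> R[i]) : cintegrable mu u ->
  cintegrable mu (fun p => conjc (u p)).
Proof.
move=> iu; apply: (cintegrable_le _ (integrable_normc iu)).
  exact: (cmeasurable_conjc (cintegrable_measurable iu)).
by move=> p; rewrite normc_conjc.
Qed.

Lemma measurable_fourier (u : ST -> R[i]) : cmeasurable u -> cmeasurable (fourier u).
Proof.
move=> mu_; apply: (@cmeasurable_cint_snd _ _ _ _ _ mu
  (fun z => expi (- (dot z.2.1 z.1.1 + z.2.2 * z.1.2)) * u z.2)).
apply: cmeasurableM; last exact: (cmeasurable_comp mu_ measurable_snd).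
by apply: cmeasurable_expi; meas.
Qed.

Lemma conjcM (x y : R[i]) : conjc (x * y) = conjc x * conjc y.
Proof. exact: rmorphM. Qed.

(** The case w = conj u and g y = e^(-i y q) conj (v y): conjugation reflects
    frequencies, whence -q - p for v. *)
Lemma fourier_conjM_le (u v : ST -> R[i]) (q : ST) : schwartz u -> schwartz v ->
  (((\int[mu]_z @poisson R n z) * normc (fourier (fun p => conjc (u p) * conjc (v p)) q))%:E
    <= \int[mu]_p (normc (fourier u p) * normc (fourier v (third q p)))%:E)%E.
Proof.
move=> uS vS; have [M HM] := schwartz_bounded uS.
have iu := schwartz_cintegrable uS; have iv := schwartz_cintegrable vS.
have icu := cintegrable_conjc iu; have icv := cintegrable_conjc iv.
have stdotC (a b : ST) : stdot a b = stdot b a.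
  by rewrite /stdot mulrC; congr (_ + _); apply: eq_bigr => i _; rewrite mulrC.
pose g (y : ST) := conjc (v y) * expi (- stdot y q).
have ig : cintegrable mu g.
  by apply: cintegrable_expiM => //; apply: measurable_fun_opp; apply: measurable_stdot => //; meas.
have HM' x : normc (conjc (u x)) <= M by rewrite normc_conjc.
have c1 : continuous (fun x => complex.Re (conjc (u x))).
  rewrite (_ : (fun x => _) = (fun x => complex.Re (u x))); first exact: (proj1 (proj1 uS.1 [::])).
  by apply/funext => x; case: (u x).
have c2 : continuous (fun x => complex.Im (conjc (u x))).
  rewrite (_ : (fun x => _) = (fun x => - complex.Im (u x))).
    by move=> x; apply: cvgN; exact: (proj1 (proj1 uS.2 [::])).
  by apply/funext => x; case: (u x).
have := normc_cint_mul_le icu ig HM' c1 c2.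
have -> : cint mu (fun y => g y * conjc (u y)) =
    fourier (fun p => conjc (u p) * conjc (v p)) q.
  by apply: eq_cint => y; rewrite /g -/(stdot y q) mulrAC mulrC [_ * conjc (u y)]mulrC.
move=> /le_trans; apply; rewrite le_eqVlt; apply/orP; left; apply/eqP.
have iE (h : ST -> R[i]) (b : ST) : cintegrable mu h ->
    cintegrable mu (fun x => expi (- (dot x.1 b.1 + x.2 * b.2)) * h x).
  move=> ih; rewrite (_ : (fun x => _) = (fun x => h x * expi (- stdot x b))); last first.
    by apply/funext => x; rewrite mulrC.
  by apply: cintegrable_expiM => //; apply: measurable_fun_opp; apply: measurable_stdot => //; meas.
have stdot_third (y p : ST) : stdot y (third q p) = - stdot y q - stdot p y.
  have dE : dot y.1 (- q.1 - p.1) = - dot y.1 q.1 - dot y.1 p.1.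
    by rewrite /dot -!sumrN -big_split; apply: eq_bigr => i _; rewrite !mxE /=; ring.
  by rewrite (stdotC p) /stdot /third /= dE; ring.
apply: eq_integral => p _; congr (_ * _)%:E.
  rewrite -[RHS]normc_conjc /fourier -cint_conjc; last exact: iE.
  congr normc; apply: eq_cint => x; rewrite conjcM conjc_expi opprK mulrC.
  by rewrite -/(stdot x p) stdotC.
rewrite -[RHS]normc_conjc /fourier -cint_conjc; last exact: iE.
congr normc; apply: eq_cint => x; rewrite /g conjcM conjc_expi opprK.
by rewrite -/(stdot x (third q p)) stdot_third expiD [RHS]mulrC mulrA.
Qed.

End schwartz.

(** * Duality and the bilinear estimate *)

Section assembly.
Local Open Scope ereal_scope.
Context {R : realType}.
Local Notation mR := (measurableTypeR R).
Local Notation leb := (@lebesgue_measure R).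
Local Notation ST n := ('rV[R]_n * mR)%type.
Local Notation normc := Normc.normc.
Local Notation mu := (@lebesgue_spacetime R _).

Definition Xweight n (sigma beta : R) (q : ST n) : R :=
  (freq_bracket q `^ sigma * modulation_bracket q `^ beta)%R.

Lemma measurable_Xweight n sigma beta :
  measurable_fun setT (@Xweight n sigma beta : _ -> mR).
Proof. by rewrite /Xweight /freq_bracket /modulation_bracket; meas. Qed.

Lemma Xweight_ge0 n sigma beta (q : ST n) : (0 <= Xweight sigma beta q)%R.
Proof. by rewrite mulr_ge0 ?powR_ge0. Qed.

Lemma XnormE n sigma beta (w : ST n -> R[i]) :
  Xnorm sigma beta w =
  (\int[mu]_q ((Xweight sigma beta q * normc (fourier w q)) ^+ 2)%:E) `^ 2^-1.
Proof.
rewrite /Xnorm Lnorm.unlock; congr (_ `^ _); apply: eq_integral => q _.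
by rewrite poweR_EFin ger0_norm ?mulr_ge0 ?powR_ge0 ?normc_ge0 // powR_mulrn // !mulr_ge0 ?powR_ge0 ?normc_ge0.
Qed.

Lemma integral_poisson_gt0 n : (0 < \int[@lebesgue_spacetime R n]_z @poisson R n z)%R.
Proof.
have fin := integrable_fin_num measurableT (@integrable_poisson R n).
rewrite -lte_fin fineK //.
pose b (t : mR) : R := (`|t| <= 1)%R%:R.
have mcube : measurable_fun setT (fun x : 'rV[R]_n => (cube 1 x)%:E).
  by apply/measurable_EFinP; apply: measurable_cube; meas.
have mb : measurable_fun setT (fun t : mR => (b t)%:E) by rewrite /b; meas.
have b0 t : 0 <= (b t)%:E by rewrite lee_fin.
have cube0 (x : 'rV[R]_n) : 0 <= (cube 1 x)%:E by rewrite lee_fin cube_ge0.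
have step : 1%:E <= \int[@lebesgue_spacetime R n]_z ((b z.2)%:E * (cube 1 z.1)%:E).
  rewrite (integral_spacetime_prod mb mcube b0 cube0) integral_norm_le // integral_cube //.
  by rewrite -EFinM lee_fin mulr1 -exprS exprn_ege1 // ler1n.
apply: lt_le_trans (lt_le_trans lte01 step) _.
apply: ge0_le_integral => //.
- by move=> z _; exact: mule_ge0.
- apply: emeasurable_funM; first exact: (measurableT_comp mb measurable_snd).
  exact: (measurableT_comp mcube measurable_fst).
- by apply/measurable_EFinP; exact: (measurable_integrable (integrable_poisson n)).
have le1 (x : R) : (`|x| <= 1 -> 1 <= 2 / (1 + x ^+ 2))%R.
  move=> x1; have p : (0 < 1 + x ^+ 2)%R by rewrite ltr_pwDl // sqr_ge0.
  rewrite ler_pdivlMr // mul1r.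
  by have : (`|x| ^+ 2 <= 1)%R; [rewrite expr_le1|rewrite real_normK ?num_real //; lra].
move=> z _; rewrite -EFinM lee_fin /b.
have [h|_] := leP `|z.2|%R 1%R; last by rewrite mul0r poisson_ge0.
rewrite mul1r; have [->|[-> Hz]] := cubeP 1 z.1; first exact: poisson_ge0.
rewrite /poisson /tensor -[leLHS](mulr1 1%R); apply: ler_pM => //; last exact: le1.
apply: (big_ind (fun x : R => 1 <= x)%R) => // [x y x1 y1|j _]; last exact: le1.
by rewrite -[leLHS](mulr1 1%R); apply: ler_pM.
Qed.

Section duality.
Context (n : nat) (K : ST n * ST n -> R) (U V H : ST n -> R) (w1 w2 w3 : ST n -> R) (c0 C : R).
Hypotheses (mU : measurable_fun setT (U : _ -> mR)) (mV : measurable_fun setT (V : _ -> mR))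
  (mH : measurable_fun setT (H : _ -> mR)).
Hypotheses (U0 : forall q, (0 <= U q)%R) (V0 : forall q, (0 <= V q)%R)
  (H0 : forall q, (0 <= H q)%R).
Hypotheses (mw3 : measurable_fun setT (w3 : _ -> mR)) (w30 : forall q, (0 <= w3 q)%R).
Hypothesis KE : forall p q, (K (p, q) * w1 p * w2 q = w3 (third p q))%R.
Hypotheses (c0_gt0 : (0 < c0)%R) (C0 : (0 <= C)%R).
Hypothesis conv : forall q, (c0 * H q)%:E <= \int[mu]_p (U p * V (third q p))%:E.
Let F1 q := (w1 q * U q)%:E.
Let F2 q := (w2 q * V q)%:E.
Hypothesis KC : forall F3 : ST n -> \bar R, measurable_fun setT F3 -> (forall q, 0 <= F3 q) ->
  (trilinear K F1 F2 F3) ^+ 2 <=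
  C%:E * (\int[mu]_q F1 q ^+ 2 * \int[mu]_q F2 q ^+ 2 * \int[mu]_q F3 q ^+ 2).

(** With I the integral of P^2, and A and B those of F1^2 and F2^2, testing the
    trilinear form on P gives a value T with c0 I <= T, whereas T^2 <= C A B I;
    a finite positive I can be cancelled. *)
Lemma truncated_duality (P : ST n -> R) : measurable_fun setT (P : _ -> mR) ->
  (forall q, P q = 0 \/ P q = w3 q * H q)%R ->
  \int[mu]_q (P q ^+ 2)%:E < +oo ->
  \int[mu]_q (P q ^+ 2)%:E <= (C / c0 ^+ 2)%:E * (\int[mu]_q F1 q ^+ 2 * \int[mu]_q F2 q ^+ 2).
Proof.
move=> mP HP Pfin.
have P0 q : (0 <= P q)%R by case: (HP q) => ->; rewrite ?mulr_ge0.
pose G q := (w3 q * P q)%R.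
have G0 q : (0 <= G q)%R by rewrite mulr_ge0.
have mG : measurable_fun setT (G : _ -> mR) by exact: measurable_funM.
set I := \int[mu]_q (P q ^+ 2)%:E in Pfin *.
have I0 : 0 <= I by apply: integral_ge0 => q _; rewrite lee_fin sqr_ge0.
have mPE : measurable_fun setT (fun q => (P q)%:E) by exact/measurable_EFinP.
pose f (pq : ST n * ST n) : \bar R := (U pq.1 * V pq.2 * G (third pq.1 pq.2))%:E.
have mf : measurable_fun setT f by rewrite /f; meas.
have f0 pq : 0 <= f pq by rewrite lee_fin !mulr_ge0.
have TE : trilinear K F1 F2 (fun q => (P q)%:E) = \int[mu \x mu]_pq f pq.
  apply: eq_integral => -[p q] _; rewrite /f /G /F1 /F2 /= -KE -!EFinM; congr EFin; ring.
have fE : \int[mu \x mu]_pq f pq = \int[mu]_q ((G q)%:E * \int[mu]_p (U p * V (third q p))%:E).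
  have mf' : measurable_fun setT (fun pq : ST n * ST n => f (pq.1, third pq.1 pq.2)).
    by apply: (measurableT_comp mf); meas.
  rewrite -(integral_third_pair mf f0).
  rewrite (@fubini_tonelli2 _ _ _ _ _ mu mu _ mf' (fun pq => f0 _)).
  apply: eq_integral => q _.
  rewrite -ge0_integralZl //; last 3 first.
  - by meas.
  - by move=> p _; rewrite lee_fin mulr_ge0.
  - by rewrite lee_fin.
  by apply: eq_integral => p _; rewrite /f /= thirdK -EFinM thirdC; congr EFin; ring.
have low : c0%:E * I <= trilinear K F1 F2 (fun q => (P q)%:E).
  rewrite TE fE /I -ge0_integralZl ?lee_fin ?(ltW c0_gt0) //; last 2 first.
  - by meas.
  - by move=> q _; rewrite lee_fin sqr_ge0.
  have mconv : measurable_fun setT (fun q => \int[mu]_p (U p * V (third q p))%:E).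
    apply: (@measurable_integral_snd _ _ _ _ _ mu
      (fun z : ST n * ST n => (U z.2 * V (third z.1 z.2))%:E)); first by meas.
    by move=> z; rewrite lee_fin mulr_ge0.
  apply: ge0_le_integral => //.
  - by move=> q _; rewrite mule_ge0 ?lee_fin ?sqr_ge0 // ltW.
  - by meas.
  - by apply: emeasurable_funM => //; apply/measurable_EFinP.
  move=> q _; apply: (@le_trans _ _ ((G q)%:E * (c0 * H q)%:E)); last first.
    by apply: lee_wpmul2l; rewrite ?lee_fin.
  rewrite -!EFinM lee_fin /G; case: (HP q) => ->.
    by rewrite mulr0 mul0r expr0n mulr0.
  by rewrite le_eqVlt; apply/orP; left; apply/eqP; ring.
have T0 : 0 <= trilinear K F1 F2 (fun q => (P q)%:E).
  by rewrite TE; apply: integral_ge0 => pq _; exact: f0.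
have KCP : (trilinear K F1 F2 (fun q => (P q)%:E)) ^+ 2 <=
    C%:E * (\int[mu]_q F1 q ^+ 2 * \int[mu]_q F2 q ^+ 2 * I).
  by apply: KC => // q; rewrite lee_fin.
have Z0 : 0 <= \int[mu]_q F1 q ^+ 2 * \int[mu]_q F2 q ^+ 2.
  by apply: mule_ge0; apply: integral_ge0 => q _; rewrite expe2 -EFinM lee_fin -expr2 sqr_ge0.
move: (\int[mu]_q F1 q ^+ 2 * \int[mu]_q F2 q ^+ 2) Z0 KCP => Z Z0 KCP.
have c2 : (0 < c0 ^+ 2)%R by rewrite exprn_gt0.
case: I I0 Pfin low KCP => [i||] //; rewrite lee_fin => i0 _ low KCP.
have [->|ip] := eqVneq i 0%R; first by rewrite mule_ge0 // lee_fin divr_ge0 // ltW.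
have {ip i0} i0 : (0 < i)%R by rewrite lt_neqAle eq_sym ip.
have sq : (c0%:E * i%:E) ^+ 2 <= (trilinear K F1 F2 (fun q => (P q)%:E)) ^+ 2.
  by rewrite !expe2; apply: lee_pmul => //; rewrite -EFinM lee_fin mulr_ge0 // ltW.
have {sq KCP} := le_trans sq KCP.
have -> : (c0%:E * i%:E) ^+ 2 = (c0 ^+ 2 * i)%:E * i%:E.
  by rewrite expe2 -!EFinM; congr EFin; ring.
rewrite muleA lee_pmul2r ?lte_fin // => H1.
have -> : i%:E = (c0 ^+ 2)^-1%:E * (c0 ^+ 2 * i)%:E.
  by rewrite -EFinM mulKf // gt_eqF.
rewrite [X in _ <= X * Z](_ : _ = (c0 ^+ 2)^-1%:E * C%:E); last by rewrite -EFinM mulrC.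
rewrite -muleA; apply: lee_wpmul2l => //.
by rewrite lee_fin invr_ge0 ltW.
Qed.

(** Truncation to sets of finite measure on which the function is bounded makes
    its L^2 norm finite; these sets exhaust the space. *)
Lemma duality_bound :
  \int[mu]_q ((w3 q * H q) ^+ 2)%:E
    <= (C / c0 ^+ 2)%:E * (\int[mu]_q F1 q ^+ 2 * \int[mu]_q F2 q ^+ 2).
Proof.
have [S [ST_ ndS Sfin]] := (sigma_finiteP _ _).1 (sigma_finiteT (@lebesgue_spacetime R n)).
pose Q q := (w3 q * H q)%R.
have Q0 q : (0 <= Q q)%R by rewrite mulr_ge0.
have mQ : measurable_fun setT (Q : _ -> mR) by exact: measurable_funM.
pose P (m : nat) q : R := (\1_(S m) q * (Q q <= m%:R)%R%:R * Q q)%R.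
have mind m : measurable_fun setT (\1_(S m) : ST n -> mR).
  exact: measurable_indic (Sfin m).1.
have mP m : measurable_fun setT (P m : _ -> mR).
  have mb : measurable_fun setT (fun q => (Q q <= m%:R)%R%:R : mR) by meas.
  exact: (measurable_funM (measurable_funM (mind m) mb) mQ).
have mP2 m : measurable_fun setT (fun q => (P m q ^+ 2)%:E).
  by apply/measurable_EFinP; apply: measurable_funX; exact: mP.
have P_alt m q : (P m q = 0 \/ P m q = Q q)%R.
  rewrite /P indicE; case: (q \in S m); last by left; rewrite !mul0r.
  by rewrite mul1r; case: (Q q <= _)%R; rewrite ?mul1r ?mul0r; [right|left].
have P_le m q : ((P m q) ^+ 2 <= m%:R ^+ 2 * \1_(S m) q)%R.
  rewrite /P indicE; case: (q \in S m); last by rewrite !mul0r expr0n mulr0.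
  rewrite mul1r mulr1; have [h|h] := leP (Q q) m%:R; last by rewrite mul0r expr0n sqr_ge0.
  by rewrite mul1r ler_pXn2r ?nnegrE.
have Pfin m : \int[mu]_q (P m q ^+ 2)%:E < +oo.
  apply: (@le_lt_trans _ _ ((m%:R ^+ 2)%:E * mu (S m))); last first.
    by apply: lte_mul_pinfty; rewrite ?lee_fin ?sqr_ge0 //; exact: (Sfin m).2.
  apply: (@le_trans _ _ (\int[mu]_q (m%:R ^+ 2 * \1_(S m) q)%:E)).
    apply: ge0_le_integral => //.
    - by move=> q _; rewrite lee_fin sqr_ge0.
    - have mI : measurable_fun setT (fun q => m%:R ^+ 2 * \1_(S m) q : mR)%R.
        exact: (measurable_funM (measurable_cst _) (mind m)).
      exact: ((measurable_EFinP _ _).2 mI).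
    - by move=> q _; rewrite lee_fin.
  under eq_integral do rewrite EFinM.
  rewrite ge0_integralZl ?lee_fin ?sqr_ge0 //; last exact: ((measurable_EFinP _ _).2 (mind m)).
  by rewrite integral_indic ?setIT //; exact: (Sfin m).1.
have Pnd q : nondecreasing_seq (fun m => (P m q ^+ 2)%:E).
  move=> m k mk; have [->|Pm] := P_alt m q; first by rewrite expr0n lee_fin sqr_ge0.
  suff -> : P k q = P m q by [].
  have [Q0'|Qn] := eqVneq (Q q) 0%R; first by rewrite /P Q0' !mulr0.
  have : (P m q != 0)%R by rewrite Pm.
  rewrite /P !indicE; case: (boolP (q \in S m)) => qm; last by rewrite !mul0r eqxx.
  have -> : q \in S k.
    by move: qm; rewrite !inE; move: q {Pm Qn}; exact/subsetPset/ndS.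
  have [h _|_] := leP (Q q) m%:R; last by rewrite mulr0 mul0r eqxx.
  by rewrite (le_trans h) ?ler_nat // !mul1r.
have Pcvg q : (fun m => (P m q ^+ 2)%:E) @ \oo --> (Q q ^+ 2)%:E.
  have [m0 _ qm0] : (\bigcup_i S i) q by rewrite -ST_.
  apply: cvg_near_cst; near=> m.
  have qm : q \in S m.
    rewrite inE; move: qm0; have : (m0 <= m)%N by near: m; exact: nbhs_infty_ge.
    by move=> /ndS /subsetPset; apply.
  have Qm : (Q q <= m%:R)%R.
    near: m; have [k Hk] : exists k : nat, (Q q <= k%:R)%R.
      by exists (Num.truncn (Q q)).+1; rewrite ltW // truncnS_gt.
    by near=> m; apply: le_trans Hk _; rewrite ler_nat; near: m; exact: nbhs_infty_ge.
  by rewrite /P indicE qm Qm !mul1r.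
have := @cvg_monotone_convergence _ _ _ (@lebesgue_spacetime R n) setT measurableT
  (fun m q => (P m q ^+ 2)%:E).
have -> : \int[mu]_q limn (fun m => (P m q ^+ 2)%:E) = \int[mu]_q (Q q ^+ 2)%:E.
  by apply: eq_integral => q _; exact: (cvg_lim _ (Pcvg q)).
move=> cv; apply: (cvge_to_le (cv _ _ _)).
- exact: mP2.
- by move=> m q _; rewrite lee_fin sqr_ge0.
- by move=> q _; exact: Pnd.
- by apply: nearW => m; apply: truncated_duality.
Unshelve. all: by end_near. Qed.

End duality.
Local Close Scope ereal_scope.

Lemma weight_cancel (a1 a2 b l1 l2 m : R) : a1 != 0 -> a2 != 0 -> l1 != 0 -> l2 != 0 ->
  a1^-1 * a2^-1 * b * (l1^-1 * l2^-1 * m) * (a1 * l1) * (a2 * l2) = b * m.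
Proof. by move=> ha1 ha2 hl1 hl2; field; rewrite ha1 ha2 hl1 hl2. Qed.

Lemma bilinear_estimate_of_trilinear_bounded n s theta :
  trilinear_bounded (@bilinear_weight R n (- s) theta) ->
  exists C : R, 0 < C /\
    forall u v : ST n -> R[i], schwartz u -> schwartz v ->
      (Xnorm s (theta - 1) (fun p => (conjc (u p) * conjc (v p))%R)
        <= C%:E * Xnorm s theta u * Xnorm s theta v)%E.
Proof.
move=> [C C0 HC].
set c0 := \int[@lebesgue_spacetime R n]_z @poisson R n z.
have c0_gt0 : 0 < c0 by exact: integral_poisson_gt0.
set A : R := C / c0 ^+ 2 + 1.
have A0 : 0 < A by rewrite ltr_wpDl // divr_ge0 // sqr_ge0.
exists (A `^ 2^-1); split; first exact: powR_gt0.
move=> u v uS vS; rewrite !XnormE.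
have iu := schwartz_cintegrable uS; have iv := schwartz_cintegrable vS.
pose U (q : ST n) := normc (fourier u q); pose V (q : ST n) := normc (fourier v q).
pose H (q : ST n) := normc (fourier (fun p => conjc (u p) * conjc (v p)) q).
have mU : measurable_fun setT (U : _ -> mR).
  by apply: measurable_normc; apply: measurable_fourier; exact: (cintegrable_measurable iu).
have mV : measurable_fun setT (V : _ -> mR).
  by apply: measurable_normc; apply: measurable_fourier; exact: (cintegrable_measurable iv).
have mH : measurable_fun setT (H : _ -> mR).
  apply: measurable_normc; apply: measurable_fourier; apply: cmeasurableM.
    by apply: cmeasurable_conjc; exact: (cintegrable_measurable iu).
  by apply: cmeasurable_conjc; exact: (cintegrable_measurable iv).
pose w1 := @Xweight n s theta; pose w3 := @Xweight n s (theta - 1).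
have mF (f : ST n -> R) : measurable_fun setT (f : _ -> mR) ->
    measurable_fun setT (fun q => (w1 q * f q)%:E).
  by move=> mf; apply/measurable_EFinP; apply: measurable_funM => //; exact: measurable_Xweight.
have KE p q : bilinear_weight (- s) theta (p, q) * w1 p * w1 q = w3 (third p q).
  rewrite /w1 /w3 /Xweight /bilinear_weight /= opprK !powRN.
  apply: weight_cancel; rewrite gt_eqF // powR_gt0 //;
    by [exact: freq_bracket_gt0|exact: modulation_bracket_gt0].
have sqE (f : ST n -> R) : (\int[mu]_q ((f q)%:E ^+ 2) = \int[mu]_q ((f q) ^+ 2)%:E)%E.
  by apply: eq_integral => q _; rewrite expe2 -EFinM -expr2.
have conv (q : ST n) :
    ((c0 * H q)%:E <= \int[mu]_p (U p * V (third q p))%:E)%E.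
  exact: (fourier_conjM_le q uS vS).
have := @duality_bound n (bilinear_weight (- s) theta) U V H w1 w1 w3 c0 C
  mU mV mH (fun=> normc_ge0 _) (fun=> normc_ge0 _) (fun=> normc_ge0 _)
  (@measurable_Xweight n s (theta - 1)) (@Xweight_ge0 n s (theta - 1)) KE c0_gt0 C0
  conv
  (fun F3 mF3 F30 => HC _ _ F3 (mF _ mU) (mF _ mV) mF3
     (fun q => mulr_ge0 (@Xweight_ge0 n s theta q) (normc_ge0 _))
     (fun q => mulr_ge0 (@Xweight_ge0 n s theta q) (normc_ge0 _)) F30).
rewrite !sqE => D.
have I0 (f : ST n -> R) : (0 <= \int[mu]_q ((f q) ^+ 2)%:E)%E.
  by apply: integral_ge0 => q _; rewrite lee_fin sqr_ge0.
rewrite -poweR_EFin -muleA -poweRM // -poweRM ?mule_ge0 ?lee_fin ?(ltW A0) //.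
have inI (x : \bar R) : (0 <= x)%E -> x \in `[0, +oo]%E.
  by move=> x0; rewrite in_itv /= x0 leey.
apply: gt0_ler_poweR; rewrite ?invr_ge0 // ?inI ?mule_ge0 ?lee_fin ?(ltW A0) //.
apply: le_trans D _; apply: lee_wpmul2r; first exact: mule_ge0 (I0 _) (I0 _).
by rewrite lee_fin lerDl.
Qed.

End assembly.

Theorem proposition3p4 (R : realType) (n : nat) (s theta : R)
    (hadm : admissible n s theta) :
  exists C : R, 0 < C /\
    forall u v : 'rV[R]_n * R -> R[i], schwartz u -> schwartz v ->
      (Xnorm s (theta - 1) (fun p => (conjc (u p) * conjc (v p))%R)
        <= C%:E * Xnorm s theta u * Xnorm s theta v)%E.
Proof.
by apply: bilinear_estimate_of_trilinear_bounded; exact: trilinear_bounded_admissible.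
Qed.
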